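(* Let $c,\epsilon,\Delta x,\Delta y,\Delta t>0$ with $\frac{c\Delta t}{\epsilon}\le\min(\Delta x,\Delta y)$. Consider in two space dimensions, with $q=(u,v,p)$, the acoustic system $$\partial_tu+\tfrac c\epsilon\partial_xp=0,\qquad\partial_tv+\tfrac c\epsilon\partial_yp=0,\qquad\partial_tp+\tfrac c\epsilon(\partial_xu+\partial_yv)=0$$ and an equidistant Cartesian grid. Let $q^n_{\mathrm{recon}}$ be the piecewise constant function equal to $q^n_{ij}=(u^n_{ij},v^n_{ij},p^n_{ij})$ in the cell with center $\mathbf x_{ij}$ (with $(q^n_{ij})$ bounded), and define the multidimensional Godunov scheme by $q^{n+1}_{ij}=(A\,T_{\Delta t}\,q^n_{\mathrm{recon}})(\mathbf x_{ij})$. Then, all grid functions on the right being evaluated at time level $n$ and index $(i,j)$, $$u^{n+1}_{ij}=u-\frac{c\Delta t}{2\epsilon\Delta x}\big(D_xp-D_{xx}u\big)-\frac12\frac{(c\Delta t)^2}{\epsilon^2\Delta x\Delta y}\Big(-\frac1{2\pi}D_{xx}D_{yy}u-\frac14D_xD_yv+\frac14D_xD_{yy}p\Big),$$ $$v^{n+1}_{ij}=v-\frac{c\Delta t}{2\epsilon\Delta y}\big(D_yp-D_{yy}v\big)-\frac12\frac{(c\Delta t)^2}{\epsilon^2\Delta x\Delta y}\Big(-\frac1{2\pi}D_{xx}D_{yy}v-\frac14D_xD_yu+\frac14D_{xx}D_yp\Big),$$ $$\begin{aligned}p^{n+1}_{ij}={}&p-\frac{c\Delta t}{2\epsilon\Delta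 x}\big(D_xu-D_{xx}p\big)-\frac{c\Delta t}{2\epsilon\Delta y}\big(D_yv-D_{yy}p\big)\\&-\frac12\frac{(c\Delta t)^2}{\epsilon^2\Delta x\Delta y}\Big(\frac14D_xD_{yy}u+\frac14D_{xx}D_yv-2\cdot\frac1{2\pi}D_{xx}D_{yy}p\Big).\end{aligned}$$
   Context: For a grid function $q_{ij}$: $(D_xq)_{ij}=q_{i+1,j}-q_{i-1,j}$, $(D_yq)_{ij}=q_{i,j+1}-q_{i,j-1}$, $(D_{xx}q)_{ij}=q_{i+1,j}-2q_{ij}+q_{i-1,j}$, $(D_{yy}q)_{ij}=q_{i,j+1}-2q_{ij}+q_{i,j-1}$; products denote composition. $T_t$ is the evolution operator mapping initial data to the (distributional) solution at time $t$: a $C^1$ map from $[0,\infty)$ into distributions satisfying the equations for every $t$ as identities of distributions, with the given initial data. $A$ is the cell average: $(Aq)(\mathbf x)=\frac1{\Delta x\Delta y}\int_{[-\frac{\Delta x}2,\frac{\Delta x}2]\times[-\frac{\Delta y}2,\frac{\Delta y}2]}q(\mathbf x+\mathbf s)\,d\mathbf s$. Cell $(i,j)$ is the rectangle of size $\Delta x\times\Delta y$ centered at $\mathbf x_{ij}$. *)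

(* Defs.v *)
From HB Require Import structures.
From mathcomp Require Import all_boot all_order all_algebra.
From mathcomp Require Import all_classical all_reals all_analysis.
Set Implicit Arguments.
Unset Strict Implicit.
Unset Printing Implicit Defensive.
Import Order.TTheory GRing.Theory Num.Theory.
Import numFieldNormedType.Exports.
Local Open Scope classical_set_scope.
Local Open Scope ring_scope.

Section Distributions.
Variable R : realType.
Implicit Types (f g phi psi : R * R -> R) (T : (R * R -> R) -> R).

Definition e_x : R * R := (1, 0).
Definition e_y : R * R := (0, 1).

(* Iterated partial derivatives; in the multi-index s, true stands for d/dx and
   false for d/dy. *)
Fixpoint partial (s : seq bool) f : R * R -> R :=
  if s is b :: s' then 'D_(if b then e_x else e_y) (partial s' f) else f.

Definition smooth f := forall s x, differentiable (partial s f) x.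

Definition support_in (K : set (R * R)) f := forall x, ~ K x -> f x = 0.

Definition test_function phi :=
  smooth phi /\ exists2 K, compact K & support_in K phi.

(* A distribution is a functional of which only the values at test functions are
   meaningful: two functionals are the same distribution when they agree on test
   functions.  Continuity is the seminorm criterion
   |T phi| <= C * max_(|s| <= N) sup |partial s phi|  on every compact set K,
   the maximum being replaced by an arbitrary upper bound M of it. *)
Definition is_distribution T :=
  (forall (a : R) phi psi, test_function phi -> test_function psi ->
     T (fun x => a * phi x + psi x) = a * T phi + T psi) /\
  (forall K, compact K -> exists N : nat, exists C : R,
     forall phi (M : R), test_function phi -> support_in K phi ->
       (forall s x, (size s <= N)%N -> `|partial s phi x| <= M) ->
       `|T phi| <= C * M).

Definition ddistr (v : R * R) T : (R * R -> R) -> R := fun phi => - T ('D_v phi).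

Definition lebesgue2 : set (measurableTypeR R * measurableTypeR R) -> \bar R :=
  (@lebesgue_measure R \x @lebesgue_measure R)%E.

Definition locally_integrable2 f :=
  measurable_fun [set: measurableTypeR R * measurableTypeR R] f /\
  forall K : set (R * R), compact K ->
    (\int[lebesgue2]_(x in K) `|f x|%:E < +oo)%E.

Definition distr_of_fun f : (R * R -> R) -> R :=
  fun phi => \int[lebesgue2]_(x in setT) (f x * phi x).

(* T is a C^1 map from [0, +oo[ into distributions (with their weak topology),
   of derivative dT.  The difference quotient is one-sided at t = 0, and nothing
   is required of T and dT at negative times. *)
Definition C1_distr (T dT : R -> (R * R -> R) -> R) :=
  (forall t, 0 <= t -> is_distribution (T t) /\ is_distribution (dT t)) /\
  (forall phi, test_function phi ->
     (forall t, 0 <= t ->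
        h^-1 * (T (t + h) phi - T t phi)
          @[h --> within [set h : R | 0 <= t + h] (0 : R)^'] --> dT t phi) /\
     {within `[0, +oo[, continuous (fun t => dT t phi)}).

Definition acoustic_solution (c eps : R) (U V P : R -> (R * R -> R) -> R) :=
  exists dU dV dP : R -> (R * R -> R) -> R,
    [/\ C1_distr U dU, C1_distr V dV, C1_distr P dP &
      forall t phi, 0 <= t -> test_function phi ->
        [/\ dU t phi + c / eps * ddistr e_x (P t) phi = 0,
            dV t phi + c / eps * ddistr e_y (P t) phi = 0 &
            dP t phi
              + c / eps * (ddistr e_x (U t) phi + ddistr e_y (V t) phi) = 0]].

Definition has_initial_data (T : R -> (R * R -> R) -> R) f :=
  forall phi, test_function phi -> T 0 phi = distr_of_fun f phi.

Definition cell_average (dx dy : R) f (x : R * R) : R :=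
  1 / (dx * dy) *
  \int[lebesgue2]_(s in `[- (dx / 2), dx / 2] `*` `[- (dy / 2), dy / 2])
     f (x.1 + s.1, x.2 + s.2).

(* (A T)(x) = a for a distribution T.  Evaluating the integral A requires T to be
   given by a locally integrable function; this is asserted here, not assumed.
   Since this function is unique up to a null set, the value a is unique. *)
Definition distr_cell_average (dx dy : R) T (x : R * R) (a : R) :=
  exists f, [/\ locally_integrable2 f,
    forall phi, test_function phi -> T phi = distr_of_fun f phi &
    cell_average dx dy f x = a].

End Distributions.

Section Grid.
Variable R : realType.
Implicit Types q : int -> int -> R.

Definition Dx q : int -> int -> R := fun i j => q (i + 1) j - q (i - 1) j.
Definition Dy q : int -> int -> R := fun i j => q i (j + 1) - q i (j - 1).
Definition Dxx q : int -> int -> R :=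
  fun i j => q (i + 1) j - 2 * q i j + q (i - 1) j.
Definition Dyy q : int -> int -> R :=
  fun i j => q i (j + 1) - 2 * q i j + q i (j - 1).

Definition bounded_grid q := exists M : R, forall i j, `|q i j| <= M.

(* The origin x0 of the grid, the center of cell (0, 0), is arbitrary. *)
Definition cell_center (x0 : R * R) (dx dy : R) (i j : int) : R * R :=
  (x0.1 + i%:~R * dx, x0.2 + j%:~R * dy).

(* Cells are taken half-open: x lies in cell (i, j) when
   i - 1/2 <= (x.1 - x0.1) / dx < i + 1/2, and likewise for j and x.2.  As a
   distribution, recon does not depend on the values on the cell edges. *)
Definition recon (x0 : R * R) (dx dy : R) q (x : R * R) : R :=
  q (Num.floor ((x.1 - x0.1) / dx + 1 / 2))
    (Num.floor ((x.2 - x0.2) / dy + 1 / 2)).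

End Grid.

(* Main.v *)
(** The proof avoids an explicit solution formula for the initial data.  Let Z_t
    and W_t = dZ_t/dt be the operators on test functions given by spherical means
    over S^2 (method of descent), so that dW_t/dt = 1 + Z_t lap.  They yield an
    explicit backward solution of the acoustic system for smooth data, and pairing
    it with the distributional solution gives a functional that is separately
    differentiable in the two times; the Chernoff-Royden theorem makes it depend
    on their sum only.  Hence U, V, P at time dt are the initial data tested
    against 1 + Z dx dx, Z dx dy, W dx, and so on, at radius r = c dt / eps.

    On one cell, a derivative in front of Z or W turns the cell integral into
    integrals over opposite edges (for Z after one integration by parts on the
    sphere).  The resulting functionals are integrals of the test function over
    the edge smeared by a sphere, hence have integrable densities by
    Radon-Nikodym, and the mass of such a density in a neighbouring cell is a
    trigonometric integral because r <= min(dx, dy).  Summing over the cells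
    gives the stencil. *)
From HB Require Import structures.
Require Import Defs.
From mathcomp Require Import all_boot all_order all_algebra.
From mathcomp Require Import all_classical all_reals all_analysis measurable_realfun.
From mathcomp Require Import ring lra zify.
Set Implicit Arguments.
Unset Strict Implicit.
Unset Printing Implicit Defensive.
Import Order.TTheory GRing.Theory Num.Theory.
Import numFieldNormedType.Exports.
Local Open Scope classical_set_scope.
Local Open Scope ring_scope.

(** * Calculus of test functions in the plane *)

Lemma differentiable_littleo (K : numFieldType) (V W : normedModType K)
    (f : V -> W) (df : {linear V -> W}) (x : V) : continuous df ->
  (forall e, 0 < e -> \forall v \near (0 : V), `|f (x + v) - f x - df v| <= e * `|v|) ->
  differentiable f x /\ 'd f x = df :> (V -> W).
Proof.
move=> cdf H.
have E : f \o shift x = cst (f x) + df +o_ 0 id.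
  apply/eqaddoP => e e0; near=> v => /=.
  rewrite fctE /= [v + x]addrC /cst /= opprD addrA.
  by near: v; exact: H.
by split; [apply/diff_locallyP; rewrite (diff_unique cdf E)|exact: diff_unique].
Unshelve. all: by end_near. Qed.

Section PlaneCalculus.
Context {R : realType}.
Implicit Types (phi psi : R * R -> R) (x y v : R * R) (t s : R).

Lemma mvt_R (f df : R -> R) (a b : R) :
  (forall z : R, is_derive z 1 f (df z)) ->
  exists c, `|c - a| <= `|b - a| /\ f b - f a = df c * (b - a).
Proof.
move=> Df.
have cf : continuous f.
  by move=> z; apply: differentiable_continuous; apply/derivable1_diffP; apply: ex_derive.
have [ab|ba] := leP a b.
  have [c cab E] := MVT_segment ab (fun z _ => Df z) (continuous_subspaceT cf).
  exists c; split => //; move: cab; rewrite in_itv /= => /andP[ac cb].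
  by rewrite !ger0_norm ?subr_ge0// lerD2r.
have [c cab E] := MVT_segment (ltW ba) (fun z _ => Df z) (continuous_subspaceT cf).
exists c; split; last by lra.
move: cab; rewrite in_itv /= => /andP[ac cb].
by rewrite distrC (distrC b) !ger0_norm ?subr_ge0// ?(ltW ba)// lerB.
Qed.

Lemma is_derive_comp2 (f : R * R -> R) (g1 g2 : R -> R) t (d1 d2 : R) :
  differentiable f (g1 t, g2 t) ->
  is_derive t 1 g1 d1 -> is_derive t 1 g2 d2 ->
  is_derive t 1 (fun s => f (g1 s, g2 s))
    (d1 * 'D_(e_x R) f (g1 t, g2 t) + d2 * 'D_(e_y R) f (g1 t, g2 t)).
Proof.
move=> df dg1 dg2.
have D1 : differentiable g1 t by apply/derivable1_diffP; apply: ex_derive.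
have D2 : differentiable g2 t by apply/derivable1_diffP; apply: ex_derive.
have Dp := differentiable_pair D1 D2.
have -> : (fun s => f (g1 s, g2 s)) = f \o (fun s => (g1 s, g2 s)) by [].
have Dc : differentiable (f \o (fun s => (g1 s, g2 s))) t.
  exact: differentiable_comp.
apply: DeriveDef; first exact: diff_derivable.
rewrite deriveE// diff_comp//= diff_pair//=.
rewrite -!deriveE// (derive_val (is_derive := dg1)) (derive_val (is_derive := dg2)) !deriveE//.
have -> : (d1, d2) = d1 *: e_x R + d2 *: e_y R :> R * R.
  by congr pair; rewrite /= ?scaler0 ?mulr1 ?addr0 ?add0r// /GRing.scale/= ?mulr1 ?mulr0 ?addr0 ?add0r.
by rewrite linearD !linearZ.
Qed.

Lemma differentiable_quadratic_remainder (f : R * R -> R) x (a b C : R) :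
  (forall v, `|f (x + v) - f x - (v.1 * a + v.2 * b)| <= C * (`|v.1| + `|v.2|) ^+ 2) ->
  [/\ differentiable f x, 'D_(e_x R) f x = a & 'D_(e_y R) f x = b].
Proof.
move=> H.
pose d v := v.1 * a + v.2 * b.
have lin_d : linear d.
  by move=> k u v; rewrite /d /= /GRing.scale/=; ring.
pose dlM := GRing.isLinear.Build _ _ _ _ _ lin_d.
pose dL : {linear _ -> _} := HB.pack d dlM.
have cd : continuous dL.
  move=> z; rewrite /= /d; apply: cvgD; apply: cvgMl; [exact: cvg_fst|exact: cvg_snd].
have C0 : 0 <= C.
  have := H (1, 0); rewrite /= normr0 normr1 addr0 expr1n mulr1.
  exact: le_trans.
have E e : 0 < e -> \forall v \near (0 : R * R), `|f (x + v) - f x - dL v| <= e * `|v|.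
  move=> e0; near=> v.
  apply: (le_trans (H v)).
  have n1 : `|v.1| <= `|v| by rewrite prod_normE le_max lexx.
  have n2 : `|v.2| <= `|v| by rewrite prod_normE le_max lexx orbT.
  have n3 : (`|v.1| + `|v.2|) ^+ 2 <= 4 * `|v| * `|v|.
    have := normr_ge0 v.1; have := normr_ge0 v.2; nra.
  apply: (le_trans (ler_wpM2l C0 n3)).
  rewrite mulrA ler_wpM2r//.
  have : `|v| < e / (4 * C + 1).
    near: v; apply: (@nbhs0_lt R (R * R)%type); apply: divr_gt0 => //; lra.
  rewrite ltr_pdivlMr; last lra.
  have := normr_ge0 v; nra.
have [Df dE] := differentiable_littleo cd E.
split => //; rewrite deriveE// dE /= /d /= ; ring.
Unshelve. all: by end_near. Qed.

Lemma is_derive_quadratic_remainder (f : R -> R) (t a C : R) :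
  (forall h, `|f (t + h) - f t - h * a| <= C * h ^+ 2) -> is_derive t 1 f a.
Proof.
move=> H.
pose dd (h : R) := h * a.
have lin_d : linear dd by move=> z u v; rewrite /dd /= /GRing.scale/=; ring.
pose dlM := GRing.isLinear.Build _ _ _ _ _ lin_d.
pose dL : {linear _ -> _} := HB.pack dd dlM.
have cd : continuous dL by move=> z; exact: mulrr_continuous.
have C0 : 0 <= C by have := H 1; rewrite expr1n mulr1; exact: le_trans.
have E (e : R) : 0 < e -> \forall v \near (0 : R), `|f (t + v) - f t - dL v| <= e * `|v|.
  move=> e0; near=> v; apply: (le_trans (H v)).
  rewrite -[v ^+ 2]real_normK ?num_real// expr2 mulrA ler_wpM2r//.
  have : `|v| < e / (C + 1).
    near: v; apply: (@nbhs0_lt R R); apply: divr_gt0 => //; lra.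
  rewrite ltr_pdivlMr; last lra.
  have := normr_ge0 v; nra.
have [Df dE] := differentiable_littleo cd E.
apply: DeriveDef; first exact: diff_derivable.
by rewrite deriveE// dE /= /dd mul1r.
Unshelve. all: by end_near. Qed.

Lemma partial_cat (l l' : seq bool) phi :
  partial l (partial l' phi) = partial (l ++ l') phi.
Proof. by elim: l => //= c l ->. Qed.

Lemma norm_le_box (x : R * R) r : (`|x| <= r) = (`|x.1| <= r) && (`|x.2| <= r).
Proof. by rewrite prod_normE ge_max. Qed.

Lemma compact_box r : compact [set x : R * R | `|x| <= r].
Proof.
rewrite (_ : [set x | _] = `[-r, r] `*` `[-r, r]).
  by apply: compact_setX; exact: segment_compact.
apply/seteqP; split => x /=; rewrite norm_le_box !in_itv /= !ler_norml.
  by move=> /andP[].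
by move=> [-> ->].
Qed.

Lemma test_functionP phi : test_function phi <->
  smooth phi /\ exists r : R, forall x, r < `|x| -> phi x = 0.
Proof.
split=> [[sphi [K cK Kphi]]|[sphi [r Hr]]]; split => //.
  have [M [_ HM]] := compact_bounded cK.
  exists (M + 1) => x Mx; apply: Kphi => Kx.
  have := HM (M + 1) _ x Kx; rewrite ltrDl ltr01 => /(_ isT).
  by rewrite /= leNgt Mx.
exists [set x : R * R | `|x| <= r]; first exact: compact_box.
by move=> x /=; rewrite leNgt => /negP; rewrite negbK; exact: Hr.
Qed.

Lemma smooth_partial phi l : smooth phi -> smooth (partial l phi).
Proof. by move=> sphi l' x; rewrite partial_cat; exact: sphi. Qed.

Lemma test_function_partial phi l : test_function phi ->
  test_function (partial l phi).
Proof.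
move=> /test_functionP[sphi [r Hr]]; apply/test_functionP; split.
  exact: smooth_partial.
exists r; elim: l => //= b l IH x rx.
have near0 : \forall h \near (0 : R)^', (partial l phi \o shift x) (h *: (if b then e_x R else e_y R)) = 0.
  have co : {for 0, continuous (fun h : R => `|h *: (if b then e_x R else e_y R) + x|)}.
    apply: (@continuous_comp _ _ _ _ (fun z : R * R => `|z|)); last exact: norm_continuous.
    apply: cvgD; last exact: cvg_cst.
    exact: scalel_continuous.
  apply: cvg_within.
  have : \forall h \near (0:R), r < `|h *: (if b then e_x R else e_y R) + x|.
    apply: (co [set z | r < z]); rewrite /= scale0r add0r.
    exact: lt_nbhsr.
  by apply: filterS => h; exact: IH.
rewrite /derive; apply: cvg_lim => //.
apply: (@cvg_trans _ ((cst (0:R)) @ (0:R)^')); last exact: cvg_cst.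
apply: near_eq_cvg; apply: filterS near0 => h /= ->.
by rewrite IH// subr0 scaler0.
Qed.

Lemma test_function_bounded phi : test_function phi ->
  exists M : R, 0 <= M /\ forall x, `|phi x| <= M.
Proof.
move=> /test_functionP[sphi [r Hr]].
have cphi : continuous phi by move=> x; apply: differentiable_continuous; exact: (sphi [::]).
have /compact_bounded[M [_ HM]] : compact (phi @` [set x : R * R | `|x| <= r]).
  apply: continuous_compact; last exact: compact_box.
  exact: continuous_subspaceT.
exists (`|M| + 1); split => [|x]; first by rewrite addr_ge0.
have [xr|rx] := leP `|x| r; last by rewrite Hr// normr0 addr_ge0.
apply: (HM (`|M| + 1)); last by exists x.
by rewrite (le_lt_trans (ler_norm M))// ltrDl.
Qed.

Lemma is_derive_lin (a df dg : R) (f g : R * R -> R) x v :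
  is_derive x v f df -> is_derive x v g dg ->
  is_derive x v (fun y => a * f y + g y) (a * df + dg).
Proof. by move=> Df Dg; exact: is_deriveD (is_deriveZ a Df) Dg. Qed.

Lemma partial_lin (a : R) phi psi l : smooth phi -> smooth psi ->
  partial l (fun x => a * phi x + psi x) =
  (fun x => a * partial l phi x + partial l psi x).
Proof.
move=> sphi spsi; elim: l => //= b l ->; apply/funext => x.
set v := if b then _ else _.
have D1 := derivableP (@diff_derivable _ _ _ _ _ v (sphi l x)).
have D2 := derivableP (@diff_derivable _ _ _ _ _ v (spsi l x)).
exact: (derive_val (is_derive := is_derive_lin a D1 D2)).
Qed.

Lemma test_function_lin (a : R) phi psi : test_function phi -> test_function psi ->
  test_function (fun x => a * phi x + psi x).
Proof.
move=> /test_functionP[sphi [r Hr]] /test_functionP[spsi [q Hq]].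
apply/test_functionP; split.
  move=> l x; rewrite partial_lin//.
  exact: (differentiableD (differentiableZ a (sphi l x)) (spsi l x)).
exists (Num.max r q) => x; rewrite gt_max => /andP[rx qx].
by rewrite Hr// Hq// mulr0 addr0.
Qed.

Definition swap_pt x : R * R := (x.2, x.1).

Lemma derive_swap phi v x :
  'D_v (phi \o swap_pt) x = 'D_(swap_pt v) phi (swap_pt x).
Proof. by []. Qed.

Lemma partial_swap phi l : partial l (phi \o swap_pt) =
  partial (map negb l) phi \o swap_pt.
Proof.
elim: l => //= b l ->; apply/funext => x; rewrite derive_swap /=.
by case: b.
Qed.

Lemma differentiable_swap phi x :
  differentiable phi (swap_pt x) -> differentiable (phi \o swap_pt) x.
Proof.
move=> dphi; apply: differentiable_comp; last exact: dphi.
apply: differentiable_pair.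
  suff [] : [/\ differentiable (fun y : R * R => y.2) x,
    'D_(e_x R) (fun y : R * R => y.2) x = 0 & 'D_(e_y R) (fun y : R * R => y.2) x = 1] by [].
  apply: (@differentiable_quadratic_remainder _ _ _ _ 0) => v /=.
  by rewrite mul0r (_ : _ - _ = 0) ?normr0//; ring.
suff [] : [/\ differentiable (fun y : R * R => y.1) x,
  'D_(e_x R) (fun y : R * R => y.1) x = 1 & 'D_(e_y R) (fun y : R * R => y.1) x = 0] by [].
apply: (@differentiable_quadratic_remainder _ _ _ _ 0) => v /=.
by rewrite mul0r (_ : _ - _ = 0) ?normr0//; ring.
Qed.

Lemma test_function_swap phi : test_function phi -> test_function (phi \o swap_pt).
Proof.
move=> /test_functionP[sphi [r Hr]]; apply/test_functionP; split.
  by move=> l x; rewrite partial_swap; apply: differentiable_swap; exact: sphi.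
by exists r => x rx; apply: Hr; rewrite prod_normE /= maxC -prod_normE.
Qed.

Lemma pair_addE x v : x + v = (x.1 + v.1, x.2 + v.2).
Proof. by case: x; case: v. Qed.

Lemma is_derive_fst phi (y s : R) : smooth phi ->
  is_derive s 1 (fun s => phi (s, y)) ('D_(e_x R) phi (s, y)).
Proof.
move=> sphi; have := is_derive_comp2 (sphi [::] (s, y)) (is_derive_id s 1) (is_derive_cst y s 1).
by rewrite mul1r mul0r addr0.
Qed.

Lemma is_derive_snd phi (x s : R) : smooth phi ->
  is_derive s 1 (fun s => phi (x, s)) ('D_(e_y R) phi (x, s)).
Proof.
move=> sphi; have := is_derive_comp2 (sphi [::] (x, s)) (is_derive_cst x s 1) (is_derive_id s 1).
by rewrite mul1r mul0r add0r.
Qed.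

Lemma mvt_fst phi (a h y : R) : smooth phi ->
  exists c, `|c| <= `|h| /\ phi (a + h, y) - phi (a, y) = 'D_(e_x R) phi (a + c, y) * h.
Proof.
move=> sphi; have [c [ch E]] := mvt_R a (a + h) (fun s => is_derive_fst y s sphi).
by exists (c - a); move: ch E; rewrite subrKC [a + h]addrC addrK => ch ->.
Qed.

Lemma mvt_snd phi (x a h : R) : smooth phi ->
  exists c, `|c| <= `|h| /\ phi (x, a + h) - phi (x, a) = 'D_(e_y R) phi (x, a + c) * h.
Proof.
move=> sphi; have [c [ch E]] := mvt_R a (a + h) (fun s => is_derive_snd x s sphi).
by exists (c - a); move: ch E; rewrite subrKC [a + h]addrC addrK => ch ->.
Qed.

Lemma test_function_lipschitz phi : test_function phi ->
  exists M : R, 0 <= M /\ forall x v, `|phi (x + v) - phi x| <= M * (`|v.1| + `|v.2|).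
Proof.
move=> tphi; have [sphi _] := tphi.
have [M1 [M10 HM1]] := test_function_bounded (test_function_partial [:: true] tphi).
have [M2 [M20 HM2]] := test_function_bounded (test_function_partial [:: false] tphi).
exists (M1 + M2); split => [|x v]; first exact: addr_ge0.
have [c1 [_ E1]] := mvt_fst x.1 v.1 (x.2 + v.2) sphi.
have [c2 [_ E2]] := mvt_snd x.1 x.2 v.2 sphi.
have -> : phi (x + v) - phi x =
    (phi (x.1 + v.1, x.2 + v.2) - phi (x.1, x.2 + v.2)) +
    (phi (x.1, x.2 + v.2) - phi (x.1, x.2)).
  by rewrite pair_addE -!surjective_pairing; ring.
rewrite E1 E2 (le_trans (ler_normD _ _))// !normrM.
have := HM1 (x.1 + c1, x.2 + v.2); have := HM2 (x.1, x.2 + c2); rewrite /=.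
have := normr_ge0 v.1; have := normr_ge0 v.2; nra.
Qed.

Lemma test_function_taylor phi : test_function phi ->
  exists C : R, 0 <= C /\ forall x v,
   `|phi (x + v) - phi x - (v.1 * 'D_(e_x R) phi x + v.2 * 'D_(e_y R) phi x)|
     <= C * (`|v.1| + `|v.2|) ^+ 2.
Proof.
move=> tphi; have [sphi _] := tphi.
have [M1 [M10 HM1]] := test_function_lipschitz (test_function_partial [:: true] tphi).
have [M2 [M20 HM2]] := test_function_lipschitz (test_function_partial [:: false] tphi).
exists (M1 + M2); split => [|x v]; first exact: addr_ge0.
have [c1 [c1v E1]] := mvt_fst x.1 v.1 (x.2 + v.2) sphi.
have [c2 [c2v E2]] := mvt_snd x.1 x.2 v.2 sphi.
have -> : phi (x + v) - phi x =
    (phi (x.1 + v.1, x.2 + v.2) - phi (x.1, x.2 + v.2)) +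
    (phi (x.1, x.2 + v.2) - phi (x.1, x.2)).
  by rewrite pair_addE -!surjective_pairing; ring.
have {HM1} := HM1 x (c1, v.2); have {HM2} := HM2 x (0, c2).
rewrite !pair_addE /= normr0 add0r addr0 => HM2 HM1.
rewrite E1 E2.
set D1 := 'D_(e_x R) phi _ in HM1 E1 *; set D2 := 'D_(e_y R) phi _ in HM2 E2 *.
set d1 := 'D_(e_x R) phi x in HM1 *; set d2 := 'D_(e_y R) phi x in HM2 *.
rewrite (_ : _ - _ = (D1 - d1) * v.1 + (D2 - d2) * v.2); last by ring.
rewrite (le_trans (ler_normD _ _))// !normrM.
have n1 := normr_ge0 v.1; have n2 := normr_ge0 v.2.
have p1 : `|D1 - d1| <= M1 * (`|v.1| + `|v.2|).
  by apply: (le_trans HM1); rewrite ler_wpM2l// lerD2r.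
have p2 : `|D2 - d2| <= M2 * (`|v.1| + `|v.2|).
  by apply: (le_trans HM2); rewrite ler_wpM2l// (le_trans c2v)// lerDr.
have q1 := ler_wpM2r n1 p1; have q2 := ler_wpM2r n2 p2.
apply: (le_trans (lerD q1 q2)).
set S := `|v.1| + `|v.2|.
rewrite (_ : (M1 + M2) * S ^+ 2 = M1 * S * S + M2 * S * S); last by ring.
have S0 : 0 <= S by exact: addr_ge0.
by apply: lerD; apply: ler_wpM2l; rewrite ?mulr_ge0// ?lerDl ?lerDr.
Qed.

Lemma second_difference phi : test_function phi -> exists C : R, 0 <= C /\ forall x h, 0 <= h ->
  `|phi (x.1 + h, x.2 + h) - phi (x.1, x.2 + h) - phi (x.1 + h, x.2) + phi x
    - h ^+ 2 * 'D_(e_y R) ('D_(e_x R) phi) x| <= C * h ^+ 3.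
Proof.
move=> tphi; have [sphi _] := tphi.
have tphix := test_function_partial [:: true] tphi.
have [C [C0 HC]] := test_function_taylor tphix.
exists (5 * C); split => [|x h h0]; first by rewrite mulr_ge0.
pose g s := phi (s, x.2 + h) - phi (s, x.2).
have Dg (s : R) : is_derive s 1 g ('D_(e_x R) phi (s, x.2 + h) - 'D_(e_x R) phi (s, x.2)).
  by apply: is_deriveB; exact: is_derive_fst.
have [c [ch Ec]] := mvt_R x.1 (x.1 + h) Dg.
rewrite [x.1 + h]addrC addrK in ch Ec.
have -> : phi (x.1 + h, x.2 + h) - phi (x.1, x.2 + h) - phi (x.1 + h, x.2) + phi x = g (h + x.1) - g x.1.
  have -> : phi x = phi (x.1, x.2) by rewrite -surjective_pairing.
  by rewrite /g [h + _]addrC; ring.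
rewrite Ec.
have H1 := HC x (c - x.1, h); have H2 := HC x (c - x.1, 0).
rewrite !pair_addE /= normr0 !subrKC addr0 mul0r !addr0 in H1 H2.
set F1 := 'D_(e_x R) phi (c, _); set F2 := 'D_(e_x R) phi (c, _).
set A1 := 'D_(e_x R) ('D_(e_x R) phi) x; set A2 := 'D_(e_y R) ('D_(e_x R) phi) x.
set F := 'D_(e_x R) phi x.
rewrite !(ger0_norm h0) in ch H1.
rewrite (_ : _ - _ = h * ((F1 - F - ((c - x.1) * A1 + h * A2)) - (F2 - F - (c - x.1) * A1))); last by ring.
rewrite normrM (ger0_norm h0).
have n := normr_ge0 (c - x.1).
have S1 : C * (`|c - x.1| + h) ^+ 2 <= C * (4 * h ^+ 2) by apply: ler_wpM2l => //; nra.
have S2 : C * `|c - x.1| ^+ 2 <= C * h ^+ 2 by apply: ler_wpM2l => //; nra.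
rewrite (_ : 5 * C * h ^+ 3 = h * (C * (4 * h ^+ 2) + C * h ^+ 2)); last by ring.
apply: ler_wpM2l => //; apply: (le_trans (ler_normB _ _)).
by apply: lerD; [exact: le_trans S1|exact: le_trans S2].
Qed.

Lemma test_function_schwarz phi : test_function phi ->
  'D_(e_y R) ('D_(e_x R) phi) = 'D_(e_x R) ('D_(e_y R) phi).
Proof.
move=> tphi; apply/funext => x.
have [C1 [C10 H1]] := second_difference tphi.
have [C2 [C20 H2]] := second_difference (test_function_swap tphi).
apply/eqP; rewrite -subr_eq0 -normr_le0; apply/ler_addgt0Pl => e e0; rewrite addr0.
set A := 'D_(e_y R) _ x; set B := 'D_(e_x R) _ x.
pose h := e / (C1 + C2 + 1).
have h0 : 0 < h by apply: divr_gt0 => //; lra.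
have {H1} := H1 x h (ltW h0); have {H2} := H2 (swap_pt x) h (ltW h0); rewrite /=.
have -> : 'D_(e_y R) ('D_(e_x R) (phi \o swap_pt)) (swap_pt x) = B.
  have /(congr1 (fun f => f (swap_pt x))) /= -> := partial_swap phi [:: false; true].
  by rewrite /B /swap_pt /= -surjective_pairing.
rewrite /swap_pt /= -surjective_pairing => H2 H1.
have : `|h ^+ 2 * (A - B)| <= (C1 + C2) * h ^+ 3.
  have -> : h ^+ 2 * (A - B) =
    (phi (x.1 + h, x.2 + h) - phi (x.1 + h, x.2) - phi (x.1, x.2 + h) + phi x - h ^+ 2 * B)
     - (phi (x.1 + h, x.2 + h) - phi (x.1, x.2 + h) - phi (x.1 + h, x.2) + phi x - h ^+ 2 * A).
    by ring.
  apply: (le_trans (ler_normB _ _)); rewrite mulrDl.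
  by apply: le_trans (lerD H2 H1) _; rewrite addrC.
have -> : (C1 + C2) * h ^+ 3 = h ^+ 2 * ((C1 + C2) * h) by ring.
rewrite normrM (ger0_norm (exprn_ge0 _ (ltW h0))) ler_pM2l ?exprn_gt0// => H.
apply: (le_trans H); have C12 : 0 < C1 + C2 + 1 by rewrite ltr_wpDl// addr_ge0.
rewrite /h mulrA ler_pdivrMr// mulrC ler_wpM2l ?ltW//.
by rewrite ltrDl.
Qed.

End PlaneCalculus.

(** * Bounded integrands *)

Section PlaneMeasurability.
Context {R : realType}.

Lemma open_measurable_plane (U : set (R * R)) :
  open U -> (measurable : set (set (measurableTypeR R * measurableTypeR R))) U.
Proof.
move=> oU.
pose cell (q : rat * rat * nat) : set (measurableTypeR R * measurableTypeR R) :=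
  (`]ratr q.1.1 - q.2.+1%:R^-1, ratr q.1.1 + q.2.+1%:R^-1[%classic : set R) `*`
  (`]ratr q.1.2 - q.2.+1%:R^-1, ratr q.1.2 + q.2.+1%:R^-1[%classic : set R).
rewrite (_ : U = \bigcup_q (if `[< cell q `<=` U >] then cell q else set0)); last first.
  apply/seteqP; split => [x Ux|x [q _]]; last by case: asboolP => // H /H.
  have /nbhs_ballP[e /= e0 He] : nbhs x U by apply: open_nbhs_nbhs; split.
  have [n ne] : exists n : nat, n.+1%:R^-1 < e / 2 :> R.
    have e20 : 0 < e / 2 by rewrite divr_gt0.
    by exists (Num.truncn (e / 2)^-1); rewrite invf_plt ?posrE// truncnS_gt.
  have n0 : 0 < n.+1%:R^-1 :> R by rewrite invr_gt0.
  have Q (z : R) : exists q : rat, `|ratr q - z| < n.+1%:R^-1.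
    have /rat_in_itvoo[q] : z < z + n.+1%:R^-1 by rewrite ltrDl.
    rewrite in_itv /= => /andP[zq qz]; exists q.
    by rewrite gtr0_norm ?subr_gt0// ltrBlDl.
  have [q1 Hq1] := Q x.1; have [q2 Hq2] := Q x.2.
  exists (q1, q2, n) => //=.
  move: Hq1 Hq2; rewrite !ltr_norml => /andP[a1 a2] /andP[a3 a4].
  case: asboolP => [_|[]].
    set k := n.+1%:R^-1 in a1 a2 a3 a4 *.
    have b1 : ratr q1 - k < x.1 by lra.
    have b2 : x.1 < ratr q1 + k by lra.
    have b3 : ratr q2 - k < x.2 by lra.
    have b4 : x.2 < ratr q2 + k by lra.
    by split; rewrite /= in_itv /=; apply/andP.
  move=> y [] /=; rewrite !in_itv /= => /andP[b1 b2] /andP[b3 b4].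
  set k := n.+1%:R^-1 in a1 a2 a3 a4 b1 b2 b3 b4 ne.
  by apply: He; split; rewrite /ball /= ltr_norml; apply/andP; split; lra.
apply: countable_bigcupT_measurable => // q; case: asboolP => // _.
by apply: measurableX; exact: measurable_itv.
Qed.

Lemma continuous_measurable_plane (f : R * R -> R) : continuous f ->
  measurable_fun [set: measurableTypeR R * measurableTypeR R] f.
Proof.
move=> /continuousP cf; apply: (measurability _ (RGenOpens.measurableE R)).
move=> _ [_ [a [b ->] <-]]; rewrite setTI; apply: open_measurable_plane.
exact/cf/interval_open.
Qed.
End PlaneMeasurability.

Section BoundedIntegrals.
Context d (T : measurableType d) (R : realType) (mu : {measure set T -> \bar R}).
Variables (D : set T).
Hypotheses (mD : measurable D) (muD : (mu D < +oo)%E).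

Lemma bounded_integrable (f : T -> R) (M : R) : measurable_fun setT f ->
  (forall w, D w -> `|f w| <= M) -> mu.-integrable D (EFin \o f).
Proof.
move=> mf fM; apply: measurable_bounded_integrable => //.
  exact: measurable_funTS.
exists M; split; first exact: num_real.
by move=> N MN w Dw; apply: (le_trans (fM w Dw)); exact: ltW.
Qed.

Lemma Rintegral_bounded (f : T -> R) (M : R) : measurable_fun setT f ->
  (forall w, D w -> `|f w| <= M) ->
  `|\int[mu]_(w in D) f w| <= M * fine (mu D).
Proof.
move=> mf fM; have intf := bounded_integrable mf fM.
apply: (le_trans (le_normr_Rintegral mD intf)).
rewrite -Rintegral_cst//; apply: le_Rintegral => //.
  exact: integrable_norm.
by apply: (bounded_integrable (M := `|M|)) => // w _ /=.
Qed.

End BoundedIntegrals.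

Section Smear.
Context d (T : measurableType d) (R : realType) (mu : {measure set T -> \bar R}).
Variables (D : set T).
Hypotheses (mD : measurable D) (muD : (mu D < +oo)%E).
Implicit Types (k g : T -> R) (phi : R * R -> R).

Definition bmeas (D : set T) k :=
  measurable_fun setT k /\ exists c : R, 0 <= c /\ forall w, D w -> `|k w| <= c.

Lemma bmeasM k g : bmeas D k -> bmeas D g -> bmeas D (fun w => k w * g w).
Proof.
move=> [mk [a [a0 ka]]] [mg [b [b0 gb]]]; split; first exact: measurable_funM.
exists (a * b); split => [|w Dw]; first exact: mulr_ge0.
by rewrite normrM ler_pM// ?ka ?gb.
Qed.

Lemma bmeasD k g : bmeas D k -> bmeas D g -> bmeas D (fun w => k w + g w).
Proof.
move=> [mk [a [a0 ka]]] [mg [b [b0 gb]]]; split; first exact: measurable_funD.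
exists (a + b); split => [|w Dw]; first exact: addr_ge0.
by rewrite (le_trans (ler_normD _ _))// lerD ?ka ?gb.
Qed.

Lemma bmeas_cst (a : R) : bmeas D (fun=> a).
Proof. by split => //; exists `|a|. Qed.

Lemma bmeasZ (a : R) k : bmeas D k -> bmeas D (fun w => a * k w).
Proof. by apply: bmeasM; exact: bmeas_cst. Qed.

Lemma bmeasB k g : bmeas D k -> bmeas D g -> bmeas D (fun w => k w - g w).
Proof.
move=> bk bg; have := bmeasD bk (bmeasZ (-1) bg).
by rewrite (_ : (fun w => _ + _) = (fun w => k w - g w))//; apply/funext => w; rewrite mulN1r.
Qed.

Lemma bmeas_integrable k : bmeas D k -> mu.-integrable D (EFin \o k).
Proof. by move=> [mk [c [_ kc]]]; exact: (bounded_integrable _ _ _ kc). Qed.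

Lemma bRintegralD k g : bmeas D k -> bmeas D g ->
  \int[mu]_(w in D) (k w + g w) = \int[mu]_(w in D) k w + \int[mu]_(w in D) g w.
Proof. by move=> bk bg; rewrite RintegralD//; exact: bmeas_integrable. Qed.

Lemma bRintegralB k g : bmeas D k -> bmeas D g ->
  \int[mu]_(w in D) (k w - g w) = \int[mu]_(w in D) k w - \int[mu]_(w in D) g w.
Proof. by move=> bk bg; rewrite RintegralB//; exact: bmeas_integrable. Qed.

Lemma bRintegralZ (a : R) k : bmeas D k ->
  \int[mu]_(w in D) (a * k w) = a * \int[mu]_(w in D) k w.
Proof. by move=> bk; rewrite RintegralZl//; exact: bmeas_integrable. Qed.

Lemma bRintegral_lin4 k g X Y (a b : R) :
  bmeas D k -> bmeas D g -> bmeas D X -> bmeas D Y ->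
  bmeas D (fun w => k w - g w - (a * X w + b * Y w)) /\
  \int[mu]_(w in D) k w - \int[mu]_(w in D) g w
     - (a * \int[mu]_(w in D) X w + b * \int[mu]_(w in D) Y w) =
  \int[mu]_(w in D) (k w - g w - (a * X w + b * Y w)).
Proof.
move=> bk bg bX bY; have Za := bmeasZ a bX; have Zb := bmeasZ b bY.
have H1 := bmeasB bk bg; have H2 := bmeasD Za Zb; split; first exact: bmeasB.
by rewrite bRintegralB// bRintegralB// bRintegralD// !bRintegralZ.
Qed.

Definition smear k g1 g2 (t : R) phi (x : R * R) : R :=
  \int[mu]_(w in D) (k w * phi (x.1 + t * g1 w, x.2 + t * g2 w)).

Variables (g1 g2 : T -> R).
Hypotheses (bg1 : bmeas D g1) (bg2 : bmeas D g2).

Let lin_meas t (x : R * R) : measurable_fun setT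
  (fun w => (x.1 + t * g1 w, x.2 + t * g2 w) : measurableTypeR R * measurableTypeR R).
Proof.
apply: measurable_fun_pair.
  by apply: measurable_funD => //; apply: measurable_funM => //; exact: bg1.1.
by apply: measurable_funD => //; apply: measurable_funM => //; exact: bg2.1.
Qed.

Lemma bmeas_comp_test phi t x : test_function phi ->
  bmeas D (fun w => phi (x.1 + t * g1 w, x.2 + t * g2 w)).
Proof.
move=> tphi; have [M [M0 HM]] := test_function_bounded tphi; split; last by exists M.
apply: (measurableT_comp _ (lin_meas t x)).
apply: continuous_measurable_plane => y; apply: differentiable_continuous.
by case: tphi => sphi _; exact: (sphi [::]).
Qed.

Lemma bmeas_smear k phi t x : bmeas D k -> test_function phi ->
  bmeas D (fun w => k w * phi (x.1 + t * g1 w, x.2 + t * g2 w)).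
Proof. by move=> bk tphi; apply: bmeasM => //; exact: bmeas_comp_test. Qed.

Lemma smear_lin k a phi psi t x : bmeas D k -> test_function phi -> test_function psi ->
  smear k g1 g2 t (fun y => a * phi y + psi y) x =
  a * smear k g1 g2 t phi x + smear k g1 g2 t psi x.
Proof.
move=> bk tphi tpsi; have I1 := bmeas_smear t x bk tphi; have I2 := bmeas_smear t x bk tpsi.
rewrite /smear -bRintegralZ// -bRintegralD//; last exact: bmeasZ.
by apply: eq_Rintegral => w _; ring.
Qed.

Lemma smear_bounded k : bmeas D k -> exists c : R, 0 <= c /\
  forall t phi M x, test_function phi -> (forall y, `|phi y| <= M) ->
  `|smear k g1 g2 t phi x| <= c * M.
Proof.
move=> bk; have [mk [c [c0 kc]]] := bk; exists (c * fine (mu D)); split.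
  by rewrite mulr_ge0// fine_ge0.
move=> t phi M x tphi HM; rewrite -mulrA [fine _ * _]mulrC mulrA.
apply: Rintegral_bounded => //.
  by apply: measurable_funM => //; case: (bmeas_comp_test t x tphi).
move=> w Dw; rewrite normrM ler_pM// ?kc//.
Qed.

Lemma smear_differentiable k t phi x : bmeas D k -> test_function phi ->
  [/\ differentiable (smear k g1 g2 t phi) x,
    'D_(e_x R) (smear k g1 g2 t phi) x = smear k g1 g2 t ('D_(e_x R) phi) x &
    'D_(e_y R) (smear k g1 g2 t phi) x = smear k g1 g2 t ('D_(e_y R) phi) x].
Proof.
move=> bk tphi; have [mk [c [c0 kc]]] := bk.
have [C [C0 HC]] := test_function_taylor tphi.
have tx := test_function_partial [:: true] tphi.
have ty := test_function_partial [:: false] tphi.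
apply: (@differentiable_quadratic_remainder _ _ _ _ _ (c * C * fine (mu D))) => v.
have [bA E] := bRintegral_lin4 v.1 v.2 (bmeas_smear t (x + v) bk tphi)
  (bmeas_smear t x bk tphi) (bmeas_smear t x bk tx) (bmeas_smear t x bk ty).
rewrite /smear {}E mulrAC; apply: Rintegral_bounded => //; first exact: bA.1.
move=> w Dw; pose y := (x.1 + t * g1 w, x.2 + t * g2 w).
have -> : ((x + v).1 + t * g1 w, (x + v).2 + t * g2 w) = y + v.
  by rewrite !pair_addE /=; congr pair; ring.
rewrite -/y (_ : _ - _ = k w * (phi (y + v) - phi y - (v.1 * 'D_(e_x R) phi y + v.2 * 'D_(e_y R) phi y))).
  by rewrite normrM -mulrA ler_pM// kc.
by rewrite /=; ring.
Qed.

Lemma partial_smear k t phi l : bmeas D k -> test_function phi ->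
  partial l (smear k g1 g2 t phi) = smear k g1 g2 t (partial l phi).
Proof.
move=> bk tphi; elim: l => //= b l ->; apply/funext => x.
have [_ Dx Dy] := smear_differentiable t x bk (test_function_partial l tphi).
by case: b; [exact: Dx|exact: Dy].
Qed.

Lemma test_function_smear k t phi : bmeas D k -> test_function phi ->
  test_function (smear k g1 g2 t phi).
Proof.
move=> bk tphi; have [sphi [r Hr]] := (test_functionP phi).1 tphi.
apply/test_functionP; split.
  move=> l x; rewrite partial_smear//.
  by have [] := smear_differentiable t x bk (test_function_partial l tphi).
have [_ [c1 [c10 H1]]] := bg1; have [_ [c2 [c20 H2]]] := bg2.
exists (r + `|t| * (c1 + c2)) => x rx.
rewrite /smear -(Rintegral_set0 mu (fun=> 0)) Rintegral_mkcond [RHS]Rintegral_mkcond.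
congr fine; apply: eq_integral => w _; congr EFin.
rewrite /patch in_set0; case: ifPn => // /set_mem Dw.
rewrite Hr ?mulr0//.
rewrite ltNge norm_le_box /=; apply/negP => /andP[b1 b2].
move: rx; rewrite ltNge norm_le_box => /negP; apply; apply/andP; split.
- have := H1 w Dw; have := ler_normB (x.1 + t * g1 w) (t * g1 w).
  rewrite addrK normrM; have := normr_ge0 t; nra.
- have := H2 w Dw; have := ler_normB (x.2 + t * g2 w) (t * g2 w).
  rewrite addrK normrM; have := normr_ge0 t; nra.
Qed.

Lemma is_derive_smear k phi (x : R * R) (t : R) : bmeas D k -> test_function phi ->
  is_derive t 1 (fun t : R => smear k g1 g2 t phi x)
    (smear (fun w => k w * g1 w) g1 g2 t ('D_(e_x R) phi) x
     + smear (fun w => k w * g2 w) g1 g2 t ('D_(e_y R) phi) x).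
Proof.
move=> bk tphi; have [mk [c [c0 kc]]] := bk.
have [_ [c1 [c10 H1]]] := bg1; have [_ [c2 [c20 H2]]] := bg2.
have [C [C0 HC]] := test_function_taylor tphi.
have tx := test_function_partial [:: true] tphi.
have ty := test_function_partial [:: false] tphi.
apply: (@is_derive_quadratic_remainder _ _ _ _ (c * C * (c1 + c2) ^+ 2 * fine (mu D))) => h.
have [bA E] := bRintegral_lin4 h h (bmeas_smear (t + h) x bk tphi)
  (bmeas_smear t x bk tphi) (bmeas_smear t x (bmeasM bk bg1) tx)
  (bmeas_smear t x (bmeasM bk bg2) ty).
rewrite /smear mulrDr {}E mulrAC; apply: Rintegral_bounded => //; first exact: bA.1.
move=> w Dw; pose y := (x.1 + t * g1 w, x.2 + t * g2 w).
pose v := (h * g1 w, h * g2 w).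
have -> : (x.1 + (t + h) * g1 w, x.2 + (t + h) * g2 w) = y + v.
  by rewrite !pair_addE /=; congr pair; ring.
rewrite -/y (_ : _ - _ = k w * (phi (y + v) - phi y - (v.1 * 'D_(e_x R) phi y + v.2 * 'D_(e_y R) phi y))).
  rewrite (_ : c * C * _ * _ = c * (C * ((c1 + c2) * h) ^+ 2)); last by ring.
  rewrite normrM; apply: ler_pM => //; first exact: kc.
  apply: (le_trans (HC y v)); rewrite ler_wpM2l//.
  rewrite -[leRHS]real_normK ?num_real// ler_pXn2r// ?nnegrE ?addr_ge0//.
  rewrite /v /= !normrM (ger0_norm (addr_ge0 c10 c20)) mulrDl [`|h| * _]mulrC [`|h| * _]mulrC.
  by apply: lerD; apply: ler_wpM2r => //; [exact: H1|exact: H2].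
by rewrite /v /=; ring.
Qed.
End Smear.

Section BoundedFubini.
Context d1 d2 (T1 : measurableType d1) (T2 : measurableType d2) (R : realType).
Variables (m1 : {sigma_finite_measure set T1 -> \bar R})
          (m2 : {sigma_finite_measure set T2 -> \bar R}).
Variables (D1 : set T1) (D2 : set T2).
Hypotheses (mD1 : measurable D1) (mD2 : measurable D2).
Hypotheses (fD1 : (m1 D1 < +oo)%E) (fD2 : (m2 D2 < +oo)%E).

Lemma finite_measureX : ((m1 \x m2)%E (D1 `*` D2) < +oo)%E.
Proof. by rewrite product_measure1E// lte_mul_pinfty// ge0_fin_numE. Qed.

Variable f : T1 * T2 -> R.
Hypothesis bf : bmeas (D1 `*` D2) f.

Let intf : (m1 \x m2)%E.-integrable setT ((EFin \o f) \_ (D1 `*` D2)).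
Proof.
have mD := measurableX mD1 mD2; apply/(integrable_mkcond (EFin \o f) mD).
exact: (bmeas_integrable mD finite_measureX bf).
Qed.

Let sec1 x : D1 x -> m2.-integrable D2 (EFin \o (fun y => f (x, y))).
Proof.
move=> D1x; case: bf => mf [c [c0 fc]].
apply: (bounded_integrable mD2 fD2 (M := c)).
  exact: (measurableT_comp mf (pair1_measurable x)).
by move=> y D2y; exact: fc.
Qed.

Let sec2 y : D2 y -> m1.-integrable D1 (EFin \o (fun x => f (x, y))).
Proof.
move=> D2y; case: bf => mf [c [c0 fc]].
apply: (bounded_integrable mD1 fD1 (M := c)).
  exact: (measurableT_comp mf (pair2_measurable y)).
by move=> x D1x; exact: fc.
Qed.

Lemma Rfubini12 : \int[(m1 \x m2)%E]_(z in D1 `*` D2) f z =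
  \int[m1]_(x in D1) \int[m2]_(y in D2) f (x, y).
Proof.
rewrite {1}/Rintegral integral_mkcond -(integral12_prod_meas1 intf).
rewrite [in RHS]/Rintegral [in RHS]integral_mkcond; congr fine.
apply: eq_integral => x _; rewrite /fubini_F patchE /=.
case: ifPn => [/set_mem D1x|D1x].
  rewrite fineK; last by apply: integrable_fin_num => //; exact: sec1.
  rewrite [RHS]integral_mkcond; apply: eq_integral => y _.
  by rewrite !patchE in_setX (mem_set D1x).
rewrite -[RHS](@integral0 _ _ _ m2 setT); apply: eq_integral => y _.
by rewrite patchE in_setX (negbTE D1x).
Qed.

Lemma Rfubini21 : \int[(m1 \x m2)%E]_(z in D1 `*` D2) f z =
  \int[m2]_(y in D2) \int[m1]_(x in D1) f (x, y).
Proof.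
rewrite {1}/Rintegral integral_mkcond -(integral21_prod_meas1 intf).
rewrite [in RHS]/Rintegral [in RHS]integral_mkcond; congr fine.
apply: eq_integral => y _; rewrite /fubini_G patchE /=.
case: ifPn => [/set_mem D2y|D2y].
  rewrite fineK; last by apply: integrable_fin_num => //; exact: sec2.
  rewrite [RHS]integral_mkcond; apply: eq_integral => x _.
  by rewrite !patchE in_setX (mem_set D2y) andbT.
rewrite -[RHS](@integral0 _ _ _ m1 setT); apply: eq_integral => x _.
by rewrite patchE in_setX (negbTE D2y) andbF.
Qed.

End BoundedFubini.

Section RealFTC.
Context {R : realType}.
Notation mu := (@lebesgue_measure R).

Lemma Rintegral_FTC (F f : R -> R) (a b : R) : a < b ->
  (forall x : R, is_derive x 1 F (f x)) -> continuous f ->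
  \int[mu]_(x in `[a, b]) f x = F b - F a.
Proof.
move=> ab DF cf.
have cF : continuous F.
  by move=> z; apply: differentiable_continuous; apply/derivable1_diffP; apply: ex_derive.
have DLR : derivable_oo_LRcontinuous F a b.
  split; first by move=> x _; exact: ex_derive.
  - by apply: cvg_within_filter; exact: cF.
  - by apply: cvg_within_filter; exact: cF.
have E : {in `]a, b[, (F^`())%classic =1 f} by move=> x _; rewrite derive1E derive_val.
by rewrite /Rintegral (continuous_FTC2 ab (continuous_subspaceT cf) DLR E).
Qed.

Lemma Rintegral_itv_cst (c a b : R) : a <= b ->
  \int[mu]_(x in `[a, b]) c = c * (b - a).
Proof.
move=> ab; rewrite Rintegral_cst//= lebesgue_measure_itv /= lte_fin.
move: ab; rewrite le_eqVlt => /orP[/eqP->|ab]; first by rewrite ltxx subrr.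
by rewrite ab -EFinB.
Qed.

End RealFTC.

Section MeasurePreserving.
Context d (T : measurableType d) (R : realType) (mu : {measure set T -> \bar R}).
Variable phi : T -> T.
Hypotheses (mphi : measurable_fun setT phi)
  (inv : forall A, measurable A -> mu (phi @^-1` A) = mu A).
Let pushed := measure_function_pushforward__canonical__measure_function_Measure mu mphi.

Let eq_pushed (f : T -> \bar R) : (\int[pushed]_x f x = \int[mu]_x f x)%E.
Proof. by apply: eq_measure_integral => A mA _; exact: inv. Qed.

Lemma integral_measure_preserving (f : T -> R) : mu.-integrable setT (EFin \o f) ->
  mu.-integrable setT (EFin \o (f \o phi)) /\ \int[mu]_z f (phi z) = \int[mu]_z f z.
Proof.
move=> intf; have /integrableP[mf foo] := intf.
have mf' : measurable_fun setT (EFin \o f \o phi) by exact: measurableT_comp mf mphi.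
have int' : mu.-integrable setT (EFin \o (f \o phi)).
  apply/integrableP; split => //; move: foo; rewrite -eq_pushed ge0_integral_pushforward//.
  exact: measurableT_comp.
split => //; rewrite /Rintegral; congr fine; rewrite -[RHS]eq_pushed.
exact/esym/(integral_pushforward mphi mf (D := setT) int' measurableT).
Qed.

End MeasurePreserving.

Lemma Rintegral_bigsum d (T : measurableType d) (R : realType) (mu : {measure set T -> \bar R})
    (D : set T) (I : Type) (s : seq I) (h : I -> T -> R) : measurable D ->
  (forall i, mu.-integrable D (EFin \o h i)) ->
  mu.-integrable D (EFin \o (fun x => \sum_(i <- s) h i x)) /\
  \int[mu]_(x in D) \sum_(i <- s) h i x = \sum_(i <- s) \int[mu]_(x in D) h i x.
Proof.
move=> mD inth; elim: s => [|i s [IH1 IH2]].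
  rewrite big_nil (_ : (fun x => _) = fun=> 0); last by apply/funext => x; rewrite big_nil.
  split; first exact: integrable0.
  by rewrite Rintegral_cst// mul0r.
rewrite big_cons -IH2 -RintegralD//.
rewrite (_ : (fun x => _) = fun x => h i x + \sum_(i <- s) h i x); last first.
  by apply/funext => x; rewrite big_cons.
by split=> //; exact: (integrableD mD (inth i) IH1).
Qed.

Lemma big_subseq0 (V : zmodType) (I : eqType) (r s : seq I) (F : I -> V) :
  uniq r -> uniq s -> {subset s <= r} -> (forall i, i \notin s -> F i = 0) ->
  \sum_(i <- r) F i = \sum_(i <- s) F i.
Proof.
move=> ur us sr F0.
rewrite -(@big_rmcond_in _ _ _ _ r (fun i => i \in s)); last by move=> i _; exact: F0.
rewrite -big_filter; apply: perm_big; apply: uniq_perm => //; first exact: filter_uniq.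
by move=> i; rewrite mem_filter; apply/andP/idP => [[]//|si]; split => //; exact: sr.
Qed.

Section IntBoxes.

Definition irange (N : nat) : seq int := [seq k%:Z - N%:Z | k <- iota 0 (2 * N).+1].
Definition ibox (N : nat) : seq (int * int) := [seq (i, j) | i <- irange N, j <- irange N].

Lemma absz_le2 (k : int) : k <= 2 -> -2 <= k -> (`|k|%N <= 2)%N.
Proof. by lia. Qed.

Lemma mem_irange N i : (i \in irange N) = (`|i|%N <= N)%N.
Proof.
apply/mapP/idP => [[k]|iN]; first by rewrite mem_iota => k0 ->; lia.
by exists (absz ((i : int) + N%:Z)); [rewrite mem_iota|]; lia.
Qed.

Lemma uniq_irange N : uniq (irange N).
Proof. by rewrite map_inj_uniq ?iota_uniq// => k l /addIr[]. Qed.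

Lemma mem_ibox N p : (p \in ibox N) = (`|p.1|%N <= N)%N && (`|p.2|%N <= N)%N.
Proof.
rewrite -!mem_irange; apply/allpairsP/andP => [[[i j] [? ? ->]]//|[p1 p2]].
by exists p; rewrite -surjective_pairing.
Qed.

Lemma uniq_ibox N : uniq (ibox N).
Proof. by apply: allpairs_uniq; [exact: uniq_irange|exact: uniq_irange|move=> [? ?] [? ?]]. Qed.

Lemma sum_irange3 (R : pzRingType) N (i : int) (F : int -> R) : (`|i|.+1 <= N)%N ->
  (forall k, k != i - 1 -> k != i -> k != i + 1 -> F k = 0) ->
  \sum_(k <- irange N) F k = F (i - 1) + (F i + F (i + 1)).
Proof.
move=> iN F0; rewrite (@big_subseq0 _ _ _ [:: i - 1; i; i + 1]).
- by rewrite !big_cons big_nil addr0.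
- exact: uniq_irange.
- by rewrite /= !inE; lia.
- by move=> k kin; rewrite mem_irange; move: kin; rewrite !inE => /or3P[/eqP->|/eqP->|/eqP->]; lia.
- by move=> k; rewrite !inE !negb_or => /and3P[? ? ?]; exact: F0.
Qed.

End IntBoxes.

(** * Densities of pushed forward measures *)

Section BoundedFunctionals.
Context d (T : measurableType d) (R : realType).
Implicit Types (h : T -> R) (L : (T -> R) -> R).

Lemma bmeas_indic (D A : set T) : measurable A -> bmeas D (\1_A : T -> R).
Proof.
move=> mA; split; first exact: measurable_indic.
exists 1; split => // x _; rewrite indicE; by case: (x \in A); rewrite ?normr1 ?normr0.
Qed.

(* Binary expansion: subtracting c/2 times the indicator of {h >= c/2} halves the
   range of h without changing [L h]. *)
Lemma bounded_functional0 L (K : R) :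
  (forall a h h', bmeas setT h -> bmeas setT h' ->
     L (fun x => a * h x + h' x) = a * L h + L h') ->
  (forall h (c : R), bmeas setT h -> (forall x, `|h x| <= c) -> `|L h| <= K * c) ->
  (forall A, measurable A -> L (\1_A : T -> R) = 0) ->
  forall h, bmeas setT h -> L h = 0.
Proof.
move=> linL bL L1.
have step n : forall h (c : R), bmeas setT h -> (forall x, 0 <= h x <= c) ->
    `|L h| <= K * (c / 2 ^+ n).
  elim: n => [|n IH] h c bh hc.
    rewrite expr0 divr1; apply: bL => // x.
    by have /andP[h0 h1] := hc x; rewrite ger0_norm.
  pose A := [set x | c / 2 <= h x].
  have mA : measurable A.
    have -> : A = h @^-1` `[c / 2, +oo[.
      by apply/seteqP; split => x; rewrite /A /= in_itv/= andbT.
    by rewrite -[X in measurable X]setTI; apply: bh.1 => //; exact: measurable_itv.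
  have bA : bmeas setT (\1_A : T -> R) := bmeas_indic setT mA.
  pose h' x := (- (c / 2)) * \1_A x + h x.
  have bh' : bmeas setT h' := bmeasD (bmeasZ _ bA) bh.
  have Eh : L h = L h' by rewrite /h' linL// L1// mulr0 add0r.
  rewrite Eh (_ : c / 2 ^+ n.+1 = c / 2 / 2 ^+ n); last by rewrite exprS invfM mulrA.
  apply: IH => // x.
  rewrite /h' indicE; have := hc x.
  case: (boolP (x \in A)) => [/set_mem|/negP xA].
    by rewrite /A /= mulr1 => ? /andP[? ?]; apply/andP; split; lra.
  have : ~ (c / 2 <= h x) by move=> H; apply: xA; apply/mem_set.
  by move=> /negP; rewrite -ltNge mulr0 add0r => ? /andP[? ?]; apply/andP; split; lra.
have pos h (c : R) : bmeas setT h -> (forall x, 0 <= h x <= c) -> L h = 0.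
  move=> bh hc; apply/eqP; rewrite -normr_eq0 eq_le normr_ge0 andbT leNgt.
  apply/negP => H.
  pose n := Num.truncn (K * c / `|L h|).
  have := step n.+1 h c bh hc; apply/negP; rewrite -ltNge mulrA ltr_pdivrMr ?exprn_gt0// -ltr_pdivrMl// mulrC.
  apply: (lt_trans (truncnS_gt _)); rewrite -/n -natrX ltr_nat; exact: ltn_expl.
move=> h bh; have [mh [c [c0 hc]]] := bh.
have b1 : bmeas setT (\1_setT : T -> R) := bmeas_indic setT measurableT.
have bs : bmeas setT (fun x => c * \1_setT x + h x) := bmeasD (bmeasZ _ b1) bh.
have := pos _ (2 * c) bs; rewrite linL// L1// mulr0 add0r; apply => x.
have := hc x I; rewrite indicE in_setT mulr1 ler_norml => /andP[? ?].
by apply/andP; split; lra.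
Qed.

End BoundedFunctionals.

Lemma charge_density d (T : measurableType d) (R : realType) (nu : {charge set T -> \bar R})
    (la : {sigma_finite_measure set T -> \bar R}) : nu `<< la ->
  exists f : T -> R, la.-integrable setT (EFin \o f) /\
    forall A, measurable A -> nu A = (\int[la]_(x in A) (f x)%:E)%E.
Proof.
move=> numu; exists (fun x => fine (Radon_Nikodym nu la x)).
have E : EFin \o (fun x => fine (Radon_Nikodym nu la x)) = Radon_Nikodym nu la.
  by apply/funext => x /=; rewrite fineK// Radon_Nikodym_fin_num.
split; first by rewrite E; exact: Radon_Nikodym_integrable.
by move=> A mA; rewrite (Radon_Nikodym_integral numu mA) -E.
Qed.

Section Densities.
Context d (T : measurableType d) d' (T' : measurableType d') (R : realType).
Variables (mu : {measure set T -> \bar R}) (la : {sigma_finite_measure set T' -> \bar R}).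

Lemma integrable_mul_bmeas (f h : T' -> R) : la.-integrable setT (EFin \o f) ->
  bmeas setT h -> la.-integrable setT (EFin \o (fun x => f x * h x)).
Proof.
move=> intf [mh [c [c0 hc]]].
apply: (integrableMl measurableT intf mh); exists c; split; first exact: num_real.
by move=> M cM x _ /=; apply: (le_trans (hc x I)); exact: ltW.
Qed.

Lemma pushforward_density (D : set T) (B : set T') (k : T -> R) (g : T -> T') :
  measurable D -> (mu D < +oo)%E -> measurable B -> bmeas D k ->
  measurable_fun setT g -> (forall w, D w -> B (g w)) ->
  (forall A, measurable A -> la A = 0%E -> mu (D `&` g @^-1` A) = 0%E) ->
  exists f : T' -> R, [/\ la.-integrable setT (EFin \o f),
    forall x, ~ B x -> f x = 0 &
    forall h, bmeas setT h ->
      \int[mu]_(w in D) (k w * h (g w)) = \int[la]_x (f x * h x)].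
Proof.
move=> mD fD mB bk mg gB null.
have intk : mu.-integrable setT ((EFin \o k) \_ D).
  by apply/(integrable_mkcond (EFin \o k) mD); exact: (bmeas_integrable mD fD bk).
pose nu := pushforward (induced_charge intk) g.
have nuE A : measurable A -> nu A = (\int[mu]_(w in D `&` g @^-1` A) (k w)%:E)%E.
  by move=> mA; rewrite /nu /pushforward /induced_charge -integral_mkcondl.
have numu : nu `<< la.
  apply/null_content_dominatesP => A mA A0; rewrite nuE//.
  have mDA : measurable (D `&` g @^-1` A).
    by apply: measurableI => //; rewrite -[X in measurable X]setTI; exact: mg.
  apply: null_set_integral => //; last exact: null.
  by apply/measurable_EFinP; apply: measurable_funTS; exact: bk.1.
have [f0 [intf0 f0E]] : exists f : T' -> R, la.-integrable setT (EFin \o f) /\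
    forall A, measurable A -> nu A = (\int[la]_(x in A) (f x)%:E)%E.
  exact: (@charge_density _ _ R (measure_function_pushforward__canonical__charge_Charge (induced_charge intk) mg) la numu).
have key h : bmeas setT h -> \int[mu]_(w in D) (k w * h (g w)) = \int[la]_x (f0 x * h x).
  have bkg h' : bmeas setT h' -> bmeas D (fun w => k w * h' (g w)).
    move=> [mh' [c [c0 hc]]]; apply: bmeasM => //; split; first exact: measurableT_comp mh' mg.
    by exists c; split => // w _; exact: hc.
  pose L (h : T' -> R) := \int[mu]_(w in D) (k w * h (g w)) - \int[la]_x (f0 x * h x).
  pose K := \int[mu]_(w in D) `|k w| + \int[la]_x `|f0 x|.
  suff L0 : forall h, bmeas setT h -> L h = 0 by move=> /L0/eqP; rewrite subr_eq0 => /eqP.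
  apply: (@bounded_functional0 _ _ _ _ K).
  - move=> a h1 h2 b1 b2; rewrite /L.
    have -> : \int[mu]_(w in D) (k w * (a * h1 (g w) + h2 (g w))) =
        a * \int[mu]_(w in D) (k w * h1 (g w)) + \int[mu]_(w in D) (k w * h2 (g w)).
      rewrite -(bRintegralZ mD fD a (bkg _ b1)) -(bRintegralD mD fD (bmeasZ a (bkg _ b1)) (bkg _ b2)).
      by apply: eq_Rintegral => w _; ring.
    have -> : \int[la]_x (f0 x * (a * h1 x + h2 x)) =
        a * \int[la]_x (f0 x * h1 x) + \int[la]_x (f0 x * h2 x).
      rewrite -RintegralZl//; last exact: (integrable_mul_bmeas intf0 b1).
      rewrite -RintegralD//; last exact: (integrable_mul_bmeas intf0 b2).
        by apply: eq_Rintegral => w _; ring.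
      have := integrable_mul_bmeas intf0 (bmeasZ a b1).
      by congr (la.-integrable _ _); apply/funext => x /=; congr EFin; ring.
    by ring.
  - move=> h1 c b1 hc; rewrite /L /K mulrDl (le_trans (ler_normB _ _))// lerD//.
    + rewrite (le_trans (le_normr_Rintegral mD (bmeas_integrable mD fD (bkg _ b1))))//.
      have bnk : bmeas D (fun w => `|k w|).
        have [mk [c' [c0 kc]]] := bk; split; first exact: measurableT_comp.
        by exists c'; split => // w Dw; rewrite normr_id kc.
      rewrite mulrC -(bRintegralZ mD fD c bnk); apply: le_Rintegral => //.
      * by apply: integrable_norm; exact: (bmeas_integrable mD fD (bkg _ b1)).
      * exact: (bmeas_integrable mD fD (bmeasZ c bnk)).
      * by move=> w Dw; rewrite normrM mulrC ler_wpM2r.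
    + have I1 := integrable_mul_bmeas intf0 b1.
      rewrite (le_trans (le_normr_Rintegral measurableT I1))//.
      have I0 := integrable_norm intf0.
      rewrite -RintegralZr//; apply: le_Rintegral => //.
      * exact: integrable_norm I1.
      * have := integrable_mul_bmeas I0 (bmeas_cst setT c); exact.
      * by move=> x _; rewrite normrM ler_wpM2l.
  - move=> A mA; apply/eqP; rewrite subr_eq0; apply/eqP.
    transitivity (fine (nu A)).
      rewrite nuE// /Rintegral integral_mkcondr; congr fine; apply: eq_integral => w _.
      rewrite patchE indicE (_ : (w \in g @^-1` A) = (g w \in A)); last first.
        by apply/idP/idP => [/set_mem H|/set_mem H]; apply/mem_set.
      by case: ifP; rewrite ?mulr1 ?mulr0.
    rewrite f0E// /Rintegral; congr fine; rewrite [LHS]integral_mkcond.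
    apply: eq_integral => x _; rewrite patchE indicE /=.
    by case: ifP; rewrite ?mulr1 ?mulr0.
exists (fun x => f0 x * \1_B x); split.
- have b1 : bmeas setT (\1_B : T' -> R) := bmeas_indic R setT mB; exact: (integrable_mul_bmeas intf0 b1).
- by move=> x Bx; rewrite indicE memNset// mulr0.
- move=> h bh; transitivity (\int[mu]_(w in D) (k w * (\1_B (g w) * h (g w)))).
    by apply: eq_Rintegral => w /set_mem Dw; rewrite indicE mem_set ?mul1r//; exact: gB.
  rewrite (key (fun x => \1_B x * h x)); last exact: (bmeasM (bmeas_indic R setT mB : bmeas setT (\1_B : T' -> R)) bh).
  by apply: eq_Rintegral => x _; rewrite mulrA.
Qed.
End Densities.

Section NullPreimages.
#[local] Opaque sin cos pi.
Context {R : realType}.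
Notation mu := (@lebesgue_measure R).

Lemma open_itv_cover_null (A : set R) (e : R) : mu A = 0%E -> 0 < e ->
  exists a b : R^nat, [/\ forall n, a n <= b n, A `<=` \bigcup_n `]a n, b n[%classic &
    (\sum_(0 <= n <oo) (b n - a n)%:E <= e%:E)%E].
Proof.
move=> A0 e0.
have [F [Fitv AF] Fe] : exists2 F, open_itv_cover A F &
    (\sum_(0 <= k <oo) (@wlength R idfun) (F k) <= e%:E)%E.
  have : mu A \is a fin_num by rewrite A0.
  rewrite -[mu A]/((wlength idfun)^* A)%mu outer_measure_open_itv_cover.
  move=> /lb_ereal_inf_adherent-/(_ _ e0)[_/= [F]] AF <- Fe.
  exists F => //; apply: ltW; move: Fe.
  by rewrite -outer_measure_open_itv_cover -[X in (X + _)%E]/(mu A) A0 add0e.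
have H n : exists ab : R * R, ab.1 <= ab.2 /\ F n = `]ab.1, ab.2[%classic.
  have [[a b] /= ->] := Fitv n; have [ab|ba] := leP a b; first by exists (a, b).
  exists (0, 0); split => //; rewrite set_itvoo0.
  by apply/seteqP; split => // x /=; rewrite in_itv/=; lra.
exists (fun n => (sval (cid (H n))).1), (fun n => (sval (cid (H n))).2); split.
- by move=> n; case: cid => ab [].
- apply: (subset_trans AF) => x [n _ Fx]; exists n => //.
  by move: Fx; case: cid => ab /= [_ ->].
- apply: le_trans Fe; apply: lee_nneseries => [n _ _|n _].
    by have [le _] := svalP (cid (H n)); rewrite lee_fin subr_ge0.
  have [le E] := svalP (cid (H n)); rewrite [in leRHS]E. by rewrite wlength_itv_bnd.
Qed.

Lemma null_preimage_expanding (A E : set R) (g : R -> R) (C : R) : 0 <= C ->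
  (forall x y, E x -> E y -> `|x - y| <= C * `|g x - g y|) ->
  mu A = 0%E -> mu (E `&` g @^-1` A) = 0%E.
Proof.
move=> C0 Eg A0; apply/eqP; rewrite eq_le measure_ge0 andbT.
apply/lee_addgt0Pr => e e0; rewrite add0e.
have [a [b [ab Aab abe]]] := open_itv_cover_null A0 (divr_gt0 e0 (ltr_wpDl (mulr_ge0 (ler0n _ 2) C0) ltr01)).
pose G n := E `&` g @^-1` `]a n, b n[%classic.
have sub : E `&` g @^-1` A `<=` \bigcup_n G n.
  by move=> x [Ex /Aab[n _ gx]]; exists n.
apply: (le_trans (le_outer_measure mu _ _ sub)).
apply: (le_trans (outer_measure_sigma_subadditive mu G)).
apply: (@le_trans _ _ (\sum_(0 <= n <oo) ((2 * C)%:E * (b n - a n)%:E))%E).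
  apply: lee_nneseries => // n _.
  have [[x0 [Ex0 gx0]]|no] := pselect (exists x, G n x); last first.
    rewrite (_ : G n = set0) ?measure0 -?EFinM ?lee_fin ?mulr_ge0 ?subr_ge0//.
    by apply/seteqP; split => // x Gx; exfalso; apply: no; exists x.
  pose L := C * (b n - a n).
  have sG : G n `<=` `[x0 - L, x0 + L].
    move=> x [Ex gx]; have := Eg x x0 Ex Ex0.
    have H : C * `|g x - g x0| <= L.
      rewrite ler_wpM2l// ler_norml; move: gx gx0; rewrite /= !in_itv/=.
      by move=> /andP[? ?] /andP[? ?]; apply/andP; split; lra.
    move=> /le_trans/(_ H); rewrite ler_norml /= in_itv/= => /andP[? ?].
    by apply/andP; split; lra.
  apply: (@le_trans _ _ (mu `[x0 - L, x0 + L]%classic)); first exact: le_outer_measure.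
  rewrite lebesgue_measure_itv /= lte_fin; case: ifP => _.
    by rewrite -EFinB -EFinM lee_fin /L; lra.
  by rewrite -EFinM lee_fin mulr_ge0// ?mulr_ge0// subr_ge0.
rewrite nneseriesZl; last by move=> n _; rewrite lee_fin subr_ge0.
have C1 : 0 < 2 * C + 1 by rewrite ltr_wpDl// mulr_ge0.
apply: (@le_trans _ _ ((2 * C)%:E * (e / (2 * C + 1))%:E)%E).
  by rewrite lee_wpmul2l// lee_fin mulr_ge0.
rewrite -EFinM lee_fin mulrA ler_pdivrMr// mulrC ler_wpM2l ?ltW// ltrDl//.
Qed.

Lemma null_preimage_cos (A : set R) (a s : R) : s != 0 -> mu A = 0%E ->
  mu (`[0, pi] `&` (fun b => a + s * cos b) @^-1` A) = 0%E.
Proof.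
move=> s0 A0.
pose E n : set R := `[n.+1%:R^-1, pi - n.+1%:R^-1]%classic.
pose P : set R := (fun b => a + s * cos b) @^-1` A.
have sub : `[0, pi] `&` P `<=` [set 0] `|` [set pi] `|` \bigcup_n (E n `&` P).
  move=> b [/=]; rewrite in_itv/= => /andP[b0 bpi] Pb.
  have [->|bn0] := eqVneq b 0; first by left; left.
  have [->|bnpi] := eqVneq b pi; first by left; right.
  right.
  have b0' : 0 < b by rewrite lt_def bn0.
  have bpi' : 0 < pi - b by rewrite subr_gt0 lt_neqAle bnpi.
  pose m := Num.min b (pi - b).
  have m0 : 0 < m by rewrite lt_min b0'.
  exists (Num.truncn m^-1) => //; split => //; rewrite /E /= in_itv/=.
  have nm : (Num.truncn m^-1).+1%:R^-1 < m by rewrite invf_plt ?posrE// truncnS_gt.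
  set k := (_.+1%:R^-1) in nm *.
  by move: nm; rewrite lt_min => /andP[? ?]; apply/andP; split; lra.
apply/eqP; rewrite eq_le measure_ge0 andbT.
apply: (le_trans (le_outer_measure mu _ _ sub)).
apply: (le_trans (outer_measureU2 mu _ _)); rewrite -[leRHS]adde0; apply: leeD.
  apply: (le_trans (outer_measureU2 mu _ _)); rewrite -[leRHS]adde0; apply: leeD.
    by rewrite -[leLHS]/(mu [set (0 : R)]) lebesgue_measure_set1.
  by rewrite -[leLHS]/(mu [set (pi : R)]) lebesgue_measure_set1.
apply: (le_trans (outer_measure_sigma_subadditive mu _)).
rewrite eseries0// => n _ _.
have k0 : 0 < n.+1%:R^-1 :> R by rewrite invr_gt0.
have [ltE|geE] := ltP (n.+1%:R^-1 : R) (pi - n.+1%:R^-1); last first.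
  apply/eqP; rewrite eq_le measure_ge0 andbT.
  apply: (@le_trans _ _ (mu (E n))); first by apply: le_outer_measure => x [].
  by rewrite /E lebesgue_measure_itv /= lte_fin ltNge geE.
have [c cE cmin] := EVT_min (ltW ltE) (continuous_subspaceT (@continuous_sin R)).
have sc : 0 < sin c.
  apply: sin_gt0_pi; move: cE ltE k0; rewrite !in_itv/=; set k := _.+1%:R^-1.
  by move=> /andP[? ?] ? ?; apply/andP; split; lra.
apply: (@null_preimage_expanding A (E n) _ (`|s| * sin c)^-1) => //.
  by rewrite invr_ge0 mulr_ge0// ltW.
have main x y : E n x -> E n y -> x < y -> sin c * (y - x) <= cos x - cos y.
  move=> Ex Ey xy.
  have [z zxy] := @MVT R cos (fun x => - sin x) x y xy (fun x _ => is_derive_cos x)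
     (continuous_subspaceT (@continuous_cos R)).
  move=> e; rewrite -(opprB (cos y) (cos x)) e mulNr opprK ler_wpM2r ?subr_ge0 ?(ltW xy)//.
  apply: cmin; move: Ex Ey zxy; rewrite /E /= !in_itv/=; set k := _.+1%:R^-1.
  by move=> /andP[? ?] /andP[? ?] /andP[? ?]; apply/andP; split; lra.
move=> x y Ex Ey.
rewrite mulrC ler_pdivlMr ?mulr_gt0 ?normr_gt0// opprD addrACA subrr add0r -mulrBr normrM.
rewrite mulrCA ler_wpM2l//.
have [xy|xy|->] := ltgtP x y; last by rewrite !subrr normr0 mul0r.
- have := main x y Ex Ey xy; rewrite [`|x - y|]ltr0_norm ?subr_lt0// opprB mulrC => H.
  exact: (le_trans H (ler_norm _)).
- have := main y x Ey Ex xy; rewrite [`|x - y|]gtr0_norm ?subr_gt0// mulrC => H.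
  by rewrite distrC; exact: (le_trans H (ler_norm _)).
Qed.

End NullPreimages.

(** * Spherical means and the wave operators *)

Lemma sigma_finiteX d1 d2 (T1 : measurableType d1) (T2 : measurableType d2)
    (R : realType) (m1 : {sigma_finite_measure set T1 -> \bar R})
    (m2 : {sigma_finite_measure set T2 -> \bar R}) : sigma_finite setT (m1 \x m2)%E.
Proof.
have /sigma_finiteP[F [TF ndF Foo]] := sigma_finiteT m1.
have /sigma_finiteP[G [TG ndG Goo]] := sigma_finiteT m2.
exists (fun n => F n `*` G n).
  rewrite -setXTT TF TG predeqE => -[x y]; split.
    move=> [/= [n _ Fnx] [k _ Gky]]; exists (maxn n k) => //; split.
    - by move: x Fnx; exact/subsetPset/ndF/leq_maxl.
    - by move: y Gky; exact/subsetPset/ndG/leq_maxr.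
  by move=> [n _ []/= ? ?]; split; exists n.
move=> k; have [mF fF] := Foo k; have [mG fG] := Goo k.
by split; [exact: measurableX|exact: finite_measureX].
Qed.

Definition lebesgue3 (R : realType) :
  set (measurableTypeR R * (measurableTypeR R * measurableTypeR R)) -> \bar R :=
  (@lebesgue_measure R \x @lebesgue2 R)%E.

HB.instance Definition _ (R : realType) := Measure.on (@lebesgue2 R).
HB.instance Definition _ (R : realType) :=
  Measure_isSigmaFinite.Build _ _ _ (@lebesgue2 R)
    (sigma_finiteX (@lebesgue_measure R) (@lebesgue_measure R)).
HB.instance Definition _ (R : realType) := Measure.on (@lebesgue3 R).
HB.instance Definition _ (R : realType) :=
  Measure_isSigmaFinite.Build _ _ _ (@lebesgue3 R)
    (sigma_finiteX (@lebesgue_measure R) (@lebesgue2 R)).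

Section LineDerivatives.
Context {R : realType}.
Implicit Types (f g : R -> R) (s : R).

Lemma is_derive_mul f g s (df dg : R) : is_derive s 1 f df -> is_derive s 1 g dg ->
  is_derive s 1 (fun y => f y * g y) (f s * dg + g s * df).
Proof. by move=> Df Dg; exact: is_deriveM. Qed.

Lemma is_derive_add f g s (df dg : R) : is_derive s 1 f df -> is_derive s 1 g dg ->
  is_derive s 1 (fun y => f y + g y) (df + dg).
Proof. by move=> Df Dg; exact: is_deriveD. Qed.

Lemma is_derive_scale f s (a df : R) : is_derive s 1 f df ->
  is_derive s 1 (fun y => a * f y) (a * df).
Proof. by move=> Df; exact: is_deriveZ. Qed.

Lemma is_derive0_eq f (a b : R) : (forall s : R, is_derive s 1 f 0) -> f a = f b.
Proof.
by move=> Df; have [c [_ /eqP]] := mvt_R b a Df; rewrite mul0r subr_eq0 => /eqP.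
Qed.

Lemma is_derive_continuous f s (df : R) : is_derive s 1 f df -> {for s, continuous f}.
Proof.
by move=> Df; apply: differentiable_continuous; apply/derivable1_diffP; exact: ex_derive.
Qed.

Lemma continuous_line (phi : R * R -> R) (g1 g2 : R -> R) : smooth phi ->
  continuous g1 -> continuous g2 -> continuous (fun s => phi (g1 s, g2 s)).
Proof.
move=> sphi c1 c2 s; apply: (@continuous_comp _ _ _ (fun s => (g1 s, g2 s)) phi).
  exact: (cvg_pair (c1 s) (c2 s)).
by apply: differentiable_continuous; exact: (sphi [::]).
Qed.

Lemma is_derive_comp2_line (phi : R * R -> R) (g1 g2 : R -> R) s (d1 d2 : R) :
  smooth phi -> is_derive s 1 g1 d1 -> is_derive s 1 g2 d2 ->
  is_derive s 1 (fun s => phi (g1 s, g2 s))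
    (d1 * 'D_(e_x R) phi (g1 s, g2 s) + d2 * 'D_(e_y R) phi (g1 s, g2 s)).
Proof. by move=> sphi; exact: is_derive_comp2 (sphi [::] _). Qed.

Lemma is_derive_opp f s (df : R) : is_derive s 1 f df ->
  is_derive s 1 (fun y => - f y) (- df).
Proof. by move=> Df; exact: is_deriveN. Qed.

Lemma continuous_mul f g : continuous f -> continuous g -> continuous (fun s => f s * g s).
Proof. by move=> cf cg s; apply: cvgM; [exact: cf|exact: cg]. Qed.

Lemma continuous_add f g : continuous f -> continuous g -> continuous (fun s => f s + g s).
Proof. by move=> cf cg s; apply: cvgD; [exact: cf|exact: cg]. Qed.

Lemma continuous_const (a : R) : continuous (fun _ : R => a).
Proof. by move=> s; exact: cvg_cst. Qed.

End LineDerivatives.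

Ltac solve_continuous :=
  repeat first [assumption | apply: continuous_mul | apply: continuous_add
    | exact: continuous_const ].

Ltac solve_bmeas :=
  repeat first [exact: bmeas_cst | assumption | apply: bmeasM | apply: bmeasB | apply: bmeasD ].

Section SphericalMeans.
Context {R : realType}.
Notation mu := (@lebesgue_measure R).
Notation T1 := (measurableTypeR R).
Notation T2 := (measurableTypeR R * measurableTypeR R)%type.
Notation T3 := (T1 * T2)%type.
Notation mu2 := (@lebesgue2 R).
Notation mu3 := (@lebesgue3 R).
Implicit Types (phi psi : R * R -> R) (x : R * R) (t : R).

Definition angles : set T2 := `[0, pi] `*` `[0, pi].
Definition ball_box : set T3 := `[0, 1] `*` angles.

Lemma measurable_angles : measurable angles.
Proof. by apply: measurableX; exact: measurable_itv. Qed.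

Lemma measurable_ball_box : measurable ball_box.
Proof. by apply: measurableX; [exact: measurable_itv|exact: measurable_angles]. Qed.

Lemma finite_itv (a b : R) : (mu `[a, b] < +oo)%E.
Proof.
by rewrite lebesgue_measure_itv /=; case: ifP => // _; rewrite -EFinD ltry.
Qed.

Lemma finite_angles : (mu2 angles < +oo)%E.
Proof.
exact: (@finite_measureX _ _ T1 T1 R mu mu _ _ (measurable_itv _) (measurable_itv _) (finite_itv 0 pi) (finite_itv 0 pi)).
Qed.

Lemma finite_ball_box : (mu3 ball_box < +oo)%E.
Proof.
exact: (@finite_measureX _ _ T1 T2 R mu mu2 _ _ (measurable_itv _) measurable_angles (finite_itv 0 1) finite_angles).
Qed.

Definition sph_weight (w : T2) : R := sin w.1.
Definition sph1 (w : T2) : R := cos w.1.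
Definition sph2 (w : T2) : R := sin w.1 * cos w.2.
Definition rad (f : T2 -> R) (z : T3) : R := z.1 * f z.2.

Lemma measurable_sin_comp d (T : measurableType d) (f : T -> R) :
  measurable_fun setT f -> measurable_fun setT (sin \o f).
Proof.
by move=> mf; apply: measurableT_comp mf; apply: continuous_measurable_fun; exact: continuous_sin.
Qed.

Lemma measurable_cos_comp d (T : measurableType d) (f : T -> R) :
  measurable_fun setT f -> measurable_fun setT (cos \o f).
Proof.
by move=> mf; apply: measurableT_comp mf; apply: continuous_measurable_fun; exact: continuous_cos.
Qed.

Lemma bmeas_sin D (f : T2 -> R) : measurable_fun setT f -> bmeas D (fun w => sin (f w)).
Proof.
move=> mf; split; first exact: measurable_sin_comp.
by exists 1; split => // w _; rewrite ler_norml sin_geN1 sin_le1.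
Qed.

Lemma bmeas_cos D (f : T2 -> R) : measurable_fun setT f -> bmeas D (fun w => cos (f w)).
Proof.
move=> mf; split; first exact: measurable_cos_comp.
by exists 1; split => // w _; rewrite ler_norml cos_geN1 cos_le1.
Qed.

Lemma bmeas_weight D : bmeas D sph_weight.
Proof. by apply: bmeas_sin; exact: measurable_fst. Qed.

Lemma bmeas_sph1 D : bmeas D sph1.
Proof. by apply: bmeas_cos; exact: measurable_fst. Qed.

Lemma bmeas_sph2 D : bmeas D sph2.
Proof. by apply: bmeasM; [apply: bmeas_sin; exact: measurable_fst|apply: bmeas_cos; exact: measurable_snd]. Qed.

Lemma bmeas_rad f : bmeas angles f -> bmeas ball_box (rad f).
Proof.
move=> [mf [c [c0 fc]]]; split.
  by apply: measurable_funM; [exact: measurable_fst|exact: measurableT_comp mf measurable_snd].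
exists c; split => // z [/= z1 z2]; rewrite /rad normrM -[c]mul1r ler_pM//; last exact: fc.
by move: z1; rewrite /= in_itv/= => /andP[z0 z1]; rewrite ger0_norm.
Qed.

Definition sph_mean k t phi x := smear mu2 angles k sph1 sph2 t phi x.
Definition ball_mean k t phi x := smear mu3 ball_box (rad k) (rad sph1) (rad sph2) t phi x.

Definition waveW t phi x : R := t / (2 * pi) * sph_mean sph_weight t phi x.
Definition waveZ t phi x : R := t ^+ 2 / (2 * pi) * ball_mean sph_weight t phi x.
Lemma lebesgue2_fubini12 (D1 D2 : set T1) (f : T2 -> R) : measurable D1 -> measurable D2 ->
  (mu D1 < +oo)%E -> (mu D2 < +oo)%E -> bmeas (D1 `*` D2) f ->
  \int[mu2]_(z in D1 `*` D2) f z = \int[mu]_(a in D1) \int[mu]_(b in D2) f (a, b).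
Proof. by move=> mD1 mD2 f1 f2 bf; exact: (@Rfubini12 _ _ T1 T1 R mu mu _ _ mD1 mD2 f1 f2 f bf). Qed.

Lemma lebesgue2_fubini21 (D1 D2 : set T1) (f : T2 -> R) : measurable D1 -> measurable D2 ->
  (mu D1 < +oo)%E -> (mu D2 < +oo)%E -> bmeas (D1 `*` D2) f ->
  \int[mu2]_(z in D1 `*` D2) f z = \int[mu]_(b in D2) \int[mu]_(a in D1) f (a, b).
Proof. by move=> mD1 mD2 f1 f2 bf; exact: (@Rfubini21 _ _ T1 T1 R mu mu _ _ mD1 mD2 f1 f2 f bf). Qed.

Lemma ball_box_fubini21 (f : T3 -> R) : bmeas ball_box f ->
  \int[mu3]_(z in ball_box) f z = \int[mu2]_(w in angles) \int[mu]_(s in `[0, 1]) f (s, w).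
Proof.
exact: (@Rfubini21 _ _ T1 T2 R mu mu2 _ _ (measurable_itv _) measurable_angles
  (finite_itv 0 1) finite_angles).
Qed.

Lemma ball_mean_radial t phi x : test_function phi ->
  2 * t * ball_mean sph_weight t phi x +
  t ^+ 2 * (smear mu3 ball_box (fun z => rad sph_weight z * rad sph1 z)
              (rad sph1) (rad sph2) t ('D_(e_x R) phi) x
          + smear mu3 ball_box (fun z => rad sph_weight z * rad sph2 z)
              (rad sph1) (rad sph2) t ('D_(e_y R) phi) x)
  = t * sph_mean sph_weight t phi x.
Proof.
move=> tphi; have [sphi _] := tphi.
pose px := 'D_(e_x R) phi; pose py := 'D_(e_y R) phi.
have tx : test_function px := test_function_partial [:: true] tphi.
have ty : test_function py := test_function_partial [:: false] tphi.
have [mD mD2] := (measurable_ball_box, measurable_angles).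
have bw := bmeas_rad (bmeas_weight _); have b1 := bmeas_rad (bmeas_sph1 _).
have b2 := bmeas_rad (bmeas_sph2 _).
pose q z := (x.1 + t * rad sph1 z, x.2 + t * rad sph2 z).
pose A z := rad sph_weight z * phi (q z).
pose B z := rad sph_weight z * rad sph1 z * px (q z).
pose C z := rad sph_weight z * rad sph2 z * py (q z).
have bA : bmeas ball_box A := bmeas_smear b1 b2 t x bw tphi.
have bB : bmeas ball_box B := bmeas_smear b1 b2 t x (bmeasM bw b1) tx.
have bC : bmeas ball_box C := bmeas_smear b1 b2 t x (bmeasM bw b2) ty.
transitivity (\int[mu3]_(z in ball_box) (2 * t * A z + t ^+ 2 * (B z + C z))).
  rewrite (bRintegralD mD finite_ball_box (bmeasZ _ bA) (bmeasZ _ (bmeasD bB bC))).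
  rewrite (bRintegralZ mD finite_ball_box _ bA).
  rewrite (bRintegralZ mD finite_ball_box _ (bmeasD bB bC)).
  by rewrite (bRintegralD mD finite_ball_box bB bC).
rewrite ball_box_fubini21; last exact: (bmeasD (bmeasZ _ bA) (bmeasZ _ (bmeasD bB bC))).
rewrite /sph_mean /smear -(bRintegralZ mD2 finite_angles); last first.
  exact: (bmeas_smear (bmeas_sph1 _) (bmeas_sph2 _) t x (bmeas_weight _) tphi).
apply: eq_Rintegral => w _.
pose g1 s := x.1 + t * (s * sph1 w); pose g2 s := x.2 + t * (s * sph2 w).
have Dg1 (s : R) : is_derive s 1 g1 (t * sph1 w).
  have := is_derive_add (is_derive_cst x.1 s 1) (is_derive_scale t
     (is_derive_mul (is_derive_id s 1) (is_derive_cst (sph1 w) s 1))).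
  by rewrite add0r mulr0 add0r mulr1.
have Dg2 (s : R) : is_derive s 1 g2 (t * sph2 w).
  have := is_derive_add (is_derive_cst x.2 s 1) (is_derive_scale t
     (is_derive_mul (is_derive_id s 1) (is_derive_cst (sph2 w) s 1))).
  by rewrite add0r mulr0 add0r mulr1.
have cg1 : continuous g1 by move=> s; exact: is_derive_continuous (Dg1 s).
have cg2 : continuous g2 by move=> s; exact: is_derive_continuous (Dg2 s).
pose F s := t * sph_weight w * (s * s * phi (g1 s, g2 s)).
pose f s := t * sph_weight w * (s * s * (t * sph1 w * px (g1 s, g2 s) + t * sph2 w * py (g1 s, g2 s))
   + phi (g1 s, g2 s) * (s * 1 + s * 1)).
have DF (s : R) : is_derive s 1 F (f s).
  have Ds2 := is_derive_mul (is_derive_id s 1) (is_derive_id s 1).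
  exact: (is_derive_scale _ (is_derive_mul Ds2 (is_derive_comp2 (sphi [::] _) (Dg1 s) (Dg2 s)))).
have cf : continuous f.
  have idc : continuous (fun s : R => s) by move=> s; exact: cvg_id.
  have cc (z : R) : continuous (fun s : R => z) by move=> s; exact: cvg_cst.
  have M (a b : R -> R) : continuous a -> continuous b -> continuous (fun s => a s * b s).
    by move=> ca cb s; apply: cvgM; [exact: ca|exact: cb].
  have P (a b : R -> R) : continuous a -> continuous b -> continuous (fun s => a s + b s).
    by move=> ca cb s; apply: cvgD; [exact: ca|exact: cb].
  have cphi := continuous_line sphi cg1 cg2.
  have cpx := continuous_line tx.1 cg1 cg2; have cpy := continuous_line ty.1 cg1 cg2.
  exact: (M _ _ (cc _) (P _ _ (M _ _ (M _ _ idc idc) (P _ _ (M _ _ (cc _) cpx) (M _ _ (cc _) cpy)))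
    (M _ _ cphi (P _ _ (M _ _ idc (cc 1)) (M _ _ idc (cc 1)))))).
have /= := Rintegral_FTC ltr01 DF cf.
rewrite (_ : F 1 - F 0 = t * (sph_weight w * phi (x.1 + t * sph1 w, x.2 + t * sph2 w))); last first.
  by rewrite /F /g1 /g2 !mul1r mul0r; ring.
move=> <-; apply: eq_Rintegral => s _.
rewrite /A /B /C /f /q /rad /= -/(g1 s) -/(g2 s).
set a := phi _; set b := px _; set c := py _; ring.
Qed.

Lemma is_derive_waveZ phi x t : test_function phi ->
  is_derive t 1 (fun t : R => waveZ t phi x) (waveW t phi x).
Proof.
move=> tphi.
have bw := bmeas_rad (bmeas_weight _); have b1 := bmeas_rad (bmeas_sph1 _).
have b2 := bmeas_rad (bmeas_sph2 _).
have D := is_derive_smear measurable_ball_box finite_ball_box b1 b2 x t bw tphi.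
have D2 : is_derive t 1 (fun t : R => (2 * pi)^-1 * (t * t)) ((2 * pi)^-1 * (t * 1 + t * 1)).
  by apply: is_derive_scale; apply: is_derive_mul; exact: is_derive_id.
have -> : (fun t : R => waveZ t phi x) = (fun t => (2 * pi)^-1 * (t * t) *
    smear mu3 ball_box (rad sph_weight) (rad sph1) (rad sph2) t phi x).
  by apply/funext => s; rewrite /waveZ [_ / _]mulrC expr2.
apply: (is_derive_eq (is_derive_mul D2 D)).
rewrite /waveW.
have := ball_mean_radial t x tphi.
rewrite /ball_mean.
set S := smear _ _ _ _ _ _ _ _; set X := smear _ _ _ _ _ _ _ _; set Y := smear _ _ _ _ _ _ _ _ => E.
rewrite (_ : _ / _ * _ = (2 * pi)^-1 * (t * sph_mean sph_weight t phi x)); last by ring.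
by rewrite -E; ring.
Qed.

Lemma bmeas_divergence1 D t (sb cb ca X Y XX XY YX YY : T2 -> R) :
  bmeas D sb -> bmeas D cb -> bmeas D ca -> bmeas D X -> bmeas D Y ->
  bmeas D XX -> bmeas D XY -> bmeas D YX -> bmeas D YY ->
  bmeas D (fun w => sb w * ((-1) * (sb w * ((-1) * (t * (sb w * XX w)) + t * (cb w * (ca w * XY w))))
      + (cb w * (ca w * ((-1) * (t * (sb w * YX w)) + t * (cb w * (ca w * YY w))))
      + ((-1) * (cb w * X w) + (-1) * (sb w * (ca w * Y w)))))
    + cb w * ((-1) * (sb w * X w) + cb w * (ca w * Y w))).
Proof. by move=> *; solve_bmeas. Qed.

Lemma bmeas_divergence2 D t (sb sa ca Y YY : T2 -> R) :
  bmeas D sb -> bmeas D sa -> bmeas D ca -> bmeas D Y -> bmeas D YY ->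
  bmeas D (fun w => t * (sb w * (sa w * (sa w * YY w))) + (-1) * (ca w * Y w)).
Proof. by move=> *; solve_bmeas. Qed.

Lemma continuous_divergence1 t (sb cb ca X Y XX XY YX YY : R -> R) :
  continuous sb -> continuous cb -> continuous ca -> continuous X -> continuous Y ->
  continuous XX -> continuous XY -> continuous YX -> continuous YY ->
  continuous (fun w => sb w * ((-1) * (sb w * ((-1) * (t * (sb w * XX w)) + t * (cb w * (ca w * XY w))))
      + (cb w * (ca w * ((-1) * (t * (sb w * YX w)) + t * (cb w * (ca w * YY w))))
      + ((-1) * (cb w * X w) + (-1) * (sb w * (ca w * Y w)))))
    + cb w * ((-1) * (sb w * X w) + cb w * (ca w * Y w))).
Proof. by move=> *; solve_continuous. Qed.

Lemma continuous_divergence2 t (sb sa ca Y YY : R -> R) :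
  continuous sb -> continuous sa -> continuous ca -> continuous Y -> continuous YY ->
  continuous (fun w => t * (sb w * (sa w * (sa w * YY w))) + (-1) * (ca w * Y w)).
Proof. by move=> *; solve_continuous. Qed.

Lemma sphere_divergence t x (px py pxx pxy pyx pyy : R * R -> R) :
  test_function px -> test_function py ->
  pxx = 'D_(e_x R) px -> pxy = 'D_(e_y R) px -> pyx = 'D_(e_x R) py -> pyy = 'D_(e_y R) py ->
  let S k psi := sph_mean k t psi x in
  2 * (S (fun w => sph_weight w * sph1 w) px + S (fun w => sph_weight w * sph2 w) py)
  + t * ((S (fun w => sph_weight w * sph1 w * sph1 w) pxx
        + S (fun w => sph_weight w * sph1 w * sph2 w) pxy)
       + (S (fun w => sph_weight w * sph2 w * sph1 w) pyx
        + S (fun w => sph_weight w * sph2 w * sph2 w) pyy))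
  = t * (S sph_weight pxx + S sph_weight pyy).
Proof.
move=> tx ty Exx Exy Eyx Eyy S.
have txx : test_function pxx by rewrite Exx; exact: (test_function_partial [:: true] tx).
have txy : test_function pxy by rewrite Exy; exact: (test_function_partial [:: false] tx).
have tyx : test_function pyx by rewrite Eyx; exact: (test_function_partial [:: true] ty).
have tyy : test_function pyy by rewrite Eyy; exact: (test_function_partial [:: false] ty).
have [mD fD] := (measurable_angles, finite_angles).
have bw := bmeas_weight angles; have b1 := bmeas_sph1 angles; have b2 := bmeas_sph2 angles.
pose q (w : T2) := (x.1 + t * sph1 w, x.2 + t * sph2 w).
have bq psi : test_function psi -> bmeas angles (fun w => psi (q w)).
  by move=> tpsi; have H := bmeas_comp_test b1 b2 t x tpsi; exact: H.
have SE k psi : S k psi = \int[mu2]_(w in angles) (k w * psi (q w)) by [].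
have bca : bmeas angles (fun w => cos w.2) by apply: bmeas_cos; exact: measurable_snd.
have bsa : bmeas angles (fun w => sin w.2) by apply: bmeas_sin; exact: measurable_snd.
have bcb : bmeas angles (fun w => cos w.1) by apply: bmeas_cos; exact: measurable_fst.
have bsb : bmeas angles (fun w => sin w.1) by apply: bmeas_sin; exact: measurable_fst.
have bx := bq _ tx; have by_ := bq _ ty; have bxx := bq _ txx; have bxy := bq _ txy.
have byx := bq _ tyx; have byy := bq _ tyy.
pose I (f : T2 -> R) := \int[mu2]_(w in angles) f w.
have ID f g : bmeas angles f -> bmeas angles g -> I (fun w => f w + g w) = I f + I g.
  by move=> bf bg; exact: (bRintegralD mD fD bf bg).
have IZ a f : bmeas angles f -> I (fun w => a * f w) = a * I f.
  by move=> bf; exact: (bRintegralZ mD fD a bf).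
pose pb (w : T2) := sin w.1 * ((-1) * (sin w.1 * ((-1) * (t * (sin w.1 * pxx (q w))) + t * (cos w.1 * (cos w.2 * pxy (q w)))))
      + (cos w.1 * (cos w.2 * ((-1) * (t * (sin w.1 * pyx (q w))) + t * (cos w.1 * (cos w.2 * pyy (q w)))))
      + ((-1) * (cos w.1 * px (q w)) + (-1) * (sin w.1 * (cos w.2 * py (q w))))))
    + cos w.1 * ((-1) * (sin w.1 * px (q w)) + cos w.1 * (cos w.2 * py (q w))).
pose qa (w : T2) := t * (sin w.1 * (sin w.2 * (sin w.2 * pyy (q w)))) + (-1) * (cos w.2 * py (q w)).
have bpb : bmeas angles pb := bmeas_divergence1 t bsb bcb bca bx by_ bxx bxy byx byy.
have bqa : bmeas angles qa := bmeas_divergence2 t bsb bsa bca by_ byy.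
have Fxx z : 'D_(e_x R) px z = pxx z by rewrite Exx.
have Fxy z : 'D_(e_y R) px z = pxy z by rewrite Exy.
have Fyx z : 'D_(e_x R) py z = pyx z by rewrite Eyx.
have Fyy z : 'D_(e_y R) py z = pyy z by rewrite Eyy.
have Ipb : I pb = 0.
  have E := lebesgue2_fubini21 (measurable_itv _) (measurable_itv _) (finite_itv 0 pi) (finite_itv 0 pi) bpb.
  rewrite /I /angles {}E (@eq_Rintegral _ _ _ _ _ (cst 0)) ?Rintegral_cst ?mul0r// => a _ /=.
  pose F (b : R) := sin b * ((-1) * (sin b * px (q (b, a))) + cos b * (cos a * py (q (b, a)))).
  have Dq1 (b : R) : is_derive b 1 (fun b : R => x.1 + t * cos b) (t * - sin b).
    by apply: (is_derive_eq (is_derive_add (is_derive_cst x.1 b 1) (is_derive_scale t (is_derive_cos b)))); rewrite add0r.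
  have Dq2 (b : R) : is_derive b 1 (fun b : R => x.2 + t * (sin b * cos a)) (t * (cos b * cos a)).
    apply: (is_derive_eq (is_derive_add (is_derive_cst x.2 b 1) (is_derive_scale t
      (is_derive_mul (is_derive_sin b) (is_derive_cst (cos a) b 1))))).
    by rewrite add0r mulr0 add0r mulrC [cos a * _]mulrC mulrC.
  have cq1 : continuous (fun b : R => x.1 + t * cos b) by move=> b; exact: is_derive_continuous (Dq1 b).
  have cq2 : continuous (fun b : R => x.2 + t * (sin b * cos a)) by move=> b; exact: is_derive_continuous (Dq2 b).
  have cp psi : test_function psi -> continuous (fun b : R => psi (q (b, a))).
    by move=> tpsi; exact: (continuous_line tpsi.1 cq1 cq2).
  have [c1 c2 c3 c4] := And4 (cp _ tx) (cp _ ty) (cp _ txx) (cp _ txy).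
  have [c5 c6] := conj (cp _ tyx) (cp _ tyy).
  have cpb : continuous (fun b : R => pb (b, a)) := (continuous_divergence1 (t:=t) (@continuous_sin R) (@continuous_cos R) (@continuous_const R (cos a))
      c1 c2 c3 c4 c5 c6).
  have DF (b : R) : is_derive b 1 F (pb (b, a)).
    have DX := is_derive_comp2_line tx.1 (Dq1 b) (Dq2 b).
    have DY := is_derive_comp2_line ty.1 (Dq1 b) (Dq2 b).
    rewrite Fxx Fxy in DX; rewrite Fyx Fyy in DY.
    apply: (is_derive_eq (is_derive_mul (is_derive_sin b) (is_derive_add
      (is_derive_scale (-1) (is_derive_mul (is_derive_sin b) DX))
      (is_derive_mul (is_derive_cos b) (is_derive_scale (cos a) DY))))).
    rewrite /pb /q /sph1 /sph2 /=; ring.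
  by rewrite (Rintegral_FTC (pi_gt0 R) DF cpb) /F sin0 sinpi !mul0r subrr.
have Iqa : I qa = 0.
  have E := lebesgue2_fubini12 (measurable_itv _) (measurable_itv _) (finite_itv 0 pi) (finite_itv 0 pi) bqa.
  rewrite /I /angles {}E (@eq_Rintegral _ _ _ _ _ (cst 0)) ?Rintegral_cst ?mul0r// => b _ /=.
  pose F (a : R) := (-1) * (sin a * py (q (b, a))).
  have Dq1 (a : R) : is_derive a 1 (fun a : R => x.1 + t * cos b) 0 by exact: is_derive_cst.
  have Dq2 (a : R) : is_derive a 1 (fun a : R => x.2 + t * (sin b * cos a)) (t * (sin b * - sin a)).
    apply: (is_derive_eq (is_derive_add (is_derive_cst x.2 a 1) (is_derive_scale t
      (is_derive_scale (sin b) (is_derive_cos a))))).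
    by rewrite add0r.
  have cq1 : continuous (fun a : R => x.1 + t * cos b) by move=> a; exact: is_derive_continuous (Dq1 a).
  have cq2 : continuous (fun a : R => x.2 + t * (sin b * cos a)) by move=> a; exact: is_derive_continuous (Dq2 a).
  have c2 : continuous (fun a : R => py (q (b, a))) := continuous_line ty.1 cq1 cq2.
  have c6 : continuous (fun a : R => pyy (q (b, a))) := continuous_line tyy.1 cq1 cq2.
  have cqa : continuous (fun a : R => qa (b, a)) := (continuous_divergence2 (t:=t) (@continuous_const R (sin b)) (@continuous_sin R) (@continuous_cos R) c2 c6).
  have DF (a : R) : is_derive a 1 F (qa (b, a)).
    have DY := is_derive_comp2_line ty.1 (Dq1 a) (Dq2 a).
    rewrite Fyx Fyy in DY.
    apply: (is_derive_eq (is_derive_scale (-1) (is_derive_mul (is_derive_sin a) DY))).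
    rewrite /qa /q /sph1 /sph2 /=; ring.
  by rewrite (Rintegral_FTC (pi_gt0 R) DF cqa) /F sin0 sinpi !mul0r subrr.
pose H1 w := 2 * (sph_weight w * sph1 w * px (q w) + sph_weight w * sph2 w * py (q w))
  + t * ((sph_weight w * sph1 w * sph1 w * pxx (q w) + sph_weight w * sph1 w * sph2 w * pxy (q w))
  + (sph_weight w * sph2 w * sph1 w * pyx (q w) + sph_weight w * sph2 w * sph2 w * pyy (q w))).
pose H2 w := t * (sph_weight w * pxx (q w) + sph_weight w * pyy (q w)).
have e1 : bmeas angles (fun w => sph_weight w * sph1 w * px (q w)) by solve_bmeas.
have e2 : bmeas angles (fun w => sph_weight w * sph2 w * py (q w)) by solve_bmeas.
have e3 : bmeas angles (fun w => sph_weight w * sph1 w * sph1 w * pxx (q w)) by solve_bmeas.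
have e4 : bmeas angles (fun w => sph_weight w * sph1 w * sph2 w * pxy (q w)) by solve_bmeas.
have e5 : bmeas angles (fun w => sph_weight w * sph2 w * sph1 w * pyx (q w)) by solve_bmeas.
have e6 : bmeas angles (fun w => sph_weight w * sph2 w * sph2 w * pyy (q w)) by solve_bmeas.
have e7 : bmeas angles (fun w => sph_weight w * pxx (q w)) by solve_bmeas.
have e8 : bmeas angles (fun w => sph_weight w * pyy (q w)) by solve_bmeas.
have bH1 : bmeas angles H1 := bmeasD (bmeasZ 2 (bmeasD e1 e2)) (bmeasZ t (bmeasD (bmeasD e3 e4) (bmeasD e5 e6))).
have bH2 : bmeas angles H2 := bmeasZ t (bmeasD e7 e8).
have <- : I H1 = 2 * (S (fun w => sph_weight w * sph1 w) px + S (fun w => sph_weight w * sph2 w) py)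
  + t * ((S (fun w => sph_weight w * sph1 w * sph1 w) pxx
        + S (fun w => sph_weight w * sph1 w * sph2 w) pxy)
       + (S (fun w => sph_weight w * sph2 w * sph1 w) pyx
        + S (fun w => sph_weight w * sph2 w * sph2 w) pyy)).
  rewrite /H1 (ID _ _ (bmeasZ 2 (bmeasD e1 e2)) (bmeasZ t (bmeasD (bmeasD e3 e4) (bmeasD e5 e6)))).
  rewrite (IZ _ _ (bmeasD e1 e2)) (IZ _ _ (bmeasD (bmeasD e3 e4) (bmeasD e5 e6))).
  by rewrite (ID _ _ e1 e2) (ID _ _ (bmeasD e3 e4) (bmeasD e5 e6)) (ID _ _ e3 e4) (ID _ _ e5 e6).
have <- : I H2 = t * (S sph_weight pxx + S sph_weight pyy).
  by rewrite /H2 (IZ _ _ (bmeasD e7 e8)) (ID _ _ e7 e8).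
transitivity (I H1 + (I pb + I qa)); first by rewrite Ipb Iqa !addr0.
rewrite -(ID _ _ bpb bqa) -(ID _ _ bH1 (bmeasD bpb bqa)).
apply: eq_Rintegral => w _.
rewrite /H1 /H2 /pb /qa /sph_weight /sph1 /sph2.
have := cos2Dsin2 w.1; have := cos2Dsin2 w.2.
set A := pxx _; set B := pxy _; set B' := pyx _; set C := pyy _; set a := px _; set b := py _.
set sb := sin w.1; set cb := cos w.1; set sa := sin w.2; set ca := cos w.2 => Ea Eb.
apply/eqP; rewrite -subr_eq0; apply/eqP.
transitivity ((cb ^+ 2 + sb ^+ 2 - 1) * (ca * b + t * sb * A + t * sb * ca ^+ 2 * C)
  + (ca ^+ 2 + sa ^+ 2 - 1) * (t * sb * C)); first by ring.
by rewrite Ea Eb subrr !mul0r addr0.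
Qed.

End SphericalMeans.

Section WaveOperators.
Context {R : realType}.
Notation mu := (@lebesgue_measure R).
Notation T1 := (measurableTypeR R).
Notation T2 := (measurableTypeR R * measurableTypeR R)%type.
Notation T3 := (T1 * T2)%type.
Notation mu2 := (@lebesgue2 R).
Notation mu3 := (@lebesgue3 R).
Implicit Types (phi psi : R * R -> R) (x : R * R) (t : R).

Lemma sph_weight_mass : \int[mu2]_(w in angles) sph_weight w = 2 * pi :> R.
Proof.
have E := lebesgue2_fubini12 (measurable_itv _) (measurable_itv _) (finite_itv 0 pi) (finite_itv 0 pi) (bmeas_weight angles).
rewrite /angles {}E.
transitivity (\int[mu]_(a in `[0, pi]) (pi * sin a)).
  apply: eq_Rintegral.
  by move=> a _; rewrite /sph_weight /= (Rintegral_itv_cst _ (pi_ge0 R)) subr0 mulrC.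
have D (a : R) : is_derive a 1 (fun a : R => pi * - cos a) (pi * sin a).
  by apply: (is_derive_eq (is_derive_scale pi (is_derive_opp (is_derive_cos a)))); rewrite opprK.
have c : continuous (fun a : R => pi * sin a).
  by apply: continuous_mul; [exact: continuous_const|exact: continuous_sin].
by rewrite (Rintegral_FTC (pi_gt0 R) D c) cospi cos0; ring.
Qed.

Lemma sph_mean0 phi x : sph_mean sph_weight 0 phi x = 2 * pi * phi x.
Proof.
transitivity (\int[mu2]_(w in angles) (phi x * sph_weight w)).
  apply: eq_Rintegral.
  by move=> w _; rewrite !mul0r !addr0 -surjective_pairing mulrC.
by rewrite (bRintegralZ measurable_angles finite_angles _ (bmeas_weight _)) sph_weight_mass mulrC.
Qed.

Definition dX phi : R * R -> R := 'D_(e_x R) phi.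
Definition dY phi : R * R -> R := 'D_(e_y R) phi.
Definition lap phi x : R := dX (dX phi) x + dY (dY phi) x.

Lemma test_function_dX phi : test_function phi -> test_function (dX phi).
Proof. exact: (test_function_partial [:: true]). Qed.

Lemma test_function_dY phi : test_function phi -> test_function (dY phi).
Proof. exact: (test_function_partial [:: false]). Qed.

Lemma lapE phi : lap phi = (fun x => 1 * dX (dX phi) x + dY (dY phi) x).
Proof. by apply/funext => x; rewrite mul1r. Qed.

Lemma test_function_lap phi : test_function phi -> test_function (lap phi).
Proof.
move=> tphi; rewrite lapE; apply: test_function_lin.
  by do 2 apply: test_function_dX.
by do 2 apply: test_function_dY.
Qed.

Lemma sph_mean_lap t phi x : test_function phi ->
  sph_mean sph_weight t (lap phi) x =
  sph_mean sph_weight t (dX (dX phi)) x + sph_mean sph_weight t (dY (dY phi)) x.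
Proof.
move=> tphi; rewrite lapE /sph_mean.
rewrite (smear_lin measurable_angles finite_angles (bmeas_sph1 _) (bmeas_sph2 _) 1 t x
  (bmeas_weight _) (test_function_dX (test_function_dX tphi)) (test_function_dY (test_function_dY tphi))).
by rewrite mul1r.
Qed.

Let sph_derive k phi x t : bmeas angles k -> test_function phi ->
  is_derive t 1 (fun t : R => sph_mean k t phi x)
    (sph_mean (fun w => k w * sph1 w) t (dX phi) x
     + sph_mean (fun w => k w * sph2 w) t (dY phi) x).
Proof.
move=> bk tphi.
exact: (is_derive_smear measurable_angles finite_angles (bmeas_sph1 _) (bmeas_sph2 _) x t bk tphi).
Qed.

Lemma waveW_lin t a phi psi x : test_function phi -> test_function psi ->
  waveW t (fun y => a * phi y + psi y) x = a * waveW t phi x + waveW t psi x.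
Proof.
move=> tphi tpsi; rewrite /waveW /sph_mean.
rewrite (smear_lin measurable_angles finite_angles (bmeas_sph1 _) (bmeas_sph2 _) _ _ _ (bmeas_weight _) tphi tpsi).
by ring.
Qed.

Lemma waveZ_lin t a phi psi x : test_function phi -> test_function psi ->
  waveZ t (fun y => a * phi y + psi y) x = a * waveZ t phi x + waveZ t psi x.
Proof.
move=> tphi tpsi; rewrite /waveZ /ball_mean.
rewrite (smear_lin measurable_ball_box finite_ball_box (bmeas_rad (bmeas_sph1 _)) (bmeas_rad (bmeas_sph2 _))
  _ _ _ (bmeas_rad (bmeas_weight _)) tphi tpsi).
by ring.
Qed.

Lemma partial_scale (a : R) phi l : smooth phi ->
  partial l (fun x => a * phi x) = (fun x => a * partial l phi x).
Proof.
move=> sphi; elim: l => //= b l ->; apply/funext => x.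
set v := if b then _ else _.
have D1 := derivableP (@diff_derivable _ _ _ _ _ v (sphi l x)).
exact: (derive_val (is_derive := is_deriveZ a D1)).
Qed.

Lemma test_function_scale (a : R) phi : test_function phi -> test_function (fun x => a * phi x).
Proof.
move=> tphi; have := test_function_lin (a - 1) tphi tphi.
by rewrite (_ : (fun x => _) = (fun x => a * phi x))//; apply/funext => x; ring.
Qed.

Lemma partial_waveW t phi l : test_function phi -> partial l (waveW t phi) = waveW t (partial l phi).
Proof.
move=> tphi.
have ts := test_function_smear measurable_angles finite_angles (bmeas_sph1 _) (bmeas_sph2 _) t (bmeas_weight _) tphi.
rewrite (_ : waveW t phi = (fun x => t / (2 * pi) * smear mu2 angles sph_weight sph1 sph2 t phi x))//.
rewrite (partial_scale _ _ ts.1).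
by rewrite (partial_smear measurable_angles finite_angles (bmeas_sph1 _) (bmeas_sph2 _) _ _ (bmeas_weight _) tphi).
Qed.

Lemma test_function_waveW t phi : test_function phi -> test_function (waveW t phi).
Proof.
move=> tphi; apply: test_function_scale.
exact: (test_function_smear measurable_angles finite_angles (bmeas_sph1 _) (bmeas_sph2 _) t (bmeas_weight _) tphi).
Qed.

Lemma partial_waveZ t phi l : test_function phi -> partial l (waveZ t phi) = waveZ t (partial l phi).
Proof.
move=> tphi.
have b1 := bmeas_rad (bmeas_sph1 (angles (R:=R))); have b2 := bmeas_rad (bmeas_sph2 (angles (R:=R))).
have bw := bmeas_rad (bmeas_weight (angles (R:=R))).
have ts := test_function_smear measurable_ball_box finite_ball_box b1 b2 t bw tphi.
rewrite (_ : waveZ t phi = (fun x => t ^+ 2 / (2 * pi) * smear mu3 ball_box (rad sph_weight) (rad sph1) (rad sph2) t phi x))//.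
rewrite (partial_scale _ _ ts.1).
by rewrite (partial_smear measurable_ball_box finite_ball_box b1 b2 _ _ bw tphi).
Qed.

Lemma test_function_waveZ t phi : test_function phi -> test_function (waveZ t phi).
Proof.
move=> tphi; apply: test_function_scale.
exact: (test_function_smear measurable_ball_box finite_ball_box (bmeas_rad (bmeas_sph1 _))
  (bmeas_rad (bmeas_sph2 _)) t (bmeas_rad (bmeas_weight _)) tphi).
Qed.

Lemma waveW_bounded : exists c : R, 0 <= c /\ forall t phi M x, test_function phi ->
  (forall y, `|phi y| <= M) -> `|waveW t phi x| <= c * `|t| * M.
Proof.
have [c [c0 Hc]] := smear_bounded measurable_angles finite_angles (bmeas_sph1 _) (bmeas_sph2 _) (bmeas_weight (angles (R:=R))).
exists (c / (2 * pi)); have p0 : 0 <= (2 * pi)^-1 :> R by rewrite invr_ge0 mulr_ge0// pi_ge0.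
split => [|t phi M x tphi HM]; first exact: mulr_ge0.
rewrite /waveW !normrM (ger0_norm p0) (_ : c / _ * _ * _ = `|t| / (2 * pi) * (c * M)); last by ring.
by rewrite ler_wpM2l ?mulr_ge0//; exact: Hc.
Qed.

Lemma waveZ_bounded : exists c : R, 0 <= c /\ forall t phi M x, test_function phi ->
  (forall y, `|phi y| <= M) -> `|waveZ t phi x| <= c * t ^+ 2 * M.
Proof.
have [c [c0 Hc]] := smear_bounded measurable_ball_box finite_ball_box (bmeas_rad (bmeas_sph1 _))
  (bmeas_rad (bmeas_sph2 _)) (bmeas_rad (bmeas_weight (angles (R:=R)))).
exists (c / (2 * pi)); have p0 : 0 <= (2 * pi)^-1 :> R by rewrite invr_ge0 mulr_ge0// pi_ge0.
split => [|t phi M x tphi HM]; first exact: mulr_ge0.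
have t0 : 0 <= t ^+ 2 / (2 * pi) by rewrite mulr_ge0// sqr_ge0.
rewrite /waveZ normrM (ger0_norm t0).
rewrite (_ : c / _ * _ * _ = t ^+ 2 / (2 * pi) * (c * M)); last by ring.
by rewrite ler_wpM2l//; exact: Hc.
Qed.

#[local] Opaque derive smear sin cos pi Rintegral sph_mean ball_mean.

Definition waveC0 t phi x : R := (2 * pi)^-1 * (sph_mean sph_weight t phi x
  + t * (sph_mean (fun w => sph_weight w * sph1 w) t (dX phi) x
       + sph_mean (fun w => sph_weight w * sph2 w) t (dY phi) x)).

Lemma is_derive_waveW0 phi x t : test_function phi ->
  is_derive t 1 (fun t : R => waveW t phi x) (waveC0 t phi x).
Proof.
move=> tphi.
have -> : (fun t : R => waveW t phi x) = (fun t => (2 * pi)^-1 * (t * sph_mean sph_weight t phi x)).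
  by apply/funext => s; rewrite /waveW; ring.
apply: (is_derive_eq (is_derive_scale (2 * pi)^-1 (is_derive_mul (is_derive_id t 1)
  (sph_derive x t (bmeas_weight _) tphi)))).
by apply: (congr1 ( *%R _)); rewrite mulr1 addrC.
Qed.

Lemma is_derive_waveC0 phi x t : test_function phi ->
  is_derive t 1 (fun t : R => waveC0 t phi x) (waveW t (lap phi) x).
Proof.
move=> tphi.
have tx := test_function_dX tphi; have ty := test_function_dY tphi.
have b1 := bmeasM (bmeas_weight (angles (R:=R))) (bmeas_sph1 _).
have b2 := bmeasM (bmeas_weight (angles (R:=R))) (bmeas_sph2 _).
apply: (is_derive_eq (is_derive_scale (2 * pi)^-1 (is_derive_add
  (sph_derive x t (bmeas_weight _) tphi) (is_derive_mul (is_derive_id t 1)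
  (is_derive_add (sph_derive x t b1 tx) (sph_derive x t b2 ty)))))).
have E := @sphere_divergence R t x (dX phi) (dY phi) (dX (dX phi)) (dY (dX phi))
   (dX (dY phi)) (dY (dY phi)) tx ty erefl erefl erefl erefl.
rewrite /waveW (sph_mean_lap _ _ tphi).
rewrite [t / _]mulrC -mulrA.
apply: (etrans _ (congr1 ( *%R (2 * pi)^-1) E)).
have alg (c A B : R) : c * (A + (B + A * 1)) = c * (2 * A + B) by ring.
exact: alg.
Qed.

Lemma waveZ0 phi x : waveZ 0 phi x = 0.
Proof. by rewrite /waveZ expr0n /= !mul0r. Qed.

Lemma waveW0 phi x : waveW 0 phi x = 0.
Proof. by rewrite /waveW !mul0r. Qed.

Lemma waveC0E phi x t : test_function phi -> waveC0 t phi x = phi x + waveZ t (lap phi) x.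
Proof.
move=> tphi; have tl := test_function_lap tphi.
have D (s : R) : is_derive s 1 (fun t : R => waveC0 t phi x + - waveZ t (lap phi) x) 0.
  apply: (is_derive_eq (is_derive_add (is_derive_waveC0 x s tphi)
    (is_derive_opp (is_derive_waveZ x s tl)))).
  by rewrite subrr.
have E : waveC0 t phi x + - waveZ t (lap phi) x = waveC0 0 phi x + - waveZ 0 (lap phi) x
  := is_derive0_eq t 0 D.
have E0 : waveC0 0 phi x = phi x.
  have p0 : 2 * pi != 0 :> R by apply: lt0r_neq0; apply: mulr_gt0; [exact: ltr0n|exact: pi_gt0].
  rewrite /waveC0 mul0r addr0 sph_mean0; exact: (mulKf p0).
apply/eqP; rewrite -subr_eq; apply/eqP; apply: (etrans E).
rewrite waveZ0 E0 oppr0; exact: addr0.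
Qed.

Lemma is_derive_waveW phi x t : test_function phi ->
  is_derive t 1 (fun t : R => waveW t phi x) (phi x + waveZ t (lap phi) x).
Proof. by move=> tphi; rewrite -waveC0E//; exact: is_derive_waveW0. Qed.

End WaveOperators.

(** * Uniqueness by duality *)

Section SeparateTransport.
Context {R : realType}.

Lemma is_derive_littleo (f : R -> R) (s a : R) :
  (forall e : R, 0 < e -> exists d : R, 0 < d /\ forall h, `|h| < d ->
     `|f (s + h) - f s - h * a| <= e * `|h|) -> is_derive s 1 f a.
Proof.
move=> H.
pose dd (h : R) := h * a.
have lin_d : linear dd by move=> z u v; rewrite /dd /= /GRing.scale/=; ring.
pose dlM := GRing.isLinear.Build _ _ _ _ _ lin_d.
pose dL : {linear _ -> _} := HB.pack dd dlM.
have cd : continuous dL by move=> z; exact: mulrr_continuous.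
have E (e : R) : 0 < e -> \forall v \near (0 : R), `|f (s + v) - f s - dL v| <= e * `|v|.
  move=> /H[d [d0 Hd]]; near=> v; apply: Hd.
  by near: v; exact: (@nbhs0_lt R R).
have [Df dE] := differentiable_littleo cd E.
apply: DeriveDef; first exact: diff_derivable.
by rewrite deriveE// dE /= /dd mul1r.
Unshelve. all: by end_near. Qed.

Lemma is_deriveP (f : R -> R) (s a : R) : is_derive s 1 f a ->
  forall e : R, 0 < e -> exists d : R, 0 < d /\ forall h, `|h| < d ->
     `|f (s + h) - f s - h * a| <= e * `|h|.
Proof.
move=> [Df Ea] e e0.
have : h^-1 *: (f (h *: 1 + s) - f s) @[h --> (0:R)^'] --> a.
  by rewrite -Ea; exact: Df.
move=> /cvgrPdist_le /(_ e e0); rewrite near_withinE => /nbhs_ballP[d /= d0 Hd].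
exists d; split => // h hd; have [->|h0] := eqVneq h 0.
  by rewrite addr0 mul0r subr0 subrr normr0 mulr0.
have := Hd h; rewrite /ball /= sub0r normrN => /(_ hd h0).
rewrite /GRing.scale /= mulr1 [h + s]addrC distrC => H.
rewrite (_ : _ - _ = h * (h^-1 * (f (s + h) - f s) - a)); last by field.
by rewrite normrM mulrC ler_wpM2r.
Qed.

Lemma near_continuous (f : R -> R) (s : R) : {for s, continuous f} ->
  forall e : R, 0 < e -> exists d : R, 0 < d /\ forall s', `|s' - s| < d -> `|f s' - f s| < e.
Proof.
move=> cf e e0; move/cvgrPdist_lt : (cf) => /(_ e e0) /nbhs_ballP[d /= d0 Hd].
exists d; split => // s' s'd; rewrite distrC; apply: Hd; rewrite /ball /= distrC//.
Qed.

Lemma locally_constant_eq_derive (h : R -> R) (a b : R) : a <= b ->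
  (forall s : R, a <= s <= b -> is_derive s 1 h 0) -> h a = h b.
Proof.
move=> ab D.
have Doo (x : R) : x \in `]a, b[ -> is_derive x 1 h (cst 0 x).
  by rewrite in_itv /= => /andP[ax xb]; apply: D; rewrite (ltW ax) (ltW xb).
have cw : {within `[a, b], continuous h}.
  apply: derivable_within_continuous => x; rewrite in_itv /= => /D Dx.
  exact: ex_derive.
have [c _] := MVT_segment ab Doo cw.
by move=> /eqP; rewrite /= mul0r subr_eq0 => /eqP.
Qed.

Lemma locally_constant_eq (h : R -> R) (a b : R) : a <= b ->
  (forall s, a <= s <= b -> exists e : R, 0 < e /\ forall s', `|s' - s| < e -> h s' = h s) ->
  h a = h b.
Proof.
move=> ab H; apply: locally_constant_eq_derive => // s /H[e [e0 He]].
apply: is_derive_littleo => z z0.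
exists e; split => // k ke; rewrite (He (s + k)) ?[s + k]addrC ?addrK//.
by rewrite subrr mulr0 subrr normr0 mulr_ge0// ltW.
Qed.

Lemma continuous_frequently0 (k : R -> R) (x : R) : {for x, continuous k} ->
  (forall e : R, 0 < e -> exists y, `|y - x| < e /\ k y = 0) -> k x = 0.
Proof.
move=> ck H; apply/eqP; apply/negPn/negP => k0.
rewrite -normr_gt0 in k0; have [d [d0 Hd]] := near_continuous ck k0.
by have [y [/Hd + ky]] := H _ d0; rewrite ky sub0r normrN ltxx.
Qed.

Variables (F F1 F2 : R -> R -> R).
Hypothesis DF : forall s t : R, 0 < s -> is_derive t 1 (F s) (F1 s t).
Hypothesis DF1 : forall s t : R, 0 < s -> is_derive t 1 (F1 s) (F2 s t).
Hypothesis cF2 : forall s : R, 0 < s -> continuous (F2 s).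
Hypothesis DsF : forall s t : R, 0 < s -> is_derive s 1 (fun s => F s t) (F1 s t).
Hypothesis csF1 : forall s t : R, 0 < s -> {for s, continuous (fun s => F1 s t)}.
Hypothesis csF2 : forall s t : R, 0 < s -> {for s, continuous (fun s => F2 s t)}.

Variable N : R.

Let eqH (s s' : R) := forall tau, `|tau| < N -> F s (tau - s) = F s' (tau - s').
Let good (s : R) := exists e : R, 0 < e /\ forall s', `|s' - s| < e -> 0 < s' /\ eqH s' s.
Let bad (s : R) := 0 < s /\ ~ good s.
Let E (m : nat) (s : R) := forall tau, `|tau| < N -> `|F2 s (tau - s)| <= m%:R.

Let E_cover s : 0 < s -> exists m, E m s.
Proof.
move=> s0.
have /compact_bounded[M [_ HM]] : compact (F2 s @` `[- N - s, N - s]).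
  apply: continuous_compact; last exact: segment_compact.
  by apply: continuous_subspaceT; exact: cF2.
exists (Num.truncn (`|M| + 1)).+1 => tau tN.
apply: (@le_trans _ _ (`|M| + 1)); last by apply: ltW; exact: truncnS_gt.
apply: (HM (`|M| + 1)); first by rewrite (le_lt_trans (ler_norm M))// ltrDl.
exists (tau - s) => //=; rewrite in_itv /= !lerD2r.
by move: tN; rewrite ltr_norml => /andP[/ltW -> /ltW ->].
Qed.

Let E_closed m s : 0 < s -> ~ E m s ->
  exists e : R, 0 < e /\ forall s', `|s' - s| < e -> ~ E m s'.
Proof.
move=> s0 /existsNP[tau /not_implyP[tN /negP]]; rewrite -ltNge => mF.
have mF0 : 0 < `|F2 s (tau - s)| - m%:R by rewrite subr_gt0.
have [d [d0 Hd]] := near_continuous (@csF2 _ (tau - s) s0) mF0.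
exists (Num.min d (N - `|tau|)); split; first by rewrite lt_min d0 subr_gt0.
move=> s'; rewrite lt_min => /andP[/Hd H1 H2] /(_ (tau - s + s')).
have : `|tau - s + s'| < N.
  rewrite -addrA [- s + _]addrC (le_lt_trans (ler_normD _ _))//.
  by rewrite -ltrBrDl.
move=> /[swap] /[apply]; rewrite addrK => H3.
have := ler_normB (F2 s' (tau - s)) (F2 s' (tau - s) - F2 s (tau - s)).
rewrite opprB addrC subrK => H4; lra.
Qed.

Let good_open s : good s -> exists e : R, 0 < e /\ forall s', `|s' - s| < e -> good s'.
Proof.
move=> [e [e0 He]]; exists e; split => // s' s'e.
exists (e - `|s' - s|); split; first by rewrite subr_gt0.
move=> s'' H; have [] := He s''.
  have := ler_normD (s'' - s') (s' - s); rewrite addrA subrK; lra.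
move=> s''0 e1; split => // tau tN; rewrite e1//.
by have [_ ->] := He s' s'e.
Qed.

Let baire c0 : bad c0 -> exists c e m, [/\ bad c, 0 < e :> R &
  forall s, `|s - c| < e -> 0 < s /\ (bad s -> E m s)].
Proof.
move=> bc0; apply: contrapT => H.
have step (n : nat) (p : R * R) : bad p.1 /\ 0 < p.2 < p.1 -> exists q : R * R,
    [/\ bad q.1, 0 < q.2 < q.1, p.1 - p.2 <= q.1 - q.2, q.1 + q.2 <= p.1 + p.2 &
      forall s, `|s - q.1| <= q.2 -> ~ E n s].
  move=> [bp /andP[p20 p21]].
  have [c [cp bc nEc]] : exists c, [/\ `|c - p.1| < p.2, bad c & ~ E n c].
    apply: contrapT => H'; apply: H; exists p.1, p.2, n; split => // s sp.
    split; first by have := ler_norm (p.1 - s); rewrite distrC; lra.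
    by move=> bs; apply: contrapT => nE; apply: H'; exists s.
  have [e [e0 He]] := E_closed bc.1 nEc.
  pose e' := Num.min (Num.min (e / 2) (c / 2)) (p.2 - `|c - p.1|).
  have e'0 : 0 < e'.
    by rewrite !lt_min subr_gt0 cp !divr_gt0//; case: bc.
  have e'e : e' <= e / 2 by rewrite /e' !ge_min lexx.
  have e'c : e' <= c / 2 by rewrite /e' !ge_min lexx orbT.
  have e'p : e' <= p.2 - `|c - p.1| by rewrite /e' ge_min lexx orbT.
  have n1 := ler_norm (c - p.1); have n2 := ler_norm (p.1 - c); rewrite distrC in n2.
  have c0' : 0 < c by case: bc.
  exists (c, e'); split => //=; [lra|lra|lra|].
  by move=> s sc; apply: He; lra.
have [f Hf] : exists f : nat -> R * R, bad (f 0).1 /\ 0 < (f 0).2 < (f 0).1 /\ forall n,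
   [/\ bad (f n.+1).1, 0 < (f n.+1).2 < (f n.+1).1,
    (f n).1 - (f n).2 <= (f n.+1).1 - (f n.+1).2, (f n.+1).1 + (f n.+1).2 <= (f n).1 + (f n).2 &
      forall s, `|s - (f n.+1).1| <= (f n.+1).2 -> ~ E n s].
  pose g n (p : {p : R * R | bad p.1 /\ 0 < p.2 < p.1}) := cid (step n _ (svalP p)).
  pose nxt n p : {p : R * R | bad p.1 /\ 0 < p.2 < p.1} :=
    exist _ (sval (g n p)) (let: And5 a b _ _ _ := svalP (g n p) in conj a b).
  have p0 : bad (c0, c0 / 2).1 /\ 0 < (c0, c0 / 2).2 < (c0, c0 / 2).1.
    by split => //=; case: bc0 => c00 _; lra.
  pose fix h n := if n is n'.+1 then nxt n' (h n') else exist _ _ p0.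
  exists (fun n => sval (h n)); split; first exact: p0.1.
  split; first exact: p0.2.
  by move=> n; exact: (svalP (g n (h n))).
have [b0 [/andP[f00 f01] Hn]] := Hf.
pose l n := (f n).1 - (f n).2; pose r n := (f n).1 + (f n).2.
have lr n : l n <= r n.
  have f2 : 0 < (f n).2 by case: n => // n; have [_ /andP[]] := Hn n.
  by rewrite /l /r; lra.
have ml : nondecreasing_seq l by apply/nondecreasing_seqP => n; have [] := Hn n.
have mr : nonincreasing_seq r by apply/nonincreasing_seqP => n; have [] := Hn n.
have lrnm n m : l n <= r m.
  have [nm|/ltnW mn] := leqP n m; first exact: le_trans (ml _ _ nm) (lr m).
  exact: le_trans (lr n) (mr _ _ mn).
pose s := sup (range l).
have hs : has_sup (range l).
  split; first by exists (l 0), 0.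
  by exists (r 0) => _ [n _ <-].
have ls n : l n <= s by apply: ub_le_sup; [case: hs|exists n].
have sr n : s <= r n by apply: ge_sup; [case: hs|move=> _ [m _ <-]].
have s0 : 0 < s by have := ls 0; rewrite /l; lra.
have [m Em] := E_cover s0.
have [_ _ _ _ /(_ s)] := Hn m; apply => //.
have := ls m.+1; have := sr m.+1; rewrite /l /r ler_norml => H1 H2.
by apply/andP; split; lra.
Qed.

Let eqH_F2 (s s' : R) : 0 < s -> 0 < s' -> eqH s s' ->
  forall tau, `|tau| < N -> F2 s (tau - s) = F2 s' (tau - s').
Proof.
move=> s0 s'0 H.
have gen (G1 G1' G2 G2' : R -> R) : (forall t : R, is_derive t 1 G1 (G2 t)) ->
    (forall t : R, is_derive t 1 G1' (G2' t)) ->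
    (forall tau, `|tau| < N -> G1 (tau - s) = G1' (tau - s')) ->
    forall tau, `|tau| < N -> G2 (tau - s) = G2' (tau - s').
  move=> D1 D1' HG tau tN.
  have e0 (z : R) : 0 < z -> `|G2 (tau - s) - G2' (tau - s')| <= 2 * z.
    move=> z0.
    have [d [d0 Hd]] := is_deriveP (D1 (tau - s)) z0.
    have [d' [d'0 Hd']] := is_deriveP (D1' (tau - s')) z0.
    pose h := Num.min (Num.min d d') (N - `|tau|) / 2.
    have M0 : 0 < Num.min (Num.min d d') (N - `|tau|) by rewrite !lt_min d0 d'0 subr_gt0.
    have h0 : 0 < h by rewrite /h; lra.
    have hM : h < Num.min (Num.min d d') (N - `|tau|) by rewrite /h; lra.
    move: hM; rewrite !lt_min => /andP[/andP[hd hd'] hN].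
    have hh : `|h| = h by rewrite gtr0_norm.
    have := Hd h; rewrite hh => /(_ hd) B1; have := Hd' h; rewrite hh => /(_ hd') B2.
    have Eq1 : G1 (tau - s + h) = G1' (tau - s' + h).
      rewrite addrAC [in RHS]addrAC HG// (le_lt_trans (ler_normD _ _))// hh; lra.
    have Eq0 := HG _ tN.
    move: B1 B2; rewrite Eq1 Eq0 => B1 B2.
    rewrite -(ler_pM2r h0) -[X in _ * X <= _]hh -normrM.
    have := ler_normD (G1' (tau - s' + h) - G1' (tau - s') - h * G2' (tau - s'))
      (- (G1' (tau - s' + h) - G1' (tau - s') - h * G2 (tau - s))).
    rewrite normrN (_ : _ + - _ = (G2 (tau - s) - G2' (tau - s')) * h); last by ring.
    lra.
  apply/eqP; rewrite -subr_eq0 -normr_le0; apply/ler_addgt0Pl => z z0; rewrite addr0.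
  by have := e0 (z / 2); rewrite [2 * _]mulrC divfK//; apply; rewrite divr_gt0.
apply: (gen (F1 s) (F1 s') (F2 s) (F2 s')); [by move=> t; exact: DF1|by move=> t; exact: DF1|].
by apply: (gen (F s) (F s') (F1 s) (F1 s')) => // t; exact: DF.
Qed.

Let contF_t s : 0 < s -> continuous (F s).
Proof. by move=> s0 t; exact: is_derive_continuous (DF t s0). Qed.

Let contF_s s t : 0 < s -> {for s, continuous (fun s => F s t)}.
Proof. by move=> s0; exact: is_derive_continuous (DsF t s0). Qed.

Let eqH_limit s b : 0 < s -> 0 < b ->
  (forall e : R, 0 < e -> exists y, [/\ `|y - b| < e, 0 < y & eqH s y]) -> eqH s b.
Proof.
move=> s0 b0 H tau tN.
pose t := tau - b.
have C1 : {for b, continuous (fun y => F s (t + y - s) - F y t)}.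
  apply: cvgB; last exact: contF_s.
  apply: (@continuous_comp _ _ _ (fun y => t + y - s) (F s)); last exact: contF_t.
  by apply: cvgB; [apply: cvgD; [exact: cvg_cst|exact: cvg_id]|exact: cvg_cst].
have := continuous_frequently0 C1; rewrite /t subrK => C2.
apply/eqP; rewrite -subr_eq0; apply/eqP; apply: C2 => e e0.
have [|y [yb y0 Hy]] := H (Num.min e (N - `|tau|)); first by rewrite lt_min e0 subr_gt0.
move: yb; rewrite lt_min => /andP[ye yN]; exists y; split => //.
rewrite Hy; first by rewrite addrK subrr.
rewrite -addrA [- b + y]addrC (le_lt_trans (ler_normD _ _))//; lra.
Qed.

Let eqH_segment s c : 0 < s -> 0 < c ->
  (forall th, 0 <= th <= 1 -> good (s + th * (c - s))) -> eqH s c.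
Proof.
move=> s0 c0 H tau tN.
pose p th := s + th * (c - s).
have := @locally_constant_eq (fun th => F (p th) (tau - p th)) 0 1 ler01.
rewrite /p mul0r addr0 mul1r subrKC; apply => th /H[e [e0 He]].
exists (e / (`|c - s| + 1)); split; first by rewrite divr_gt0// ltr_wpDl.
move=> th' Hth; have [] := He (p th').
  rewrite (_ : _ - _ = (th' - th) * (c - s)); last by rewrite /p; ring.
  rewrite normrM; move: Hth; rewrite ltr_pdivlMr; last by rewrite ltr_wpDl.
  apply: le_lt_trans; rewrite ler_wpM2l// lerDl//.
by move=> _ ->.
Qed.

Let bad_between s c : 0 < s -> bad c ->
  exists b, [/\ bad b, eqH s b & exists th, 0 <= th <= 1 /\ b = s + th * (c - s)].
Proof.
move=> s0 bc; have c0 : 0 < c by case: bc.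
pose p th := s + th * (c - s).
have p_gt0 th : 0 <= th <= 1 -> 0 < p th.
  by rewrite /p => /andP[t0 t1]; nra.
pose Th := [set th | 0 <= th <= 1 /\ bad (p th)].
have Th1 : Th 1 by split; rewrite /= ?ler01 ?lexx// /p mul1r subrKC.
have hTh : has_inf Th.
  by split; [exists 1|exists 0 => th [/andP[]]].
pose th0 := inf Th.
have th00 : 0 <= th0 by apply: lb_le_inf; [exists 1|move=> th [/andP[]]].
have th01 : th0 <= 1 by apply: ge_inf => //; case: hTh.
have gd th : 0 <= th < th0 -> good (p th).
  move=> /andP[t0 t1]; apply: contrapT => ng.
  suff : th0 <= th by rewrite leNgt t1.
  apply: ge_inf; first by case: hTh.
  by split; [rewrite t0 (le_trans (ltW t1))|split => //; apply: p_gt0; rewrite t0 (le_trans (ltW t1))].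
have b0 : 0 < p th0 by apply: p_gt0; rewrite th00.
have bad0 : bad (p th0).
  split => // /good_open[e [e0 He]].
  have K0 : 0 < e / (`|c - s| + 1) by rewrite divr_gt0// ltr_wpDl.
  have [th Tth tlt] := inf_adherent K0 hTh.
  apply: Tth.2.2; apply: He.
  have thge : th0 <= th by apply: ge_inf => //; case: hTh.
  rewrite (_ : _ - _ = (th - th0) * (c - s)); last by rewrite /p; ring.
  rewrite normrM ger0_norm ?subr_ge0//.
  have : th - th0 < e / (`|c - s| + 1) by rewrite ltrBlDl.
  rewrite ltr_pdivlMr; last by rewrite ltr_wpDl.
  by apply: le_lt_trans; rewrite ler_wpM2l ?subr_ge0// lerDl.
exists (p th0); split => //; last by exists th0; rewrite th00 th01.
have [th00'|th0_gt0] := eqVneq th0 0.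
  by rewrite th00' /p mul0r addr0.
have th0p : 0 < th0 by rewrite lt_neqAle eq_sym th0_gt0.
apply: eqH_limit => // e e0.
pose d := Num.min th0 (e / (`|c - s| + 1)) / 2.
have K0 : 0 < e / (`|c - s| + 1) by rewrite divr_gt0// ltr_wpDl.
have m0 : 0 < Num.min th0 (e / (`|c - s| + 1)) by rewrite lt_min th0p.
have d0 : 0 < d by rewrite /d; lra.
have : d < Num.min th0 (e / (`|c - s| + 1)) by rewrite /d; lra.
rewrite lt_min => /andP[d1 d2].
have th'0 : 0 < th0 - d by lra.
exists (p (th0 - d)); split.
- rewrite (_ : _ - _ = - d * (c - s)); last by rewrite /p; ring.
  rewrite normrM normrN (gtr0_norm d0); move: d2; rewrite ltr_pdivlMr; last by rewrite ltr_wpDl.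
  by apply: le_lt_trans; apply: ler_wpM2l; [exact: ltW|rewrite lerDl].
- by apply: p_gt0; apply/andP; split; lra.
- apply: eqH_segment => //; first by apply: p_gt0; apply/andP; split; lra.
  move=> th /andP[t0 t1].
  rewrite (_ : _ + _ = p (th * (th0 - d))); last by rewrite /p; ring.
  apply: gd; apply/andP; split; first by rewrite mulr_ge0// ltW.
  nra.
Qed.

Let good_of_bound m c (e : R) : 0 < e ->
  (forall s, `|s - c| < e -> 0 < s /\ E m s) -> good c.
Proof.
move=> e0 H; exists e; split => // s' s'e; split; first by have [] := H s' s'e.
move=> tau tN.
have D (s : R) : `|s - c| < e -> is_derive s 1 (fun s => F s (tau - s)) 0.
  move=> sc; have [s0 _] := H s sc.
  apply: is_derive_littleo => z z0.
  have z30 : 0 < z / 3 by rewrite divr_gt0.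
  have [d1 [d10 H1]] := is_deriveP (DsF (tau - s) s0) z30.
  have [d2 [d20 H2]] := near_continuous (@csF1 _ (tau - s) s0) z30.
  pose d3 := z / (3 * (m%:R + 1)).
  have m1 : 0 < m%:R + 1 :> R by rewrite ltr_wpDl.
  have d30 : 0 < d3 by rewrite divr_gt0// mulr_gt0.
  pose d4 := (N - `|tau|) / 2; have d40 : 0 < d4 by rewrite divr_gt0// subr_gt0.
  pose d5 := e - `|s - c|; have d50 : 0 < d5 by rewrite subr_gt0.
  exists (Num.min (Num.min d1 d2) (Num.min d3 (Num.min d4 d5))).
  split; first by rewrite !lt_min d10 d20 d30 d40 d50.
  move=> k; rewrite !lt_min => /andP[/andP[k1 k2] /andP[k3 /andP[k4 k5]]].
  have skc : `|s + k - c| < e.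
    rewrite addrAC (le_lt_trans (ler_normD _ _))//; rewrite /d5 in k5; lra.
  have [sk0 Esk] := H _ skc.
  have [xi [xik Exi]] := mvt_R (tau - s) (tau - (s + k)) (fun t => DF t sk0).
  have [ze [zek Eze]] := mvt_R (tau - s) xi (fun t => DF1 t sk0).
  rewrite (_ : tau - (s + k) - (tau - s) = - k) in xik Exi; last by ring.
  rewrite normrN in xik.
  have zk : `|ze - (tau - s)| <= `|k| by exact: le_trans zek xik.
  have B : `|F2 (s + k) ze| <= m%:R.
    rewrite (_ : ze = (ze + (s + k)) - (s + k)); last by rewrite addrK.
    apply: Esk.
    rewrite (_ : ze + (s + k) = tau + (ze - (tau - s)) + k); last by ring.
    rewrite (le_lt_trans (ler_normD _ _))//.
    have := ler_normD tau (ze - (tau - s)); rewrite /d4 in k4; lra.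
  have -> : F (s + k) (tau - (s + k)) - F s (tau - s) - k * 0 =
    (F (s + k) (tau - s) - F s (tau - s) - k * F1 s (tau - s))
    - k * (F1 (s + k) (tau - s) - F1 s (tau - s))
    - k * (F1 (s + k) xi - F1 (s + k) (tau - s)).
    have : F (s + k) (tau - (s + k)) = F (s + k) (tau - s) + F1 (s + k) xi * - k.
      by rewrite -Exi subrKC.
    move=> ->; ring.
  have A1 := H1 k k1.
  have A2 : `|k * (F1 (s + k) (tau - s) - F1 s (tau - s))| <= z / 3 * `|k|.
    rewrite normrM mulrC ler_wpM2r//; apply: ltW; apply: H2.
    by rewrite [s + k]addrC addrK.
  have A3 : `|k * (F1 (s + k) xi - F1 (s + k) (tau - s))| <= z / 3 * `|k|.
    rewrite Eze normrM mulrC ler_wpM2r// normrM.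
    apply: (@le_trans _ _ (m%:R * `|k|)); first by apply: ler_pM => //.
    move: k3; rewrite /d3 ltr_pdivlMr; last by rewrite mulr_gt0.
    have := normr_ge0 k; have m0 : 0 <= m%:R :> R by [].
    move: (m%:R : R) m0 => M; move: `|k| => K; nra.
  apply: (le_trans (ler_normB _ _)).
  have := ler_normB (F (s + k) (tau - s) - F s (tau - s) - k * F1 s (tau - s))
     (k * (F1 (s + k) (tau - s) - F1 s (tau - s))).
  lra.
have [cs'|s'c] := leP c s'.
  apply/esym; apply: (locally_constant_eq_derive (h := fun s => F s (tau - s)) cs') => s /andP[cs ss].
  by apply: D; rewrite ger0_norm ?subr_ge0// (le_lt_trans _ s'e)// ger0_norm ?subr_ge0// lerD2r.
apply: (locally_constant_eq_derive (h := fun s => F s (tau - s)) (ltW s'c)) => s /andP[cs ss].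
apply: D; rewrite distrC ger0_norm ?subr_ge0// (le_lt_trans _ s'e)// distrC ger0_norm ?subr_ge0//.
  by rewrite lerB.
exact: ltW.
Qed.

Let no_bad c : ~ bad c.
Proof.
move=> /baire[{}c [e [m [bc e0 H]]]].
apply: bc.2; apply: (good_of_bound (m := m) e0) => s sc.
have [s0 _] := H s sc; split => //.
have [b [bb sb [th [/andP[t0 t1] Eb]]]] := bad_between s0 bc.
have bce : `|b - c| < e.
  rewrite Eb (_ : _ - _ = (1 - th) * (s - c)); last by ring.
  rewrite normrM ger0_norm ?subr_ge0// (le_lt_trans _ sc)//.
  by rewrite ler_piMl// lerBlDr lerDl.
have [b0 /(_ bb) Eb'] := H b bce.
by move=> tau tN; rewrite (eqH_F2 s0 b0 sb)//; exact: Eb'.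
Qed.

Lemma transport_bounded (a b : R) : 0 < a -> 0 < b -> eqH a b.
Proof.
move=> a0 b0; apply: eqH_segment => // th /andP[t0 t1].
apply: contrapT => ng; apply: (@no_bad (a + th * (b - a))); split => //.
nra.
Qed.

End SeparateTransport.

(* A separately smooth solution of F_s = F_t depends on s + t only
   (Chernoff and Royden): no joint continuity is assumed. *)
Lemma separate_transport (R : realType) (F F1 F2 : R -> R -> R) :
  (forall s t : R, 0 < s -> is_derive t 1 (F s) (F1 s t)) ->
  (forall s t : R, 0 < s -> is_derive t 1 (F1 s) (F2 s t)) ->
  (forall s : R, 0 < s -> continuous (F2 s)) ->
  (forall s t : R, 0 < s -> is_derive s 1 (fun s => F s t) (F1 s t)) ->
  (forall s t : R, 0 < s -> {for s, continuous (fun s => F1 s t)}) ->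
  (forall s t : R, 0 < s -> {for s, continuous (fun s => F2 s t)}) ->
  forall a b tau : R, 0 < a -> 0 < b -> F a (tau - a) = F b (tau - b).
Proof.
move=> H1 H2 H3 H4 H5 H6 a b tau a0 b0.
by apply: (transport_bounded (N := `|tau| + 1) H1 H2 H3 H4 H5 H6 a0 b0); rewrite ltrDl.
Qed.

Section Support.
Context {R : realType}.
Implicit Types (phi psi : R * R -> R) (x : R * R) (t : R).

Lemma smear_support d (T : measurableType d) (mu : {measure set T -> \bar R}) (D : set T)
    (k g1 g2 : T -> R) : bmeas D g1 -> bmeas D g2 -> exists c : R, 0 <= c /\
  forall t r phi x, (forall y, r < `|y| -> phi y = 0) -> r + `|t| * c < `|x| ->
  smear mu D k g1 g2 t phi x = 0.
Proof.
move=> [_ [c1 [c10 H1]]] [_ [c2 [c20 H2]]]; exists (c1 + c2); split; first exact: addr_ge0.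
move=> t r phi x Hr rx.
rewrite /smear -(Rintegral_set0 mu (fun=> 0)) Rintegral_mkcond [RHS]Rintegral_mkcond.
congr fine; apply: eq_integral => w _; congr EFin.
rewrite /patch in_set0; case: ifPn => // /set_mem Dw.
rewrite Hr ?mulr0//.
rewrite ltNge norm_le_box /=; apply/negP => /andP[b1 b2].
move: rx; rewrite ltNge norm_le_box => /negP; apply; apply/andP; split.
- have := H1 w Dw; have := ler_normB (x.1 + t * g1 w) (t * g1 w).
  rewrite addrK normrM; have := normr_ge0 t; nra.
- have := H2 w Dw; have := ler_normB (x.2 + t * g2 w) (t * g2 w).
  rewrite addrK normrM; have := normr_ge0 t; nra.
Qed.

Lemma wave_support : exists c : R, 0 <= c /\
  forall t r phi x, (forall y, r < `|y| -> phi y = 0) -> r + `|t| * c < `|x| ->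
  waveW t phi x = 0 /\ waveZ t phi x = 0.
Proof.
have [c [c0 Hc]] := smear_support (@lebesgue2 R) sph_weight (bmeas_sph1 angles) (bmeas_sph2 angles).
have [e [e0 He]] := smear_support (@lebesgue3 R) (rad sph_weight)
  (bmeas_rad (bmeas_sph1 angles)) (bmeas_rad (bmeas_sph2 angles)).
exists (Num.max c e); split; first by rewrite le_max c0.
move=> t r phi x Hr rx; split.
  rewrite /waveW /sph_mean (Hc t r) ?mulr0//; apply: le_lt_trans rx.
  by rewrite lerD2l ler_wpM2l// le_max lexx.
rewrite /waveZ /ball_mean (He t r) ?mulr0//; apply: le_lt_trans rx.
by rewrite lerD2l ler_wpM2l// le_max lexx orbT.
Qed.

End Support.

Section Evolution.
#[local] Opaque derive waveW waveZ sin cos pi Rintegral.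
Context {R : realType}.
Implicit Types (phi psi : R * R -> R) (x : R * R) (t : R).

Lemma partial_dX phi l : test_function phi -> partial l (dX phi) = dX (partial l phi).
Proof.
move=> tphi; elim: l => // b l IH.
have tl := test_function_partial l tphi.
case: b.
  change (dX (partial l (dX phi)) = dX (dX (partial l phi))); by rewrite IH.
change (dY (partial l (dX phi)) = dX (dY (partial l phi))); rewrite IH.
exact: test_function_schwarz tl.
Qed.

Lemma partial_dY phi l : test_function phi -> partial l (dY phi) = dY (partial l phi).
Proof.
move=> tphi; elim: l => // b l IH.
have tl := test_function_partial l tphi.
case: b; last first.
  change (dY (partial l (dY phi)) = dY (dY (partial l phi))); by rewrite IH.
change (dX (partial l (dY phi)) = dY (dX (partial l phi))); rewrite IH.
by apply/esym; exact: test_function_schwarz tl.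
Qed.

Definition dv (p1 p2 : R * R -> R) x : R := 1 * dX p1 x + dY p2 x.

Lemma test_function_dv p1 p2 : test_function p1 -> test_function p2 -> test_function (dv p1 p2).
Proof.
by move=> t1 t2; apply: test_function_lin; [exact: test_function_dX|exact: test_function_dY].
Qed.

Lemma partial_dv p1 p2 l : test_function p1 -> test_function p2 ->
  partial l (dv p1 p2) = dv (partial l p1) (partial l p2).
Proof.
move=> t1 t2; rewrite /dv partial_lin; [|exact: (test_function_dX t1).1|exact: (test_function_dY t2).1].
by rewrite (partial_dX l t1) (partial_dY l t2).
Qed.

Lemma dv_dXdY phi : dv (dX phi) (dY phi) = lap phi.
Proof. by rewrite lapE. Qed.

Lemma partial_lap phi l : test_function phi -> partial l (lap phi) = lap (partial l phi).
Proof.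
move=> tphi; rewrite -dv_dXdY partial_dv; [|exact: test_function_dX|exact: test_function_dY].
rewrite (partial_dX l tphi) (partial_dY l tphi); exact: dv_dXdY.
Qed.

Lemma lap_dX phi : test_function phi -> lap (dX phi) = dX (lap phi).
Proof. by move=> tphi; apply/esym; exact: (partial_lap [:: true] tphi). Qed.

Lemma lap_dY phi : test_function phi -> lap (dY phi) = dY (lap phi).
Proof. by move=> tphi; apply/esym; exact: (partial_lap [:: false] tphi). Qed.

Definition evo t (f g h : R * R -> R) x : R :=
  1 * f x + (1 * waveZ t g x + waveW t h x).

Lemma evo0 f g h : evo 0 f g h = f.
Proof. by apply/funext => x; rewrite /evo waveZ0 waveW0 mulr0 !addr0 mul1r. Qed.

Section Evo.
Variables (f g h : R * R -> R).
Hypotheses (tf : test_function f) (tg : test_function g) (th : test_function h).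

Lemma test_function_evo t : test_function (evo t f g h).
Proof.
apply: test_function_lin => //; apply: test_function_lin; first exact: test_function_waveZ.
exact: test_function_waveW.
Qed.

Lemma partial_evo t l : partial l (evo t f g h) = evo t (partial l f) (partial l g) (partial l h).
Proof.
have tZ := test_function_waveZ t tg; have tW := test_function_waveW t th.
rewrite /evo partial_lin; [|exact: tf.1|exact: (test_function_lin 1 tZ tW).1].
rewrite partial_lin; [|exact: tZ.1|exact: tW.1].
by rewrite partial_waveZ// partial_waveW.
Qed.

Lemma is_derive_evo x t : is_derive t 1 (fun t : R => evo t f g h x) (evo t h (lap h) g x).
Proof.
have D := is_derive_add (is_derive_cst (1 * f x) t 1)
  (is_derive_add (is_derive_scale 1 (is_derive_waveZ x t tg)) (is_derive_waveW x t th)).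
apply: (is_derive_eq D); rewrite /evo !mul1r add0r.
by rewrite addrC addrA.
Qed.

Lemma evo_bounded T : exists M : R, 0 <= M /\ forall t x, `|t| <= T -> `|evo t f g h x| <= M.
Proof.
have [Mf [Mf0 Hf]] := test_function_bounded tf.
have [Mg [Mg0 Hg]] := test_function_bounded tg.
have [Mh [Mh0 Hh]] := test_function_bounded th.
have [cW [cW0 HW]] := @waveW_bounded R; have [cZ [cZ0 HZ]] := @waveZ_bounded R.
exists (Mf + (cZ * `|T| ^+ 2 * Mg + cW * `|T| * Mh)); split.
  by rewrite !addr_ge0// ?mulr_ge0// exprn_ge0.
move=> t x tT; have tT' : `|t| <= `|T| by exact: le_trans (ler_norm T).
rewrite /evo !mul1r (le_trans (ler_normD _ _))// lerD//.
rewrite (le_trans (ler_normD _ _))// lerD//.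
  apply: (le_trans (HZ t g Mg x tg Hg)); rewrite ler_wpM2r// ler_wpM2l//.
  by rewrite -[t ^+ 2]real_normK ?num_real// ler_pXn2r// nnegrE.
by apply: (le_trans (HW t h Mh x th Hh)); rewrite ler_wpM2r// ler_wpM2l.
Qed.

Lemma evo_support T : exists r : R, forall t x, `|t| <= T -> r < `|x| -> evo t f g h x = 0.
Proof.
have [_ [rf Hf]] := (test_functionP f).1 tf.
have [_ [rg Hg]] := (test_functionP g).1 tg.
have [_ [rh Hh]] := (test_functionP h).1 th.
have [c [c0 Hc]] := @wave_support R.
exists (Num.max rf (Num.max (rg + `|T| * c) (rh + `|T| * c))) => t x tT.
rewrite !gt_max => /andP[xf /andP[xg xh]].
have tT' : `|t| * c <= `|T| * c by rewrite ler_wpM2r//; exact: le_trans (ler_norm T).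
rewrite /evo Hf//.
have [_ ->] := Hc t rg g x Hg (le_lt_trans (lerD (lexx rg) tT') xg).
have [-> _] := Hc t rh h x Hh (le_lt_trans (lerD (lexx rh) tT') xh).
by rewrite !mulr0 !addr0.
Qed.

End Evo.

Lemma taylor2 (f g k : R -> R) (t h M : R) :
  (forall t : R, is_derive t 1 f (g t)) -> (forall t : R, is_derive t 1 g (k t)) ->
  (forall s, `|s - t| <= `|h| -> `|k s| <= M) ->
  `|f (t + h) - f t - h * g t| <= M * h ^+ 2.
Proof.
move=> Df Dg HM.
have [c [ch Ec]] := mvt_R t (t + h) Df.
have [c' [ch' Ec']] := mvt_R t c Dg.
rewrite [t + h]addrC addrK in ch Ec.
rewrite [t + h]addrC Ec (_ : _ - _ = (g c - g t) * h); last by ring.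
rewrite Ec' -[h ^+ 2]real_normK ?num_real// !normrM -mulrA.
apply: ler_pM => //.
  by apply: HM; exact: le_trans ch.
by rewrite expr2 ler_wpM2r.
Qed.

Lemma uniform_multiindex (N : nat) (Q : seq bool -> R -> Prop) :
  (forall l M M', M <= M' -> Q l M -> Q l M') ->
  (forall l, exists M, Q l M) -> exists M, forall l, (size l <= N)%N -> Q l M.
Proof.
elim: N Q => [|N IH] Q mono H.
  have [M HM] := H [::]; exists M => l; rewrite leqn0 => /eqP l0.
  by rewrite (size0nil l0).
have [M1 H1] := IH (fun l => Q (true :: l)) (fun l => mono _) (fun l => H _).
have [M2 H2] := IH (fun l => Q (false :: l)) (fun l => mono _) (fun l => H _).
have [M0 H0] := H [::].
exists (Num.max M0 (Num.max M1 M2)) => -[_|[] l lN].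
- by apply: mono H0; rewrite le_max lexx.
- by apply: (mono _ M1); [rewrite !le_max lexx orbT|exact: H1].
- by apply: (mono _ M2); [rewrite !le_max lexx !orbT|exact: H2].
Qed.

Lemma is_derive_distr_evo (Lam : (R * R -> R) -> R) f g h t :
  is_distribution Lam -> test_function f -> test_function g -> test_function h ->
  is_derive t 1 (fun t : R => Lam (evo t f g h)) (Lam (evo t h (lap h) g)).
Proof.
move=> [Llin Lcont] tf tg th; have tlh := test_function_lap th; have tlg := test_function_lap tg.
have [r1 Hr1] := evo_support tf tg th (`|t| + 1).
have [r2 Hr2] := evo_support th tlh tg (`|t| + 1).
pose r := Num.max r1 r2.
have [N [C HC]] := Lcont _ (@compact_box R r).
pose rem k := fun x => (- k) * evo t h (lap h) g x + ((-1) * evo t f g h x + evo (t + k) f g h x).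
have tE k := test_function_evo tf tg th k.
have tE' := test_function_evo th tlh tg t.
have trem k : test_function (rem k).
  by apply: test_function_lin => //; exact: test_function_lin.
have [M HM] : exists M, forall l, (size l <= N)%N ->
    forall k x, `|k| <= 1 -> `|partial l (rem k) x| <= M * k ^+ 2.
  apply: uniform_multiindex => [l M M' MM' H k x k1|l].
    by apply: (le_trans (H k x k1)); rewrite ler_wpM2r// sqr_ge0.
  have [lf lg] := (test_function_partial l tf, test_function_partial l tg).
  have lh := test_function_partial l th.
  have [M [_ HM]] := evo_bounded lg (test_function_lap lg) (test_function_lap lh) (`|t| + 1).
  exists M => k x k1.
  rewrite (partial_lin (- k) l tE'.1 (test_function_lin (-1) (tE t) (tE (t + k))).1).
  rewrite (partial_lin (-1) l (tE t).1 (tE (t + k)).1).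
  rewrite (partial_evo th tlh tg) !(partial_evo tf tg th) (partial_lap l th).
  set F := partial l f in lf *; set G := partial l g in lg HM *; set H := partial l h in lh HM *.
  have Df (s : R) := is_derive_evo F lg lh x s.
  have Dg (s : R) := is_derive_evo H (test_function_lap lh) lg x s.
  have B (s : R) : `|s - t| <= `|k| -> `|evo s G (lap G) (lap H) x| <= M.
    move=> sk; apply: HM; have := ler_normD (s - t) t; rewrite subrK; lra.
  have := taylor2 Df Dg B.
  rewrite (_ : _ - _ = - k * evo t H (lap H) G x + (-1 * evo t F G H x + evo (t + k) F G H x))//.
  move: (evo t H (lap H) G x) (evo t F G H x) (evo (t + k) F G H x) => a b c; ring.
apply: is_derive_littleo => e e0.
pose K := `|C * M| + 1; have K0 : 0 < K by rewrite ltr_wpDl.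
exists (Num.min 1 (e / K)); split; first by rewrite lt_min ltr01 divr_gt0.
move=> k; rewrite lt_min => /andP[/ltW k1]; rewrite ltr_pdivlMr// => kK.
have -> : Lam (evo (t + k) f g h) - Lam (evo t f g h) - k * Lam (evo t h (lap h) g) = Lam (rem k).
  rewrite (Llin _ _ _ tE' (test_function_lin (-1) (tE t) (tE (t + k)))).
  rewrite (Llin _ _ _ (tE t) (tE (t + k))).
  move: (Lam (evo _ _ _ _)) (Lam (evo _ _ _ _)) (Lam (evo _ _ _ _)) => a b c; ring.
have sup : support_in [set x : R * R | `|x| <= r] (rem k).
  move=> x /= /negP; rewrite -ltNge /r gt_max => /andP[x1 x2].
  rewrite /rem Hr1//; last by rewrite lerDl.
  rewrite Hr1//; last by rewrite (le_trans (ler_normD _ _))// lerD2l.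
  by rewrite Hr2 ?lerDl// !mulr0 !addr0.
have := HC _ (M * k ^+ 2) (trem k) sup (fun l x lN => HM l lN k x k1).
move=> /le_trans; apply.
have k0 := normr_ge0 k.
rewrite -[k ^+ 2]real_normK ?num_real// mulrA.
have := ler_norm (C * M); rewrite /K in kK.
move: kK k0; move: (`|k|) (`|C * M|) (C * M) => a b c; nra.
Qed.

End Evolution.

Section Duality.
#[local] Opaque derive waveW waveZ sin cos pi Rintegral evo.
Context {R : realType}.
Implicit Types (phi psi : R * R -> R) (x : R * R) (s t : R).

Lemma sum3_close (a a' b b' c c' e : R) :
  `|a - a'| <= e / 6 -> `|b - b'| <= e / 6 -> `|c - c'| <= e / 6 ->
  `|a + b + c - (a' + b' + c')| <= e / 2.
Proof.
move=> h1 h2 h3; rewrite (_ : _ - _ = (a - a') + (b - b') + (c - c')); last by ring.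
apply: (le_trans (ler_normD _ _)); have := ler_normD (a - a') (b - b'); lra.
Qed.

Lemma dist_split (a b c e : R) : `|a - b| <= e / 2 -> `|a - c| <= e / 2 -> `|b - c| <= e.
Proof.
move=> h1 h2; rewrite (_ : b - c = (a - c) - (a - b)); last by ring.
by apply: (le_trans (ler_normB _ _)); lra.
Qed.

Lemma is_derive_scale_arg (f : R -> R) (A t d : R) : 0 < A ->
  is_derive (A * t) 1 f d -> is_derive t 1 (fun t : R => f (A * t)) (A * d).
Proof.
move=> A0 /is_deriveP H; apply: is_derive_littleo => e e0.
have [d0 [d00 Hd]] := H _ (divr_gt0 e0 A0).
exists (d0 / A); split; first exact: divr_gt0.
move=> h; rewrite ltr_pdivlMr// => hd.
have := Hd (A * h); rewrite normrM (gtr0_norm A0) mulrC => /(_ hd).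
rewrite mulrDr (_ : e / A * _ = e * `|h|); last by field; exact: lt0r_neq0.
by rewrite [h * (A * d)]mulrA [h * A]mulrC.
Qed.

(* A family of distributions that solves the acoustic system for positive times
   and is weakly continuous at time 0. *)
Definition weak_acoustic (A : R) (U V P : R -> (R * R -> R) -> R) :=
  [/\ forall s, 0 <= s -> [/\ is_distribution (U s), is_distribution (V s) & is_distribution (P s)],
    forall s phi, 0 < s -> test_function phi ->
      [/\ is_derive s 1 (fun s => U s phi) (A * P s (dX phi)),
          is_derive s 1 (fun s => V s phi) (A * P s (dY phi)) &
          is_derive s 1 (fun s => P s phi) (A * (U s (dX phi) + V s (dY phi)))] &
    forall phi, test_function phi -> forall e : R, 0 < e -> exists d : R, 0 < d /\
      forall s, 0 < s < d ->
      [/\ `|U s phi - U 0 phi| <= e, `|V s phi - V 0 phi| <= e & `|P s phi - P 0 phi| <= e]].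

Variables (A : R) (U V P : R -> (R * R -> R) -> R).
Hypotheses (A0 : 0 < A) (HQ : weak_acoustic A U V P).

Definition fieldU t (p1 p2 p3 : R * R -> R) := evo t p1 (dX (dv p1 p2)) (dX p3).
Definition fieldV t (p1 p2 p3 : R * R -> R) := evo t p2 (dY (dv p1 p2)) (dY p3).
Definition fieldP t (p1 p2 p3 : R * R -> R) := evo t p3 (lap p3) (dv p1 p2).

Let FF (p1 p2 p3 : R * R -> R) s t :=
  U s (fieldU t p1 p2 p3) + V s (fieldV t p1 p2 p3) + P s (fieldP t p1 p2 p3).

Let FFt p1 p2 p3 s t : test_function p1 -> test_function p2 -> test_function p3 -> 0 <= s ->
  is_derive t 1 (FF p1 p2 p3 s) (FF (dX p3) (dY p3) (dv p1 p2) s t).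
Proof.
move=> t1 t2 t3 s0; have [dU dV dP] := let: And3 H _ _ := HQ in H s s0.
have td := test_function_dv t1 t2.
have D := is_derive_add (is_derive_add
  (is_derive_distr_evo t dU t1 (test_function_dX td) (test_function_dX t3))
  (is_derive_distr_evo t dV t2 (test_function_dY td) (test_function_dY t3)))
  (is_derive_distr_evo t dP t3 (test_function_lap t3) td).
apply: (is_derive_eq D).
by rewrite /FF /fieldU /fieldV /fieldP dv_dXdY (lap_dX t3) (lap_dY t3).
Qed.

Let dX_evo t f g h : test_function f -> test_function g -> test_function h ->
  dX (evo t f g h) = evo t (dX f) (dX g) (dX h).
Proof. by move=> tf tg th; exact: (partial_evo tf tg th t [:: true]). Qed.

Let dY_evo t f g h : test_function f -> test_function g -> test_function h ->
  dY (evo t f g h) = evo t (dY f) (dY g) (dY h).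
Proof. by move=> tf tg th; exact: (partial_evo tf tg th t [:: false]). Qed.

Transparent evo.
Lemma evo_add t f g h f' g' h' : test_function g -> test_function h ->
  test_function g' -> test_function h' ->
  (fun x => 1 * evo t f g h x + evo t f' g' h' x) =
  evo t (fun x => 1 * f x + f' x) (fun x => 1 * g x + g' x) (fun x => 1 * h x + h' x).
Proof.
move=> tg th tg' th'; apply/funext => x; rewrite /evo (waveZ_lin _ 1 _ tg tg') (waveW_lin _ 1 _ th th').
move: (waveZ t g x) (waveZ t g' x) (waveW t h x) (waveW t h' x) => a b c d; ring.
Qed.
Opaque evo.

Let FFs p1 p2 p3 s t : test_function p1 -> test_function p2 -> test_function p3 -> 0 < s ->
  is_derive s 1 (fun s => FF p1 p2 p3 s t) (A * FF (dX p3) (dY p3) (dv p1 p2) s t).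
Proof.
move=> t1 t2 t3 s0; have [dU dV [Plin _]] := let: And3 H _ _ := HQ in H s (ltW s0).
have H2 := let: And3 _ H _ := HQ in H s.
have td := test_function_dv t1 t2.
have [tXd tYd tX3 tY3] := And4 (test_function_dX td) (test_function_dY td)
  (test_function_dX t3) (test_function_dY t3).
have tU := test_function_evo t1 tXd tX3 t.
have tV := test_function_evo t2 tYd tY3 t.
have tP := test_function_evo t3 (test_function_lap t3) td t.
have [DU _ _] := H2 _ s0 tU; have [_ DV _] := H2 _ s0 tV; have [_ _ DP] := H2 _ s0 tP.
apply: (is_derive_eq (is_derive_add (is_derive_add DU DV) DP)).
rewrite /FF /fieldU /fieldV /fieldP dv_dXdY.
rewrite (dX_evo t t3 (test_function_lap t3) td) (dY_evo t t3 (test_function_lap t3) td).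
have E : P s (dX (evo t p1 (dX (dv p1 p2)) (dX p3))) + P s (dY (evo t p2 (dY (dv p1 p2)) (dY p3)))
   = P s (evo t (dv p1 p2) (lap (dv p1 p2)) (lap p3)).
  rewrite -[X in X + _]mul1r -(Plin 1 _ _ (test_function_dX tU) (test_function_dY tV)).
  rewrite (dX_evo t t1 tXd tX3) (dY_evo t t2 tYd tY3) evo_add; last 4 first.
  - exact: test_function_dX.
  - exact: test_function_dX.
  - exact: test_function_dY.
  - exact: test_function_dY.
  by rewrite !lapE.
rewrite -mulrDr E; move: (P s _) (U s _) (V s _) => a b c; ring.
Qed.

Lemma acoustic_duality T p1 p2 p3 : test_function p1 -> test_function p2 -> test_function p3 -> 0 < T ->
  U T p1 + V T p2 + P T p3 =
  U 0 (fieldU (A * T) p1 p2 p3) + V 0 (fieldV (A * T) p1 p2 p3) + P 0 (fieldP (A * T) p1 p2 p3).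
Proof.
move=> t1 t2 t3 T0.
have td := test_function_dv t1 t2.
have [tX3 tY3] := (test_function_dX t3, test_function_dY t3).
have tl3 : test_function (dv (dX p3) (dY p3)) by exact: test_function_dv.
pose G s t := FF p1 p2 p3 s (A * t).
pose G1 s t := A * FF (dX p3) (dY p3) (dv p1 p2) s (A * t).
pose G2 s t := A * (A * FF (dX (dv p1 p2)) (dY (dv p1 p2)) (dv (dX p3) (dY p3)) s (A * t)).
have tXd := test_function_dX td; have tYd := test_function_dY td.
have DFt q1 q2 q3 s t (h1 : test_function q1) (h2 : test_function q2) (h3 : test_function q3)
    (s0 : 0 < s) := is_derive_scale_arg A0 (FFt (A * t) h1 h2 h3 (ltW s0)).
have D1 s t : 0 < s -> is_derive t 1 (G s) (G1 s t).
  by move=> s0; exact: (DFt _ _ _ _ _ t1 t2 t3 s0).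
have D2 s t : 0 < s -> is_derive t 1 (G1 s) (G2 s t).
  by move=> s0; exact: (is_derive_scale A (DFt _ _ _ _ _ tX3 tY3 td s0)).
have C2 s : 0 < s -> continuous (G2 s).
  move=> s0 t.
  exact: (is_derive_continuous (is_derive_scale A (is_derive_scale A (DFt _ _ _ _ _ tXd tYd tl3 s0)))).
have D3 s t : 0 < s -> is_derive s 1 (fun s => G s t) (G1 s t).
  by move=> s0; exact: (FFs (A * t) t1 t2 t3 s0).
have C3 s t : 0 < s -> {for s, continuous (fun s => G1 s t)}.
  by move=> s0; exact: (is_derive_continuous (is_derive_scale A (FFs (A * t) tX3 tY3 td s0))).
have C4 s t : 0 < s -> {for s, continuous (fun s => G2 s t)}.
  move=> s0.
  exact: (is_derive_continuous (is_derive_scale A (is_derive_scale A (FFs (A * t) tXd tYd tl3 s0)))).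
have E := separate_transport D1 D2 C2 D3 C3 C4.
have GT : G T 0 = U T p1 + V T p2 + P T p3.
  by rewrite /G /FF mulr0 /fieldU /fieldV /fieldP !evo0.
rewrite -GT -[RHS]/(G 0 T).
have cG : {for 0, continuous (G T)} := is_derive_continuous (D1 T 0 T0).
apply/eqP; rewrite -subr_eq0 -normr_le0; apply/ler_addgt0Pl => e e0; rewrite addr0.
have e20 : 0 < e / 2 by rewrite divr_gt0.
have [d [d0 Hd]] := near_continuous cG e20.
have e60 : 0 < e / 6 by rewrite divr_gt0.
have Hc := let: And3 _ _ H := HQ in H.
have [dU [dU0 HU]] := Hc (fieldU (A * T) p1 p2 p3) (test_function_evo t1 tXd tX3 _) _ e60.
have [dV [dV0 HV]] := Hc (fieldV (A * T) p1 p2 p3) (test_function_evo t2 tYd tY3 _) _ e60.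
have [dP [dP0 HP]] := Hc (fieldP (A * T) p1 p2 p3) (test_function_evo t3 (test_function_lap t3) td _) _ e60.
pose m := Num.min (Num.min d dU) (Num.min dV dP).
have m0 : 0 < m by rewrite !lt_min d0 dU0 dV0 dP0.
have s0 : 0 < m / 2 by rewrite divr_gt0.
have : m / 2 < m by rewrite ltr_pdivrMr// ltr_pMr// ltr1n.
move: s0; move: (m / 2) => s s0; rewrite !lt_min => /andP[/andP[sd sU] /andP[sV sP]].
have [{}HU _ _] := HU s (introT andP (conj s0 sU)).
have [_ {}HV _] := HV s (introT andP (conj s0 sV)).
have [_ _ {}HP] := HP s (introT andP (conj s0 sP)).
have Hs : `|G T s - G T 0| < e / 2.
  by apply: Hd; rewrite subr0 gtr0_norm.
have Es : G s T = G T s.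
  by have := E s T (s + T) s0 T0; rewrite addrK addrAC subrr add0r => ->.
have H0 : `|G s T - G 0 T| <= e / 2.
  rewrite /G /FF.
  exact: (sum3_close HU HV HP).
rewrite Es in H0; rewrite distrC; apply: (dist_split H0 (ltW Hs)).
Qed.

End Duality.

Section Instances.
#[local] Opaque derive waveW waveZ sin cos pi Rintegral evo.
Context {R : realType}.
Implicit Types (phi psi : R * R -> R) (x : R * R) (s t : R).

Lemma acoustic_solution_weak (c eps : R) (U V P : R -> (R * R -> R) -> R) :
  acoustic_solution c eps U V P -> weak_acoustic (c / eps) U V P.
Proof.
move=> [dU [dV [dP [[dU1 dU2] [dV1 dV2] [dP1 dP2] Eq]]]].
have lim (T dT : R -> (R * R -> R) -> R) (H : forall phi, test_function phi ->
     (forall t, 0 <= t ->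
        h^-1 * (T (t + h) phi - T t phi)
          @[h --> within [set h : R | 0 <= t + h] (0 : R)^'] --> dT t phi) /\
     {within `[0, +oo[, continuous (fun t => dT t phi)}) phi (t e : R) :
     test_function phi -> 0 <= t -> 0 < e -> exists d : R, 0 < d /\ forall h, `|h| < d -> 0 <= t + h ->
     `|T (t + h) phi - T t phi - h * dT t phi| <= e * `|h|.
  move=> tphi t0 e0; have [/(_ t t0) C _] := H phi tphi.
  move: C => /cvgrPdist_le /(_ e e0); rewrite near_withinE near_withinE => /nbhs_ballP[d /= d0 Hd].
  exists d; split => // h hd th; have [->|h0] := eqVneq h 0.
    by rewrite addr0 mul0r subr0 subrr normr0 mulr0.
  have := Hd h; rewrite /ball /= sub0r normrN => /(_ hd h0 th).
  rewrite distrC => B.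
  move: (T (t + h) phi) (T t phi) (dT t phi) B => a b a' B.
  rewrite (_ : _ - _ = h * (h^-1 * (a - b) - a')); last by field.
  by rewrite normrM mulrC ler_wpM2r.
have der (T dT : R -> (R * R -> R) -> R) (H : forall phi, test_function phi ->
     (forall t, 0 <= t ->
        h^-1 * (T (t + h) phi - T t phi)
          @[h --> within [set h : R | 0 <= t + h] (0 : R)^'] --> dT t phi) /\
     {within `[0, +oo[, continuous (fun t => dT t phi)}) phi (s : R) :
     test_function phi -> 0 < s -> is_derive s 1 (fun s => T s phi) (dT s phi).
  move=> tphi s0; apply: is_derive_littleo => e e0.
  have [d [d0 Hd]] := lim T dT H phi s e tphi (ltW s0) e0.
  exists (Num.min d s); split; first by rewrite lt_min d0.
  move=> h; rewrite lt_min => /andP[hd hs]; apply: Hd => //.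
  by move: hs; rewrite ltr_norml => /andP[h1 _]; rewrite -lerBlDl sub0r ltW.
have lim0 (T dT : R -> (R * R -> R) -> R) (H : forall phi, test_function phi ->
     (forall t, 0 <= t ->
        h^-1 * (T (t + h) phi - T t phi)
          @[h --> within [set h : R | 0 <= t + h] (0 : R)^'] --> dT t phi) /\
     {within `[0, +oo[, continuous (fun t => dT t phi)}) phi (e : R) : test_function phi -> 0 < e ->
     exists d : R, 0 < d /\ forall s, 0 < s < d -> `|T s phi - T 0 phi| <= e.
  move=> tphi e0; have [d [d0 Hd]] := lim T dT H phi 0 1 tphi (lexx 0) ltr01.
  pose K := `|dT 0 phi| + 1; have K0 : 0 < K by rewrite ltr_wpDl.
  exists (Num.min d (e / K)); split; first by rewrite lt_min d0 divr_gt0.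
  move=> s; rewrite lt_min ltr_pdivlMr// => /andP[s0 /andP[sd sK]].
  have := Hd s; rewrite gtr0_norm// add0r mul1r => /(_ sd (ltW s0)) B.
  have := ler_normD (T s phi - T 0 phi - s * dT 0 phi) (s * dT 0 phi).
  rewrite subrK normrM (gtr0_norm s0) => B'; apply: (le_trans B').
  apply: le_trans (ltW sK); rewrite /K mulrDr mulr1 addrC; exact: lerD.
split.
- by move=> s s0; split; [have [] := dU1 s s0|have [] := dV1 s s0|have [] := dP1 s s0].
- move=> s phi s0 tphi; have [E1 E2 E3] := Eq s phi (ltW s0) tphi.
  have D1 := der U dU dU2 phi s tphi s0; have D2 := der V dV dV2 phi s tphi s0.
  have D3 := der P dP dP2 phi s tphi s0.
  split.
  + apply: (is_derive_eq D1); move/eqP: E1; rewrite /ddistr mulrN subr_eq0 => /eqP; exact.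
  + apply: (is_derive_eq D2); move/eqP: E2; rewrite /ddistr mulrN subr_eq0 => /eqP; exact.
  + apply: (is_derive_eq D3); move/eqP: E3; rewrite /ddistr -opprD mulrN subr_eq0 => /eqP; exact.
- move=> phi tphi e e0.
  have [d1 [d10 H1]] := lim0 U dU dU2 phi e tphi e0.
  have [d2 [d20 H2]] := lim0 V dV dV2 phi e tphi e0.
  have [d3 [d30 H3]] := lim0 P dP dP2 phi e tphi e0.
  exists (Num.min d1 (Num.min d2 d3)); split; first by rewrite !lt_min d10 d20.
  move=> s; rewrite !lt_min => /andP[s0 /andP[s1 /andP[s2 s3]]].
  by split; [apply: H1|apply: H2|apply: H3]; rewrite s0.
Qed.

Lemma dX_swap phi : dX (phi \o (@swap_pt R)) = dY phi \o (@swap_pt R).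
Proof. by apply/funext => x; exact: derive_swap. Qed.

Lemma dY_swap phi : dY (phi \o (@swap_pt R)) = dX phi \o (@swap_pt R).
Proof. by apply/funext => x; exact: derive_swap. Qed.

Lemma lap_swap phi : lap (phi \o (@swap_pt R)) = lap phi \o (@swap_pt R).
Proof.
apply/funext => x; rewrite /lap dX_swap dY_swap dX_swap dY_swap /=; exact: addrC.
Qed.

Lemma dX_lin (a : R) phi psi : test_function phi -> test_function psi ->
  dX (fun x => a * phi x + psi x) = (fun x => a * dX phi x + dX psi x).
Proof. by move=> tphi tpsi; exact: (partial_lin a [:: true] tphi.1 tpsi.1). Qed.

Lemma dY_lin (a : R) phi psi : test_function phi -> test_function psi ->
  dY (fun x => a * phi x + psi x) = (fun x => a * dY phi x + dY psi x).
Proof. by move=> tphi tpsi; exact: (partial_lin a [:: false] tphi.1 tpsi.1). Qed.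

Lemma lin_rearrange (a b b' c c' : R) : a * b + b' + (a * c + c') = a * (b + c) + (b' + c').
Proof. by ring. Qed.

Lemma lap_lin (a : R) phi psi : test_function phi -> test_function psi ->
  lap (fun x => a * phi x + psi x) = (fun x => a * lap phi x + lap psi x).
Proof.
move=> tphi tpsi; apply/funext => x; rewrite /lap dX_lin// dY_lin//.
rewrite dX_lin; [|exact: test_function_dX..].
rewrite dY_lin; [|exact: test_function_dY..].
exact: lin_rearrange.
Qed.

Lemma test_function0 : test_function (fun _ : R * R => 0 : R).
Proof.
have E l : partial l (fun _ : R * R => 0 : R) = fun=> 0.
  elim: l => //= b l ->; apply/funext => x; exact: derive_cst.
split; last by exists set0 => //; exact: compact0.
by move=> l x; rewrite E; exact: differentiable_cst.
Qed.

Let Wy s psi x := waveW s (psi \o (@swap_pt R)) (swap_pt x).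
Let Zy s psi x := waveZ s (psi \o (@swap_pt R)) (swap_pt x).

Let DWy psi x s : test_function psi ->
  is_derive s 1 (fun s => Wy s psi x) (psi x + Zy s (lap psi) x).
Proof.
move=> tpsi; have D := is_derive_waveW (swap_pt x) s (test_function_swap tpsi).
apply: (is_derive_eq D); rewrite lap_swap /Zy; congr (_ + _).
by rewrite /= /swap_pt /= -surjective_pairing.
Qed.

Let DZy psi x s : test_function psi ->
  is_derive s 1 (fun s => Zy s psi x) (Wy s psi x).
Proof. by move=> tpsi; exact: (is_derive_waveZ (swap_pt x) s (test_function_swap tpsi)). Qed.

Let Wy_lin s a phi psi x : test_function phi -> test_function psi ->
  Wy s (fun y => a * phi y + psi y) x = a * Wy s phi x + Wy s psi x.
Proof.
by move=> tphi tpsi; exact: (waveW_lin s a (swap_pt x) (test_function_swap tphi) (test_function_swap tpsi)).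
Qed.

Let Zy_lin s a phi psi x : test_function phi -> test_function psi ->
  Zy s (fun y => a * phi y + psi y) x = a * Zy s phi x + Zy s psi x.
Proof.
by move=> tphi tpsi; exact: (waveZ_lin s a (swap_pt x) (test_function_swap tphi) (test_function_swap tpsi)).
Qed.

Let weak_point_source x : weak_acoustic 1 (fun s phi => Wy s (dX phi) x) (fun s phi => Wy s (dY phi) x)
  (fun s phi => phi x + Zy s (lap phi) x).
Proof.
have [cW [cW0 HW]] := @waveW_bounded R; have [cZ [cZ0 HZ]] := @waveZ_bounded R.
have contlim (f : R -> R) : {for (0 : R), continuous f} ->
   forall e : R, 0 < e -> exists d : R, 0 < d /\ forall s, 0 < s < d -> `|f s - f 0| <= e.
  move=> cf e e0; have [d [d0 Hd]] := near_continuous cf e0; exists d; split => // s /andP[s0 sd].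
  by apply: ltW; apply: Hd; rewrite subr0 gtr0_norm.
split.
- move=> s _; split; split.
  + move=> a phi psi tphi tpsi; rewrite dX_lin//; apply: Wy_lin; exact: test_function_dX.
  + move=> K cK; exists 1%N, (cW * `|s|) => phi M tphi _ HM.
    apply: HW; first by apply: test_function_swap; exact: test_function_dX.
    by move=> y; exact: (HM [:: true]).
  + move=> a phi psi tphi tpsi; rewrite dY_lin//; apply: Wy_lin; exact: test_function_dY.
  + move=> K cK; exists 1%N, (cW * `|s|) => phi M tphi _ HM.
    apply: HW; first by apply: test_function_swap; exact: test_function_dY.
    by move=> y; exact: (HM [:: false]).
  + move=> a phi psi tphi tpsi; rewrite lap_lin// Zy_lin; [|exact: test_function_lap..].
    exact: lin_rearrange.
  + move=> K cK; exists 2%N, (1 + cZ * s ^+ 2 * 2) => phi M tphi _ HM.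
    rewrite mulrDl mul1r (le_trans (ler_normD _ _))// lerD//; first exact: (HM [::]).
    rewrite -mulrA; apply: HZ; first by apply: test_function_swap; exact: test_function_lap.
    move=> y; rewrite /= /lap (le_trans (ler_normD _ _))// mulr_natl mulr2n lerD//.
      exact: (HM [:: true; true]).
    exact: (HM [:: false; false]).
- move=> s phi s0 tphi; split.
  + apply: (is_derive_eq (DWy x s (test_function_dX tphi))); by rewrite mul1r.
  + apply: (is_derive_eq (DWy x s (test_function_dY tphi))); by rewrite mul1r.
  + have D := is_derive_add (is_derive_cst (phi x) s 1) (DZy x s (test_function_lap tphi)).
    apply: (is_derive_eq D); rewrite add0r mul1r lapE Wy_lin; first by rewrite mul1r.
      by do 2 apply: test_function_dX.
    by do 2 apply: test_function_dY.
- move=> phi tphi e e0.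
  have [d1 [d10 H1]] := contlim _ (is_derive_continuous (DWy x 0 (test_function_dX tphi))) e e0.
  have [d2 [d20 H2]] := contlim _ (is_derive_continuous (DWy x 0 (test_function_dY tphi))) e e0.
  have [d3 [d30 H3]] := contlim _ (is_derive_continuous (is_derive_add (is_derive_cst (phi x) (0:R) 1)
     (DZy x 0 (test_function_lap tphi)))) e e0.
  exists (Num.min d1 (Num.min d2 d3)); split; first by rewrite !lt_min d10 d20.
  move=> s; rewrite !lt_min => /andP[s0 /andP[s1 /andP[s2 s3]]].
  by split; [apply: H1|apply: H2|apply: H3]; rewrite s0.
Qed.

Lemma dX0 : dX (fun _ : R * R => 0 : R) = fun=> 0.
Proof. by apply/funext => y; exact: derive_cst. Qed.

Lemma dY0 : dY (fun _ : R * R => 0 : R) = fun=> 0.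
Proof. by apply/funext => y; exact: derive_cst. Qed.

Lemma waveW_zero s y : waveW s (fun _ : R * R => 0 : R) y = 0.
Proof.
have E := waveW_lin s (-1) y test_function0 test_function0.
have F : (fun _ : R * R => -1 * 0 + 0 : R) = fun=> 0 by apply/funext => z; rewrite mulr0 addr0.
by rewrite F in E; rewrite E mulN1r addNr.
Qed.

Transparent evo.
Lemma fieldP_zero T psi x :
  fieldP (1 * T) (fun=> 0) (fun=> 0) psi x = psi x + waveZ T (lap psi) x.
Proof.
rewrite /fieldP /evo !mul1r (_ : dv _ _ = fun=> 0); last first.
  by apply/funext => y; rewrite /dv dX0 dY0 mulr0 addr0.
by rewrite waveW_zero addr0.
Qed.
Opaque evo.

Lemma vanishing_sum (a b d e f g h : R) : a = 0 -> b = 0 -> d = 0 -> e = 0 -> f = 0 ->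
  a + b + g = d + e + (h + f) -> g = h.
Proof. by move=> -> -> -> -> ->; rewrite !add0r addr0. Qed.

Let Zy_lap T psi x : test_function psi -> 0 <= T -> Zy T (lap psi) x = waveZ T (lap psi) x.
Proof.
move=> tpsi; rewrite le_eqVlt => /orP[/eqP T0|T0].
  by rewrite -T0; exact: (etrans (waveZ0 _ _) (esym (waveZ0 _ _))).
have t0 := test_function0.
pose z : R * R -> R := fun=> 0.
have E : Wy T (dX z) x + Wy T (dY z) x + (psi x + Zy T (lap psi) x) =
    Wy 0 (dX (fieldU (1 * T) z z psi)) x + Wy 0 (dY (fieldV (1 * T) z z psi)) x
    + (fieldP (1 * T) z z psi x + Zy 0 (lap (fieldP (1 * T) z z psi)) x)
  := acoustic_duality ltr01 (weak_point_source x) t0 t0 tpsi T0.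
have a1 : Wy T (dX z) x = 0 by rewrite dX0; exact: waveW_zero.
have a2 : Wy T (dY z) x = 0 by rewrite dY0; exact: waveW_zero.
have b phi : Wy 0 phi x = 0 by exact: waveW0.
have b' phi : Zy 0 phi x = 0 by exact: waveZ0.
have := vanishing_sum a1 a2 (b _) (b _) (b' _) E; rewrite fieldP_zero; exact: addrI.
Qed.

Lemma waveW_swap T psi x : test_function psi -> 0 <= T ->
  waveW T (psi \o (@swap_pt R)) (swap_pt x) = waveW T psi x.
Proof.
move=> tpsi T0.
have D (s : R) : 0 <= s <= T -> is_derive s 1 (fun s => Wy s psi x + - waveW s psi x) 0.
  move=> /andP[s0 _].
  apply: (is_derive_eq (is_derive_add (DWy x s tpsi) (is_derive_opp (is_derive_waveW x s tpsi)))).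
  by rewrite Zy_lap// subrr.
have := locally_constant_eq_derive T0 D; rewrite /Wy !waveW0 subrr => /esym/eqP.
by rewrite subr_eq0 => /eqP.
Qed.

Lemma waveZ_swap T psi x : test_function psi -> 0 <= T ->
  waveZ T (psi \o (@swap_pt R)) (swap_pt x) = waveZ T psi x.
Proof.
move=> tpsi T0.
have D (s : R) : 0 <= s <= T -> is_derive s 1 (fun s => Zy s psi x + - waveZ s psi x) 0.
  move=> /andP[s0 _].
  apply: (is_derive_eq (is_derive_add (DZy x s tpsi) (is_derive_opp (is_derive_waveZ x s tpsi)))).
  by rewrite /Wy waveW_swap// subrr.
have := locally_constant_eq_derive T0 D; rewrite /Zy !waveZ0 subrr => /esym/eqP.
by rewrite subr_eq0 => /eqP.
Qed.

End Instances.

(** * Masses of smeared cell edges *)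

Section RadialParts.
#[local] Opaque derive waveW waveZ sin cos pi Rintegral evo.
Context {R : realType}.
Notation mu := (@lebesgue_measure R).
Notation T1 := (measurableTypeR R).
Notation T2 := (measurableTypeR R * measurableTypeR R)%type.
Notation T3 := (T1 * T2)%type.
Notation mu2 := (@lebesgue2 R).
Notation mu3 := (@lebesgue3 R).
Implicit Types (phi psi : R * R -> R) (x : R * R) (t : R).

Definition ray (rho : R -> R) (f : T2 -> R) (z : T3) : R := rho z.1 * f z.2.
Definition dipole (w : T2) : R := sin w.1 * cos w.1.

Lemma bmeas_dipole D : bmeas D dipole.
Proof. by apply: bmeasM; [apply: bmeas_sin|apply: bmeas_cos]; exact: measurable_fst. Qed.

Lemma bmeas_snd (f : T2 -> R) : bmeas (@angles R) f -> bmeas (@ball_box R) (fun z => f z.2).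
Proof.
move=> [mf [c [c0 fc]]]; split; first exact: measurableT_comp mf measurable_snd.
by exists c; split => // z [_ z2]; exact: fc.
Qed.

Lemma ball_box_fubini12 (f : T3 -> R) : bmeas (@ball_box R) f ->
  \int[mu3]_(z in (@ball_box R)) f z = \int[mu]_(s in `[0, 1]) \int[mu2]_(w in @angles R) f (s, w).
Proof.
exact: (@Rfubini12 _ _ T1 T2 R mu mu2 _ _ (measurable_itv _) (@measurable_angles R)
  (finite_itv 0 1) (@finite_angles R)).
Qed.

Lemma radial_alg (t s sb cb ca px py p : R) : cb ^+ 2 + sb ^+ 2 = 1 ->
  t * (s * sb * px) - sb * cb * p =
  sb * cb * (s * (t * cb * px + t * (sb * ca) * py) + p * 1)
  + (-1) * (sb * sb * (t * (s * ((-1) * sb)) * px + t * (s * (cb * ca)) * py) + p * (sb * cb + sb * cb)).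
Proof.
move=> E; rewrite (_ : t * _ = (cb ^+ 2 + sb ^+ 2) * (t * (s * sb * px))); first by ring.
by rewrite E mul1r.
Qed.

Lemma bmeas_radial1 D t (s sb cb ca px py p : T3 -> R) :
  bmeas D s -> bmeas D sb -> bmeas D cb -> bmeas D ca -> bmeas D px -> bmeas D py -> bmeas D p ->
  bmeas D (fun w => sb w * cb w * (s w * (t * cb w * px w + t * (sb w * ca w) * py w) + p w * 1)).
Proof. by move=> *; solve_bmeas. Qed.

Lemma bmeas_radial2 D t (s sb cb ca px py p : T3 -> R) :
  bmeas D s -> bmeas D sb -> bmeas D cb -> bmeas D ca -> bmeas D px -> bmeas D py -> bmeas D p ->
  bmeas D (fun w => (-1) * (sb w * sb w * (t * (s w * ((-1) * sb w)) * px w + t * (s w * (cb w * ca w)) * py w) + p w * (sb w * cb w + sb w * cb w))).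
Proof. by move=> *; solve_bmeas. Qed.

Lemma continuous_radial1 t sb cb ca (s px py p : R -> R) :
  continuous s -> continuous px -> continuous py -> continuous p ->
  continuous (fun w => sb * cb * (s w * (t * cb * px w + t * (sb * ca) * py w) + p w * 1)).
Proof. by move=> *; solve_continuous. Qed.

Lemma continuous_radial2 t s ca (sb cb px py p : R -> R) :
  continuous sb -> continuous cb -> continuous px -> continuous py -> continuous p ->
  continuous (fun w => (-1) * (sb w * sb w * (t * (s * ((-1) * sb w)) * px w + t * (s * (cb w * ca)) * py w) + p w * (sb w * cb w + sb w * cb w))).
Proof. by move=> *; solve_continuous. Qed.

Lemma dipole_ibp t x phi : test_function phi ->
  t * smear mu3 (@ball_box R) (rad (@sph_weight R)) (rad (@sph1 R)) (rad (@sph2 R)) t (dX phi) x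
  = smear mu2 (@angles R) dipole (@sph1 R) (@sph2 R) t phi x
    + smear mu3 (@ball_box R) (fun z => dipole z.2) (rad (@sph1 R)) (rad (@sph2 R)) t phi x.
Proof.
move=> tphi; have [sphi _] := tphi.
pose px := dX phi; pose py := dY phi.
have tx : test_function px := test_function_dX tphi.
have ty : test_function py := test_function_dY tphi.
have [mD mD2] := (@measurable_ball_box R, @measurable_angles R).
have [fD fD2] := (@finite_ball_box R, @finite_angles R).
have bw := bmeas_rad (@bmeas_weight R _); have b1 := bmeas_rad (@bmeas_sph1 R _).
have b2 := bmeas_rad (@bmeas_sph2 R _).
have bd : bmeas (@ball_box R) (fun z => dipole z.2) := bmeas_snd (bmeas_dipole _).
pose q (z : T3) := (x.1 + t * rad (@sph1 R) z, x.2 + t * rad (@sph2 R) z).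
have bq psi : test_function psi -> bmeas (@ball_box R) (fun z => psi (q z)).
  by move=> tpsi; exact: (bmeas_comp_test b1 b2 t x tpsi).
have bs : bmeas (@ball_box R) (fun z : T3 => z.1).
  split; first exact: measurable_fst.
  exists 1; split => // z [/= z1 _]; move: z1; rewrite in_itv/= => /andP[z0 z1].
  by rewrite ger0_norm.
have bsb : bmeas (@ball_box R) (fun z : T3 => sin z.2.1).
  by apply: (@bmeas_snd (fun w => sin w.1)); apply: bmeas_sin; exact: measurable_fst.
have bcb : bmeas (@ball_box R) (fun z : T3 => cos z.2.1).
  by apply: (@bmeas_snd (fun w => cos w.1)); apply: bmeas_cos; exact: measurable_fst.
have bca : bmeas (@ball_box R) (fun z : T3 => cos z.2.2).
  by apply: (@bmeas_snd (fun w => cos w.2)); apply: bmeas_cos; exact: measurable_snd.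
pose A1 (z : T3) := sin z.2.1 * cos z.2.1 * (z.1 * (t * cos z.2.1 * px (q z) + t * (sin z.2.1 * cos z.2.2) * py (q z)) + phi (q z) * 1).
pose A2 (z : T3) := (-1) * (sin z.2.1 * sin z.2.1 * (t * (z.1 * ((-1) * sin z.2.1)) * px (q z) + t * (z.1 * (cos z.2.1 * cos z.2.2)) * py (q z)) + phi (q z) * (sin z.2.1 * cos z.2.1 + sin z.2.1 * cos z.2.1)).
have bA1 : bmeas (@ball_box R) A1 := bmeas_radial1 t bs bsb bcb bca (bq _ tx) (bq _ ty) (bq _ tphi).
have bA2 : bmeas (@ball_box R) A2 := bmeas_radial2 t bs bsb bcb bca (bq _ tx) (bq _ ty) (bq _ tphi).
pose X (z : T3) := rad (@sph_weight R) z * px (q z).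
pose Y (z : T3) := dipole z.2 * phi (q z).
have bX : bmeas (@ball_box R) X := bmeasM bw (bq _ tx).
have bY : bmeas (@ball_box R) Y := bmeasM bd (bq _ tphi).
have E1 : \int[mu3]_(z in (@ball_box R)) A1 z = smear mu2 (@angles R) dipole (@sph1 R) (@sph2 R) t phi x.
  rewrite ball_box_fubini21//; apply: eq_Rintegral => w _.
  pose g1 s := x.1 + t * (s * sph1 w); pose g2 s := x.2 + t * (s * sph2 w).
  have Dg1 (s : R) : is_derive s 1 g1 (t * sph1 w).
    have := is_derive_add (is_derive_cst x.1 s 1) (is_derive_scale t
       (is_derive_mul (is_derive_id s 1) (is_derive_cst (sph1 w) s 1))).
    by rewrite add0r mulr0 add0r mulr1.
  have Dg2 (s : R) : is_derive s 1 g2 (t * sph2 w).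
    have := is_derive_add (is_derive_cst x.2 s 1) (is_derive_scale t
       (is_derive_mul (is_derive_id s 1) (is_derive_cst (sph2 w) s 1))).
    by rewrite add0r mulr0 add0r mulr1.
  have cg1 : continuous g1 by move=> s; exact: is_derive_continuous (Dg1 s).
  have cg2 : continuous g2 by move=> s; exact: is_derive_continuous (Dg2 s).
  pose F s := sin w.1 * cos w.1 * (s * phi (g1 s, g2 s)).
  have DF (s : R) : is_derive s 1 F (A1 (s, w)).
    exact: (is_derive_scale _ (is_derive_mul (is_derive_id s 1) (is_derive_comp2 (sphi [::] _) (Dg1 s) (Dg2 s)))).
  have cid : continuous (fun s : R => s) by move=> s; exact: cvg_id.
  have cf : continuous (fun s => A1 (s, w)) := continuous_radial1 (t := t) (sb := sin w.1) (cb := cos w.1) (ca := cos w.2) cid (continuous_line tx.1 cg1 cg2) (continuous_line ty.1 cg1 cg2) (continuous_line sphi cg1 cg2).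
  rewrite (Rintegral_FTC ltr01 DF cf) /F /g1 /g2 /dipole mul0r mulr0 subr0 !mul1r.
  by [].
have E2 : \int[mu3]_(z in (@ball_box R)) A2 z = 0.
  rewrite ball_box_fubini12// (@eq_Rintegral _ _ _ _ _ (cst 0)) ?Rintegral_cst ?mul0r// => s /set_mem s01.
  have bA2s : bmeas (@angles R) (fun w => A2 (s, w)).
    have [mA [c [c0 Ac]]] := bA2; split; first exact: (measurableT_comp mA (pair1_measurable s)).
    by exists c; split => // w Dw; exact: (Ac (s, w) (conj s01 Dw)).
  rewrite /angles lebesgue2_fubini21//; try exact: measurable_itv; try exact: finite_itv.
  rewrite (@eq_Rintegral _ _ _ _ _ (cst 0)) ?Rintegral_cst ?mul0r// => a _ /=.
  have Dq1 (b : R) : is_derive b 1 (fun b : R => x.1 + t * (s * cos b)) (t * (s * ((-1) * sin b))).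
    by apply: (is_derive_eq (is_derive_add (is_derive_cst x.1 b 1) (is_derive_scale t (is_derive_scale s (is_derive_cos b))))); rewrite add0r mulN1r.
  have Dq2 (b : R) : is_derive b 1 (fun b : R => x.2 + t * (s * (sin b * cos a))) (t * (s * (cos b * cos a))).
    apply: (is_derive_eq (is_derive_add (is_derive_cst x.2 b 1) (is_derive_scale t (is_derive_scale s
      (is_derive_mul (is_derive_sin b) (is_derive_cst (cos a) b 1)))))).
    by rewrite add0r mulr0 add0r [cos a * _]mulrC.
  have cq1 : continuous (fun b : R => x.1 + t * (s * cos b)) by move=> b; exact: is_derive_continuous (Dq1 b).
  have cq2 : continuous (fun b : R => x.2 + t * (s * (sin b * cos a))) by move=> b; exact: is_derive_continuous (Dq2 b).
  have cA : continuous (fun b => A2 (s, (b, a))) := continuous_radial2 (t := t) (s := s) (ca := cos a) (@continuous_sin R) (@continuous_cos R) (continuous_line tx.1 cq1 cq2) (continuous_line ty.1 cq1 cq2) (continuous_line sphi cq1 cq2).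
  pose F (b : R) := (-1) * (sin b * sin b * phi (x.1 + t * (s * cos b), x.2 + t * (s * (sin b * cos a)))).
  have DF (b : R) : is_derive b 1 F (A2 (s, (b, a))).
    exact: (is_derive_scale _ (is_derive_mul (is_derive_mul (is_derive_sin b) (is_derive_sin b)) (is_derive_comp2 (sphi [::] _) (Dq1 b) (Dq2 b)))).
  by rewrite (Rintegral_FTC (pi_gt0 R) DF cA) /F sin0 sinpi !mul0r mulr0 subrr.
have E : \int[mu3]_(z in (@ball_box R)) (t * X z - Y z) = smear mu2 (@angles R) dipole (@sph1 R) (@sph2 R) t phi x.
  rewrite -E1 -[RHS]addr0 -[X in _ = _ + X]E2 -(bRintegralD mD fD bA1 bA2).
  by apply: eq_Rintegral => z _; exact: (radial_alg _ _ _ _ _ _ (cos2Dsin2 _)).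
rewrite -E (bRintegralB mD fD (bmeasZ _ bX) bY) (bRintegralZ mD fD _ bX).
by rewrite subrK.
Qed.

Lemma square_factor (t a s : R) : t ^+ 2 / a * s = t / a * (t * s).
Proof. by ring. Qed.

Transparent waveZ.
Lemma dX_waveZ t x phi : test_function phi ->
  waveZ t (dX phi) x = t / (2 * pi) * (smear mu2 (@angles R) dipole (@sph1 R) (@sph2 R) t phi x
    + smear mu3 (@ball_box R) (fun z => dipole z.2) (rad (@sph1 R)) (rad (@sph2 R)) t phi x).
Proof.
move=> tphi; rewrite -dipole_ibp//; exact: square_factor.
Qed.
Opaque waveZ.

Lemma smear_ball (k g1 g2 : T2 -> R) t phi x : bmeas (@angles R) k -> bmeas (@angles R) g1 ->
  bmeas (@angles R) g2 -> test_function phi ->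
  smear mu2 (@angles R) k g1 g2 t phi x =
  smear mu3 (@ball_box R) (fun z => k z.2) (fun z => g1 z.2) (fun z => g2 z.2) t phi x.
Proof.
move=> bk b1 b2 tphi; rewrite /smear ball_box_fubini12.
  rewrite /= Rintegral_itv_cst ?ler01//; set S := \int[_]_(_ in _) _; by rewrite subr0 mulr1.
exact: (bmeas_snd (bmeas_smear b1 b2 t x bk tphi)).
Qed.

End RadialParts.

Section ProductNullSets.
#[local] Opaque derive waveW waveZ sin cos pi Rintegral evo.
Context d1 d2 (T1 : measurableType d1) (T2 : measurableType d2) (R : realType).
Variables (m1 : {sigma_finite_measure set T1 -> \bar R})
          (m2 : {sigma_finite_measure set T2 -> \bar R}).
Local Open Scope ereal_scope.

Lemma product_null_xsection (S : set (T1 * T2)) (Z : set T1) : measurable S ->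
  measurable Z -> m1 Z = 0 -> (forall x, ~ Z x -> m2 (xsection S x) = 0) ->
  (m1 \x m2) S = 0.
Proof.
move=> mS mZ Z0 H; rewrite /product_measure1.
rewrite (ge0_negligible_integral mZ measurableT _ _ Z0) //.
  by apply: integral0_eq => x [_ Zx]; exact: H.
exact: measurable_fun_xsection.
Qed.

Lemma product_null_ysection (S : set (T1 * T2)) (Z : set T2) : measurable S ->
  measurable Z -> m2 Z = 0 -> (forall y, ~ Z y -> m1 (ysection S y) = 0) ->
  (m1 \x m2) S = 0.
Proof.
move=> mS mZ Z0 H.
rewrite (@product_measure_unique _ _ _ _ _ m1 m2 (m1 \x^ m2)%E)//; last first.
  by move=> A B mA mB; exact: product_measure2E.
rewrite -[LHS]/((m1 \x^ m2) S) /product_measure2 (ge0_negligible_integral mZ measurableT _ _ Z0) //.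
  by apply: integral0_eq => x [_ Zx]; exact: H.
exact: measurable_fun_ysection.
Qed.

Lemma product_null_xsection_ae (S : set (T1 * T2)) : measurable S -> (m1 \x m2) S = 0 ->
  exists Z, [/\ measurable Z, m1 Z = 0 & forall x, ~ Z x -> m2 (xsection S x) = 0].
Proof.
move=> mS S0; have mf := measurable_fun_xsection m2 mS.
have : ae_eq m1 setT (m2 \o xsection S) (cst 0).
  apply/(ae_eq_integral_abs m1 measurableT mf); rewrite -[RHS]S0 /product_measure1.
  by apply: eq_integral => x _; rewrite gee0_abs.
move=> [Z [mZ Z0 H]]; exists Z; split => // x Zx; apply: contrapT => nx.
by apply: Zx; apply: H => /= K; exact/nx/K.
Qed.

End ProductNullSets.

Section Sheets.
#[local] Opaque derive waveW waveZ sin cos pi Rintegral evo.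
Context {R : realType}.
Notation mu := (@lebesgue_measure R).
Notation T1 := (measurableTypeR R).
Notation T2 := (measurableTypeR R * measurableTypeR R)%type.
Notation T3 := (T1 * T2)%type.
Notation mu2 := (@lebesgue2 R).
Notation mu3 := (@lebesgue3 R).
Implicit Types (h : R * R -> R) (t : R) (k g : T3 -> R).

Definition sheet k g1 g2 t (a b1 b2 : R) h : R :=
  \int[mu]_(y in `[b1, b2]) smear mu3 (@ball_box R) k g1 g2 t h (a, y).

Lemma translation_null (A : set R) (c : R) : mu A = 0%E -> mu ((fun y => y + c) @^-1` A) = 0%E.
Proof.
move=> A0; rewrite -[X in mu X]setTI; apply: (@null_preimage_expanding R A setT _ 1) => //.
by move=> x y _ _; rewrite mul1r opprD addrACA subrr addr0.
Qed.

Definition nonsingular t g := forall (a : R) (A : set R), measurable A -> mu A = 0%E ->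
  mu3 ((@ball_box R) `&` [set z | A (a + t * g z)]) = 0%E.

Lemma measurable_affine (a t : R) g : measurable_fun setT g ->
  measurable_fun setT (fun z => a + t * g z).
Proof. by move=> mg; apply: measurable_funD => //; exact: measurable_funM. Qed.

Lemma measurable_preimage d1 d2 (S1 : measurableType d1) (S2 : measurableType d2) (f : S1 -> S2) (A : set S2) :
  measurable_fun setT f -> measurable A -> measurable (f @^-1` A).
Proof. by move=> mf mA; rewrite -[X in measurable X]setTI; exact: mf. Qed.

Lemma nonsingular_sph1 t (rho : R -> R) : t != 0 -> measurable_fun setT rho ->
  (forall s, s != 0 -> rho s != 0) -> nonsingular t (ray rho (@sph1 R)).
Proof.
move=> t0 mr r0 a A mA A0.
have mg : measurable_fun setT (ray rho (@sph1 R)).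
  apply: measurable_funM; first exact: measurableT_comp mr measurable_fst.
  exact: measurableT_comp (@bmeas_sph1 R setT).1 measurable_snd.
have mS : measurable ((@ball_box R) `&` [set z | A (a + t * ray rho (@sph1 R) z)]).
  apply: measurableI; first exact: measurable_ball_box.
  exact: (measurable_preimage (measurable_affine a t mg) mA).
apply: (@product_null_xsection _ _ T1 T2 R mu mu2 _ [set 0] mS) => //.
  exact: (lebesgue_measure_set1 (0 : R)).
move=> s s0.
have mc : measurable_fun setT (fun b : R => a + t * rho s * cos b).
  apply: measurable_funD => //; apply: measurable_funM => //.
  by apply: (@measurable_cos_comp R _ T1 id); exact: measurable_id.
apply: (@product_null_xsection _ _ T1 T1 R mu mu _ (`[0, pi] `&` (fun b => a + t * rho s * cos b) @^-1` A)).
- exact: measurable_xsection.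
- apply: measurableI; first exact: measurable_itv.
  exact: (measurable_preimage mc mA).
- by apply: null_preimage_cos => //; rewrite mulf_neq0// r0//; apply/eqP => E; exact: s0.
- move=> b nb; rewrite (_ : xsection _ _ = set0) ?measure0//.
  apply/seteqP; split => // al; rewrite /xsection /= inE /= inE => -[[_ [b1 _]]] /= Ab.
  by apply: nb; split => //; move: Ab; rewrite /ray /sph1 /= mulrA.
Qed.

Lemma nonsingular_sph2 t (rho : R -> R) : t != 0 -> measurable_fun setT rho ->
  (forall s, s != 0 -> rho s != 0) -> nonsingular t (ray rho (@sph2 R)).
Proof.
move=> t0 mr r0 a A mA A0.
have mg : measurable_fun setT (ray rho (@sph2 R)).
  apply: measurable_funM; first exact: measurableT_comp mr measurable_fst.
  exact: measurableT_comp (@bmeas_sph2 R setT).1 measurable_snd.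
have mS : measurable ((@ball_box R) `&` [set z | A (a + t * ray rho (@sph2 R) z)]).
  apply: measurableI; first exact: measurable_ball_box.
  exact: (measurable_preimage (measurable_affine a t mg) mA).
apply: (@product_null_xsection _ _ T1 T2 R mu mu2 _ [set 0] mS) => //.
  exact: (lebesgue_measure_set1 (0 : R)).
move=> s s0.
apply: (@product_null_xsection _ _ T1 T1 R mu mu _ [set 0; pi]).
- exact: measurable_xsection.
- exact: measurableU.
- apply/eqP; rewrite eq_le measure_ge0 andbT (le_trans (outer_measureU2 mu _ _))//.
  by rewrite -[X in (X + _)%E]/(mu [set 0]) -[X in (_ + X)%E]/(mu [set (pi : R)]) !lebesgue_measure_set1 adde0.
- move=> b nb; have [bpi|bpi] := boolP (b \in `[0, pi]); last first.
    rewrite (_ : xsection _ _ = set0) ?measure0//.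
    apply/seteqP; split => // al; rewrite /xsection /= inE /= inE => -[[_ [b1 _]]] _.
    by exfalso; move/negP: bpi; apply.
  have sb : sin b != 0.
    apply: lt0r_neq0; apply: sin_gt0_pi; move: bpi; rewrite in_itv/= => /andP[b0 b1].
    rewrite lt_def b0 andbT lt_neqAle b1 andbT; apply/andP; split; apply/eqP => E; apply: nb; first by left.
    by right.
  have H := null_preimage_cos a (mulf_neq0 (mulf_neq0 t0 (r0 s _)) sb) A0.
  have mc : measurable_fun setT (fun c : R => a + t * rho s * sin b * cos c).
    apply: measurable_funD => //; apply: measurable_funM => //.
    by apply: (@measurable_cos_comp R _ T1 id); exact: measurable_id.
  apply: (@subset_measure0 _ _ _ mu _ (`[0, pi] `&` (fun c => a + t * rho s * sin b * cos c) @^-1` A)).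
  + exact/measurable_xsection/measurable_xsection.
  + apply: measurableI; first exact: measurable_itv.
    exact: (measurable_preimage mc mA).
  + move=> al; rewrite /xsection /= inE /= inE => -[[_ [_ al1]]] /= Ab; split => //.
    by move: Ab; rewrite /ray /sph2 /= !mulrA.
  + by apply: H; apply/eqP => E; exact: s0.
Qed.

Definition mu4 := (mu \x mu3)%E.

Lemma sheet_density k g1 g2 t (a b1 b2 c : R) :
  bmeas (@ball_box R) k -> bmeas (@ball_box R) g1 -> bmeas (@ball_box R) g2 -> nonsingular t g1 ->
  (forall z, (@ball_box R) z -> `|t * g1 z| <= c /\ `|t * g2 z| <= c) ->
  exists f, [/\ mu2.-integrable setT (EFin \o f),
    forall x, f x != 0 -> a - c <= x.1 <= a + c /\ b1 - c <= x.2 <= b2 + c &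
    forall h, @bmeas _ T2 R setT h -> sheet k g1 g2 t a b1 b2 h = \int[mu2]_x (f x * h x)].
Proof.
move=> bk bg1 bg2 ns gc.
pose D : set (T1 * T3) := `[b1, b2] `*` (@ball_box R).
have [mD3 fD3] := (@measurable_ball_box R, @finite_ball_box R).
have mD : measurable D by apply: measurableX => //; exact: measurable_itv.
have fD : (mu4 D < +oo)%E.
  exact: (@finite_measureX _ _ T1 T3 R mu mu3 _ _ (measurable_itv _) mD3 (finite_itv b1 b2) fD3).
pose B : set T2 := `[a - c, a + c] `*` `[b1 - c, b2 + c].
have mB : measurable B by apply: measurableX; exact: measurable_itv.
pose g (p : T1 * T3) : T2 := (a + t * g1 p.2, p.1 + t * g2 p.2).
have mg : measurable_fun setT g.
  apply: measurable_fun_pair.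
    exact: (measurableT_comp (measurable_affine a t bg1.1) measurable_snd).
  apply: measurable_funD; first exact: measurable_fst.
  apply: measurable_funM => //; exact: (measurableT_comp bg2.1 measurable_snd).
have gB p : D p -> B (g p).
  move=> [p1 p2]; have [+ +] := gc _ p2; move: p1; rewrite /B /g /= !in_itv/= !ler_norml.
  move=> /andP[? ?] /andP[? ?] /andP[? ?]; by split; apply/andP; split; lra.
have bK : bmeas D (fun p => k p.2).
  have [mk [m [m0 km]]] := bk; split; first exact: (measurableT_comp mk measurable_snd).
  by exists m; split => // p [_ p2]; exact: km.
have null A : measurable A -> mu2 A = 0%E -> mu4 (D `&` g @^-1` A) = 0%E.
  move=> mA A0.
  have [Z [mZ Z0 HZ]] := @product_null_xsection_ae _ _ T1 T1 R mu mu A mA A0.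
  have mS : measurable (D `&` g @^-1` A) by apply: measurableI => //; exact: measurable_preimage.
  have mY : measurable ((@ball_box R) `&` [set z | Z (a + t * g1 z)]).
    by apply: measurableI => //; exact: (measurable_preimage (measurable_affine a t bg1.1) mZ).
  apply: (@product_null_ysection _ _ T1 T3 R mu mu3 _ _ mS mY); first exact: ns.
  move=> z nz; have [Dz|nDz] := pselect ((@ball_box R) z); last first.
    rewrite (_ : ysection _ _ = set0) ?measure0//; apply/seteqP; split => // y.
    by rewrite /ysection /= inE => -[[_ /nDz]].
  have nZ : ~ Z (a + t * g1 z) by move=> H; apply: nz.
  apply: (@subset_measure0 _ _ _ mu _ ((fun y => y + t * g2 z) @^-1` xsection A (a + t * g1 z))).
  - exact: measurable_ysection.
  - apply: measurable_preimage; last exact: measurable_xsection.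
    exact: measurable_funD.
  - move=> y; rewrite /ysection /= inE => -[_ Ag]; rewrite /xsection /=; exact/mem_set.
  - by apply: translation_null; exact: HZ.
have [f [intf f0 fE]] := @pushforward_density _ _ _ _ R (mu \x mu3)%E mu2 D B _ g mD fD mB bK mg gB null.
exists f; split => //.
- move=> x fx; have : B x by apply: contrapT => /f0 /eqP; rewrite (negbTE fx).
  by move=> [/=]; rewrite !in_itv.
- move=> h bh; rewrite -fE//; rewrite (@Rfubini12 _ _ T1 T3 R mu mu3 _ _ (measurable_itv _) mD3 (finite_itv b1 b2) fD3)//.
  apply: bmeasM => //; have [mh [m [m0 hm]]] := bh; split; first exact: measurableT_comp mh mg.
  by exists m; split => // p _; exact: hm.
Qed.

End Sheets.

Section HalfAngles.
#[local] Opaque derive waveW waveZ sin cos pi Rintegral evo.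
Context {R : realType}.
Notation mu := (@lebesgue_measure R).
Implicit Types (b : R) (f F : R -> R).

Definition posc b : R := if 0 <= cos b then 1 else 0.
Definition negc b : R := if cos b <= 0 then 1 else 0.

Lemma cos_ge0_half b : b \in `[0, pi] -> (0 <= cos b) = (b <= pi / 2).
Proof.
rewrite in_itv/= => /andP[b0 b1]; apply/idP/idP => [c0|bh].
  rewrite leNgt; apply/negP => hb; move: c0; rewrite leNgt => /negP; apply.
  rewrite -[b](subrK pi) cosDpi oppr_lt0; apply: cos_gt0_pihalf.
  by have := pi_gt0 R; move: (pi : R) b1 hb => p *; apply/andP; split; lra.
apply: cos_ge0_pihalf; have := pi_gt0 R; move: (pi : R) bh b0 => p *; apply/andP; split; lra.
Qed.

Lemma cos_le0_half b : b \in `[0, pi] -> (cos b <= 0) = (pi / 2 <= b).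
Proof.
rewrite in_itv/= => /andP[b0 b1].
rewrite -oppr_ge0 (_ : - cos b = cos (pi - b)); last by rewrite cosB cospi sinpi mulN1r mul0r addr0.
rewrite cos_ge0_half.
  by move: (pi : R) => p; apply/idP/idP; lra.
by rewrite in_itv/=; move: (pi : R) b0 b1 => p *; apply/andP; split; lra.
Qed.

Lemma half_integral F f : (forall b, is_derive b 1 F (f b)) -> continuous f ->
  \int[mu]_(b in `[0, pi]) (posc b * f b) = F (pi / 2) - F 0 /\
  \int[mu]_(b in `[0, pi]) (negc b * f b) = F pi - F (pi / 2).
Proof.
move=> DF cf; have p0 := pi_gt0 R.
have h0 : 0 < pi / 2 :> R by rewrite divr_gt0.
have h1 : pi / 2 < pi :> R by rewrite ltr_pdivrMr// ltr_pMr// ltr1n.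
split.
- rewrite -(Rintegral_FTC h0 DF cf).
  rewrite (_ : `[0, pi / 2]%classic = `[0, pi] `&` `]-oo, pi / 2]).
    rewrite Rintegral_mkcondr; apply: eq_Rintegral => b /set_mem /= b01.
    rewrite patchE /posc cos_ge0_half// mem_setE in_itv/=.
    by case: ifP => _; rewrite ?mul1r ?mul0r.
  apply/seteqP; split => b /=; rewrite !in_itv/=.
    by move=> /andP[-> b1]; split => //=; rewrite (le_trans b1)// ltW.
  by move=> [/andP[-> _] ->].
- rewrite -(Rintegral_FTC h1 DF cf).
  rewrite (_ : `[pi / 2, pi]%classic = `[0, pi] `&` `[pi / 2, +oo[).
    rewrite Rintegral_mkcondr; apply: eq_Rintegral => b /set_mem /= b01.
    rewrite patchE /negc cos_le0_half// mem_setE in_itv/= andbT.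
    by case: ifP => _; rewrite ?mul1r ?mul0r.
  apply/seteqP; split => b /=; rewrite !in_itv/=.
    by move=> /andP[b1 ->]; rewrite andbT; split => //; rewrite (le_trans _ b1)// ltW.
  by move=> [/andP[_ b1] /andP[b2 _]]; apply/andP.
Qed.

Lemma cos_abs b : `|cos b| = posc b * cos b - negc b * cos b.
Proof.
rewrite /posc /negc; move: (cos b) => c.
have [c0|c0|<-] := ltgtP 0 c.
- by rewrite gtr0_norm// mul1r mul0r subr0.
- by rewrite ltr0_norm// mul0r mul1r sub0r.
- by rewrite normr0 mulr0 subrr.
Qed.

Lemma cos_posp b : Num.max 0 (cos b) = posc b * cos b.
Proof.
rewrite /posc; move: (cos b) => c.
by have [c0|c0] := leP 0 c; rewrite ?mul1r ?mul0r.
Qed.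

Lemma cos_negp b : Num.max 0 (- cos b) = - (negc b * cos b).
Proof.
rewrite /negc; move: (cos b) => c; rewrite -oppr_ge0.
by have [c0|c0] := leP 0 (- c); rewrite ?mul1r ?mul0r ?oppr0.
Qed.

Let idc : continuous (fun b : R => b). Proof. by move=> b; exact: cvg_id. Qed.
Let cc := @continuous_cos R.
Let cs := @continuous_sin R.

Lemma half1 : \int[mu]_(b in `[0, pi]) (posc b * 1) = pi / 2 /\
  \int[mu]_(b in `[0, pi]) (negc b * 1) = pi / 2.
Proof.
have [-> ->] := half_integral (F := fun b => b) (f := fun=> 1) (fun b => is_derive_id b 1)
   (@continuous_const R 1).
by rewrite subr0; split => //; move: (pi : R) => p; field.
Qed.

Lemma half_cos : \int[mu]_(b in `[0, pi]) (posc b * cos b) = 1 /\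
  \int[mu]_(b in `[0, pi]) (negc b * cos b) = - 1.
Proof.
have [-> ->] := half_integral (F := sin) (f := cos) (fun b => is_derive_sin b) cc.
by rewrite sin_pihalf sin0 sinpi subr0 sub0r.
Qed.

Lemma half_sin : \int[mu]_(b in `[0, pi]) (posc b * sin b) = 1 /\
  \int[mu]_(b in `[0, pi]) (negc b * sin b) = 1.
Proof.
have D b : is_derive b 1 (fun b => - cos b : R) (sin b).
  by apply: (is_derive_eq (is_derive_opp (is_derive_cos b))); rewrite opprK.
have [-> ->] := half_integral D cs.
by rewrite cos_pihalf cos0 cospi; split; ring.
Qed.

Lemma half_sin_sin : \int[mu]_(b in `[0, pi]) (posc b * (sin b * sin b)) = pi / 4 /\
  \int[mu]_(b in `[0, pi]) (negc b * (sin b * sin b)) = pi / 4.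
Proof.
have D b : is_derive b 1 (fun b => 2^-1 * (b + - (sin b * cos b)) : R) (sin b * sin b).
  apply: (is_derive_eq (is_derive_scale _ (is_derive_add (is_derive_id b 1)
     (is_derive_opp (is_derive_mul (is_derive_sin b) (is_derive_cos b)))))).
  have := cos2Dsin2 b; move: (cos b) (sin b) => c s E.
  rewrite expr2 in E; lra.
have [-> ->] := half_integral D (continuous_mul cs cs).
rewrite cos_pihalf sin0 sinpi; move: (pi : R) (sin _) (cos _) => p s c.
by split; field.
Qed.

Lemma half_dipole : \int[mu]_(b in `[0, pi]) (posc b * (sin b * cos b)) = 1 / 2 /\
  \int[mu]_(b in `[0, pi]) (negc b * (sin b * cos b)) = - (1 / 2).
Proof.
have D b : is_derive b 1 (fun b => 2^-1 * (sin b * sin b) : R) (sin b * cos b).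
  apply: (is_derive_eq (is_derive_scale _ (is_derive_mul (is_derive_sin b) (is_derive_sin b)))).
  by move: (cos b) (sin b) => c s; field.
have [-> ->] := half_integral D (continuous_mul cs cc).
by rewrite sin_pihalf sin0 sinpi; split; field.
Qed.

Lemma half_dipole_sin : \int[mu]_(b in `[0, pi]) (posc b * (sin b * cos b * sin b)) = 1 / 3 /\
  \int[mu]_(b in `[0, pi]) (negc b * (sin b * cos b * sin b)) = - (1 / 3).
Proof.
have D b : is_derive b 1 (fun b => 3^-1 * (sin b * sin b * sin b) : R) (sin b * cos b * sin b).
  apply: (is_derive_eq (is_derive_scale _ (is_derive_mul (is_derive_mul (is_derive_sin b) (is_derive_sin b)) (is_derive_sin b)))).
  by move: (cos b) (sin b) => c s; field.
have [-> ->] := half_integral D (continuous_mul (continuous_mul cs cc) cs).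
by rewrite sin_pihalf sin0 sinpi; split; field.
Qed.

Lemma half_dipole_cos : \int[mu]_(b in `[0, pi]) (posc b * (sin b * cos b * cos b)) = 1 / 3 /\
  \int[mu]_(b in `[0, pi]) (negc b * (sin b * cos b * cos b)) = 1 / 3.
Proof.
have D b : is_derive b 1 (fun b => - 3^-1 * (cos b * cos b * cos b) : R) (sin b * cos b * cos b).
  apply: (is_derive_eq (is_derive_scale _ (is_derive_mul (is_derive_mul (is_derive_cos b) (is_derive_cos b)) (is_derive_cos b)))).
  by move: (cos b) (sin b) => c s; field.
have [-> ->] := half_integral D (continuous_mul (continuous_mul cs cc) cc).
by rewrite cos_pihalf cos0 cospi; split; field.
Qed.

End HalfAngles.

Section Products.
#[local] Opaque derive waveW waveZ sin cos pi Rintegral evo.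
Context d1 d2 (T1 : measurableType d1) (T2 : measurableType d2) (R : realType).
Variables (m1 : {sigma_finite_measure set T1 -> \bar R})
          (m2 : {sigma_finite_measure set T2 -> \bar R}).
Variables (D1 : set T1) (D2 : set T2).
Hypotheses (mD1 : measurable D1) (mD2 : measurable D2).
Hypotheses (fD1 : (m1 D1 < +oo)%E) (fD2 : (m2 D2 < +oo)%E).

Lemma bmeas_fst (f : T1 -> R) : bmeas D1 f -> bmeas (D1 `*` D2) (fun z => f z.1).
Proof.
move=> [mf [c [c0 fc]]]; split; first exact: measurableT_comp mf measurable_fst.
by exists c; split => // z [z1 _]; exact: fc.
Qed.

Lemma bmeas_snd2 (f : T2 -> R) : bmeas D2 f -> bmeas (D1 `*` D2) (fun z => f z.2).
Proof.
move=> [mf [c [c0 fc]]]; split; first exact: measurableT_comp mf measurable_snd.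
by exists c; split => // z [_ z2]; exact: fc.
Qed.

Lemma Rintegral_prod (f : T1 -> R) (g : T2 -> R) : bmeas D1 f -> bmeas D2 g ->
  \int[(m1 \x m2)%E]_(z in D1 `*` D2) (f z.1 * g z.2) =
  \int[m1]_(x in D1) f x * \int[m2]_(y in D2) g y.
Proof.
move=> bf bg; have bfg := bmeasM (bmeas_fst bf) (bmeas_snd2 bg).
rewrite (Rfubini12 mD1 mD2 fD1 fD2 bfg) mulrC -(bRintegralZ mD1 fD1 _ bf).
apply: eq_Rintegral => x _ /=.
by rewrite (bRintegralZ mD2 fD2 _ bg) mulrC.
Qed.

End Products.

Section SheetMasses.
#[local] Opaque derive waveW waveZ sin cos pi Rintegral evo.
Context {R : realType}.
Notation mu := (@lebesgue_measure R).
Notation T1 := (measurableTypeR R).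
Notation T2 := (measurableTypeR R * measurableTypeR R)%type.
Notation T3 := (T1 * T2)%type.
Notation mu2 := (@lebesgue2 R).
Notation mu3 := (@lebesgue3 R).
Implicit Types (h : R * R -> R) (t : R) (k g : T3 -> R).

Lemma ball_box_product (A B C : R -> R) : @bmeas _ T1 R `[0, 1] A ->
  @bmeas _ T1 R `[0, pi] B -> @bmeas _ T1 R `[0, pi] C ->
  \int[mu3]_(z in (@ball_box R)) (A z.1 * (B z.2.1 * C z.2.2)) =
  \int[mu]_(s in `[0, 1]) A s * (\int[mu]_(b in `[0, pi]) B b * \int[mu]_(b in `[0, pi]) C b).
Proof.
move=> bA bB bC.
have m1 : measurable (`[0, pi]%classic : set T1) by exact: measurable_itv.
have bBC : @bmeas _ T2 R (@angles R) (fun w => B w.1 * C w.2).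
  exact: bmeasM (bmeas_fst _ bB) (bmeas_snd2 _ bC).
have -> := @Rintegral_prod _ _ T1 T2 R mu mu2 _ _ (measurable_itv _) (@measurable_angles R)
  (finite_itv 0 1) (@finite_angles R) A _ bA bBC.
congr (_ * _).
exact: (@Rintegral_prod _ _ T1 T1 R mu mu _ _ m1 m1 (finite_itv 0 pi) (finite_itv 0 pi) B C bB bC).
Qed.

Lemma eq_ball_box (f g : T3 -> R) : bmeas (@ball_box R) f -> bmeas (@ball_box R) g ->
  (forall z, (@ball_box R) z -> 0 < z.1 -> f z = g z) ->
  \int[mu3]_(z in (@ball_box R)) f z = \int[mu3]_(z in (@ball_box R)) g z.
Proof.
move=> bf bg fg; rewrite !ball_box_fubini21//; apply: eq_Rintegral => w /set_mem Dw.
have int (u : T3 -> R) : bmeas (@ball_box R) u ->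
   mu.-integrable `]0, 1] (EFin \o (fun s => u (s, w))).
  move=> [mu_ [c [c0 uc]]].
  have f01 : (mu `]0%R, 1%R] < +oo)%E by rewrite lebesgue_measure_itv/= lte_fin ltr01 -EFinB ltry.
  apply: (@bounded_integrable _ T1 R mu _ (measurable_itv _) f01 _ c).
  - exact: (measurableT_comp mu_ (pair2_measurable w)).
  - move=> s /=; rewrite in_itv/= => /andP[s0 s1]; apply: uc; split => //=.
    by rewrite in_itv/= ltW.
rewrite -(Rintegral_itv_obnd_cbnd (int _ bf)) -(Rintegral_itv_obnd_cbnd (int _ bg)).
apply: eq_Rintegral => s /set_mem /=; rewrite in_itv/= => /andP[s0 s1]; apply: fg => //.
by split => //=; rewrite in_itv/= ltW.
Qed.

Definition icell (dx dy : R) (x : R * R) : set T2 :=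
  `[x.1 - dx / 2, x.1 + dx / 2] `*` `[x.2 - dy / 2, x.2 + dy / 2].

Lemma measurable_icell dx dy x : measurable (icell dx dy x).
Proof. by apply: measurableX; exact: measurable_itv. Qed.

Lemma finite_icell dx dy x : (mu2 (icell dx dy x) < +oo)%E.
Proof.
exact: (@finite_measureX _ _ T1 T1 R mu mu _ _ (measurable_itv _) (measurable_itv _)
  (finite_itv _ _) (finite_itv _ _)).
Qed.

Lemma itv_overlap (y0 c h : R) : 0 < h ->
  \int[mu]_(y in `[y0 - h / 2, y0 + h / 2]) \1_(`[c - h / 2, c + h / 2]%classic) y =
  Num.max 0 (h - `|y0 - c|).
Proof.
move=> h0.
rewrite (_ : \int[mu]_(y in _) _ =
  \int[mu]_(y in `[y0 - h / 2, y0 + h / 2] `&` `[c - h / 2, c + h / 2]) 1); last first.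
  rewrite Rintegral_mkcondr; apply: eq_Rintegral => y _; rewrite patchE indicE.
  by case: ifP.
pose m := Num.max (y0 - h / 2) (c - h / 2); pose M := Num.min (y0 + h / 2) (c + h / 2).
rewrite (_ : _ `&` _ = `[m, M]%classic); last first.
  apply/seteqP; split => y /=; rewrite !in_itv/= ge_max le_min.
    by move=> [/andP[-> ->] /andP[-> ->]].
  by move=> /andP[/andP[-> ->] /andP[-> ->]].
rewrite Rintegral_cst//= mul1r lebesgue_measure_itv/= lte_fin.
have E : M - m = h - `|y0 - c|.
  rewrite /M /m; have [yc|yc] := leP y0 c.
    rewrite ler0_norm ?subr_le0// min_l ?max_r; lra.
  by rewrite gtr0_norm ?subr_gt0// min_r ?max_l; lra.
case: ifP => [mM|/negbT]; rewrite -E.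
  by rewrite -EFinB /= max_r// subr_ge0 ltW.
by rewrite -leNgt => Mm; rewrite max_l// subr_le0.
Qed.

Lemma bmeas_indic_comp d (T : measurableType d) (D : set T) (A : set T1) (u : T -> R) :
  measurable A -> measurable_fun setT u -> bmeas D (fun z => \1_A (u z) : R).
Proof.
move=> mA mg; split; first exact: (measurableT_comp (bmeas_indic R setT (mA : measurable (A : set T1))).1 mg).
exists 1; split => // z _; rewrite indicE; by case: (_ \in _); rewrite ?normr1 ?normr0.
Qed.

Lemma sheet_indic k g1 g2 t (a y0 dx dy : R) (c : R * R) : 0 < dy ->
  bmeas (@ball_box R) k -> bmeas (@ball_box R) g1 -> bmeas (@ball_box R) g2 ->
  sheet k g1 g2 t a (y0 - dy / 2) (y0 + dy / 2) (\1_(icell dx dy c)) =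
  \int[mu3]_(z in (@ball_box R)) (k z * (\1_(`[c.1 - dx / 2, c.1 + dx / 2]%classic) (a + t * g1 z)
     * Num.max 0 (dy - `|y0 + t * g2 z - c.2|))).
Proof.
move=> dy0 bk b1 b2.
have [mD3 fD3] := (@measurable_ball_box R, @finite_ball_box R).
have mg : @measurable_fun _ _ (T1 * T3)%type T2 setT (fun p => (a + t * g1 p.2, p.1 + t * g2 p.2)).
  apply: measurable_fun_pair.
    exact: (measurableT_comp (measurable_affine a t b1.1) measurable_snd).
  apply: measurable_funD; first exact: measurable_fst.
  apply: measurable_funM => //; exact: (measurableT_comp b2.1 measurable_snd).
pose F (p : T1 * T3) : R := k p.2 * \1_(icell dx dy c) (a + t * g1 p.2, p.1 + t * g2 p.2).
have bF : bmeas (`[y0 - dy / 2, y0 + dy / 2] `*` (@ball_box R)) F.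
  apply: bmeasM; first exact: (bmeas_snd2 _ bk).
  split; first exact: (measurableT_comp (bmeas_indic R setT (measurable_icell dx dy c)).1 mg).
  exists 1; split => // z _; rewrite indicE; by case: (_ \in _); rewrite ?normr1 ?normr0.
have E := @Rfubini12 _ _ T1 T3 R mu mu3 _ _ (measurable_itv _) mD3 (finite_itv _ _) fD3 F bF.
rewrite /sheet /smear -[LHS]E.
rewrite (@Rfubini21 _ _ T1 T3 R mu mu3 _ _ (measurable_itv _) mD3 (finite_itv _ _) fD3 F bF).
apply: eq_Rintegral => z _; rewrite /F /=.
pose B : set R := `[(c.2 - t * g2 z) - dy / 2, (c.2 - t * g2 z) + dy / 2]%classic.
pose q := k z * \1_(`[c.1 - dx / 2, c.1 + dx / 2]%classic) (a + t * g1 z).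
transitivity (\int[mu]_(y in `[y0 - dy / 2, y0 + dy / 2]) (q * \1_B y)).
  apply: eq_Rintegral => y _; rewrite /q -mulrA; congr (_ * _).
  rewrite !indicE -natrM mulnb; congr ((nat_of_bool _)%:R).
  apply/idP/idP.
    move=> /set_mem[/=]; rewrite !in_itv/= => c1 /andP[c2 c3]; apply/andP; split; apply/mem_set.
      by rewrite /= in_itv.
    by rewrite /B /= in_itv/=; apply/andP; split; lra.
  move=> /andP[/set_mem /=]; rewrite in_itv/= => c1 /set_mem; rewrite /B /= in_itv/= => /andP[c2 c3].
  by apply/mem_set; split; rewrite /= in_itv/= //; apply/andP; split; lra.
have bB : @bmeas _ T1 R `[y0 - dy / 2, y0 + dy / 2] (\1_B : T1 -> R).
  by apply: bmeas_indic; exact: measurable_itv.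
rewrite (@bRintegralZ _ T1 R mu _ (measurable_itv _) (finite_itv _ _) q _ bB) itv_overlap// /q -mulrA.
by rewrite (_ : y0 - (c.2 - t * g2 z) = y0 + t * g2 z - c.2)//; ring.
Qed.

End SheetMasses.

Section Tables.
#[local] Opaque derive waveW waveZ sin cos pi Rintegral evo.
Context {R : realType}.
Implicit Types (h v : R) (l : int).

Definition tri (a b c : R) (l : int) : R :=
  if l == 1 then c else if l == 0 then b else if l == -1 then a else 0.

Definition pos01 v : R := \1_(`[0, +oo[%classic) v.
Definition neg01 v : R := \1_(`]-oo, 0]%classic) v.

Lemma pos01E v : pos01 v = if 0 <= v then 1 else 0.
Proof. by rewrite /pos01 indicE mem_setE in_itv/= andbT; case: ifP. Qed.

Lemma neg01E v : neg01 v = if v <= 0 then 1 else 0.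
Proof. by rewrite /neg01 indicE mem_setE in_itv/=; case: ifP. Qed.

Lemma int_far l : l != 1 -> l != 0 -> l != -1 -> 2 <= l \/ l <= -2.
Proof. by lia. Qed.

Lemma ler_int2 l : 2 <= l -> (2 : R) <= l%:~R.
Proof. by move=> H; rewrite -[2]/(2%:~R) ler_int. Qed.

Lemma ler_intN2 l : l <= -2 -> (l%:~R : R) <= - 2.
Proof. by move=> H; rewrite -[- 2]/((-2)%:~R) ler_int. Qed.

Lemma tent_tri h v l : 0 < h -> `|v| <= h ->
  Num.max 0 (h - `|v - l%:~R * h|) = tri (Num.max 0 (- v)) (h - `|v|) (Num.max 0 v) l.
Proof.
move=> h0 vh; move: (vh); rewrite ler_norml => /andP[v1 v2]; rewrite /tri.
have [->|l1] := eqVneq l 1.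
  by rewrite mul1r ler0_norm ?subr_le0//; congr (Num.max 0 _); lra.
have [->|l0] := eqVneq l 0.
  by rewrite mul0r subr0 max_r// subr_ge0.
have [->|lm] := eqVneq l (-1).
  by rewrite mulN1r opprK ger0_norm; [congr (Num.max 0 _); lra|lra].
rewrite max_l// subr_le0; have [l2|l2] := int_far l1 l0 lm.
  have := ler_int2 l2; move: (l%:~R) => k k2; rewrite ler0_norm; nra.
have := ler_intN2 l2; move: (l%:~R) => k k2; rewrite ger0_norm; nra.
Qed.

Lemma edge_tri (K x h v : R) l : 0 < h -> `|v| <= h -> (`|v| = h -> K = 0) ->
  K * \1_(`[x + l%:~R * h - h / 2, x + l%:~R * h + h / 2]%classic) (x + h / 2 + v) =
  K * tri 0 (neg01 v) (pos01 v) l.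
Proof.
move=> h0 vh K0; move: (vh); rewrite ler_norml => /andP[v1 v2].
rewrite /tri indicE mem_setE in_itv/=.
have [->|l1] := eqVneq l 1.
  rewrite mul1r pos01E; congr (_ * _); have [v0|v0] := leP 0 v.
    by rewrite (_ : _ && _ = true)//; apply/andP; split; lra.
  by rewrite (_ : _ && _ = false)//; apply/negP => /andP[? ?]; lra.
have [->|l0] := eqVneq l 0.
  rewrite mul0r addr0 neg01E; congr (_ * _); have [v0|v0] := leP v 0.
    by rewrite (_ : _ && _ = true)//; apply/andP; split; lra.
  by rewrite (_ : _ && _ = false)//; apply/negP => /andP[? ?]; lra.
rewrite (_ : (if l == -1 then 0 else 0) = 0); last by case: ifP.
rewrite mulr0.
have [vE|/eqP vE] := eqVneq `|v| h; first by rewrite K0// mul0r.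
have v1' : - h < v by rewrite lt_neqAle v1 andbT; apply/eqP => E; apply: vE; rewrite -E normrN gtr0_norm.
have v2' : v < h by rewrite lt_neqAle v2 andbT; apply/eqP => E; apply: vE; rewrite E gtr0_norm.
rewrite (_ : _ && _ = false) ?mulr0//; apply/negP => /andP[].
have [l2|l2] : 2 <= l \/ l <= -1 by move: l1 l0; lia.
  by have := ler_int2 l2; move: (l%:~R : R) => k; nra.
have : (l%:~R : R) <= -1 by rewrite -[-1]/((-1)%:~R) ler_int.
by move: (l%:~R : R) => k; nra.
Qed.

Lemma tri_diff (N P : R) l : tri 0 N P l - tri 0 N P (l + 1) = tri (- N) (N - P) P l.
Proof.
rewrite /tri; have [->|l1] := eqVneq l 1; first by rewrite /= subr0.
have [->|l0] := eqVneq l 0; first by rewrite /=.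
have [->|lm] := eqVneq l (-1); first by rewrite /= sub0r.
have [-> ->] : l + 1 == 1 = false /\ l + 1 == 0 = false by move: l0 lm; lia.
by rewrite if_same subr0.
Qed.

Lemma bmeas_tri d (T : measurableType d) (D : set T) (A B C : T -> R) l :
  bmeas D A -> bmeas D B -> bmeas D C -> bmeas D (fun z => tri (A z) (B z) (C z) l).
Proof. by rewrite /tri => bA bB bC; case: (l == 1) => //; case: (l == 0) => //; case: (l == -1) => //; exact: bmeas_cst. Qed.

Lemma bmeas_comp01 d (T : measurableType d) (D : set T) (u : T -> R) :
  measurable_fun setT u -> bmeas D (pos01 \o u) /\ bmeas D (neg01 \o u).
Proof.
move=> mu_; split.
  exact: (@bmeas_indic_comp R _ T D `[0, +oo[%classic u (measurable_itv _) mu_).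
exact: (@bmeas_indic_comp R _ T D `]-oo, 0]%classic u (measurable_itv _) mu_).
Qed.

Lemma bmeas_max0 d (T : measurableType d) (D : set T) (u : T -> R) :
  bmeas D u -> bmeas D (fun z => Num.max 0 (u z)).
Proof.
move=> [mu_ [c [c0 uc]]]; split; first exact: measurable_maxr.
exists c; split => // z Dz; have := uc z Dz; rewrite ler_norml => /andP[? ?].
by rewrite ger0_norm ?le_max ?lexx// ge_max c0.
Qed.

Lemma bmeas_norm d (T : measurableType d) (D : set T) (u : T -> R) :
  bmeas D u -> bmeas D (fun z => `|u z|).
Proof.
move=> [mu_ [c [c0 uc]]]; split; first exact: measurableT_comp.
by exists c; split => // z Dz; rewrite normr_id uc.
Qed.

End Tables.

Section Masses.
#[local] Opaque derive waveW waveZ sin cos pi Rintegral evo.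
Context {R : realType}.
Notation mu := (@lebesgue_measure R).
Notation T1 := (measurableTypeR R).
Notation T2 := (measurableTypeR R * measurableTypeR R)%type.
Notation T3 := (T1 * T2)%type.
Notation mu2 := (@lebesgue2 R).
Notation mu3 := (@lebesgue3 R).
Implicit Types (h : R * R -> R) (t : R) (k g u : T3 -> R) (i j : int) (x : R * R).

Lemma sheet_mass k g1 g2 u t x dx dy i j : 0 < t -> t <= dx -> t <= dy ->
  bmeas (@ball_box R) k -> bmeas (@ball_box R) g1 -> bmeas (@ball_box R) g2 -> measurable_fun setT u ->
  (forall z, (@ball_box R) z -> [/\ `|g1 z| <= 1, `|g2 z| <= 1 & `|g1 z| = 1 -> k z = 0]) ->
  (forall z, (@ball_box R) z -> 0 < z.1 -> k z != 0 ->
     (0 <= g1 z) = (0 <= u z) /\ (g1 z <= 0) = (u z <= 0)) ->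
  sheet k g1 g2 t (x.1 + dx / 2) (x.2 - dy / 2) (x.2 + dy / 2)
    (\1_(icell dx dy (x.1 + i%:~R * dx, x.2 + j%:~R * dy))) =
  \int[mu3]_(z in (@ball_box R)) (k z * (tri 0 (neg01 (u z)) (pos01 (u z)) i
     * tri (Num.max 0 (- (t * g2 z))) (dy - `|t * g2 z|) (Num.max 0 (t * g2 z)) j)).
Proof.
move=> t0 tx ty bk b1 b2 mu_ gP uP.
have dx0 : 0 < dx := lt_le_trans t0 tx; have dy0 : 0 < dy := lt_le_trans t0 ty.
rewrite sheet_indic//; apply: eq_ball_box.
- apply: bmeasM => //; apply: bmeasM.
    apply: bmeas_indic_comp; [exact: measurable_itv|exact: measurable_affine b1.1].
  apply: bmeas_max0; apply: bmeasB; first exact: bmeas_cst.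
  by apply: bmeas_norm; apply: bmeasB; [apply: bmeasD; [exact: bmeas_cst|exact: bmeasZ]|exact: bmeas_cst].
- have [bp bn] := bmeas_comp01 (@ball_box R) mu_; have b2' := bmeasZ t b2.
  apply: bmeasM => //; apply: bmeasM; apply: bmeas_tri => //; try exact: bmeas_cst.
  + apply: bmeas_max0; have := bmeasZ (-1) b2'; congr (bmeas _ _).
    by apply/funext => z; rewrite mulN1r.
  + by apply: bmeasB; [exact: bmeas_cst|exact: bmeas_norm].
  + exact: bmeas_max0.
- move=> z Bz z0; have [g1z g2z kz] := gP z Bz; rewrite /= !mulrA.
  have vx g : `|g z| <= 1 -> `|t * g z| <= t.
    by move=> gz; rewrite normrM gtr0_norm// ler_piMr// ltW.
  congr (_ * _).
  + rewrite edge_tri//; first last.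
    * move=> E; apply: kz; apply: le_anti; rewrite g1z /= -(ler_pM2l t0) mulr1.
      by rewrite -[t in t * _](gtr0_norm t0) -normrM E.
    * exact: le_trans (vx _ g1z) tx.
    have [k0|k0] := eqVneq (k z) 0; first by rewrite k0 !mul0r.
    have [u1 u2] := uP z Bz z0 k0; congr (_ * _).
    by rewrite !neg01E !pos01E pmulr_rge0// pmulr_rle0// u1 u2.
  + rewrite -tent_tri//; last exact: le_trans (vx _ g2z) ty.
    by congr (Num.max 0 (_ - `|_|)); ring.
Qed.

Lemma max0_mull (a v : R) : 0 <= a -> Num.max 0 (a * v) = a * Num.max 0 v.
Proof. by move=> a0; rewrite maxr_pMr// mulr0. Qed.

Lemma finite_mu_itv (a b : R) : (mu `[a, b] < +oo)%E. Proof. exact: finite_itv. Qed.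

Lemma bmeas_continuous (D : set T1) (f : R -> R) (c : R) : continuous f ->
  (forall b, `|f b| <= c) -> @bmeas _ T1 R D f.
Proof.
move=> cf fc; split; first exact: continuous_measurable_fun.
by exists c; split => [|w _]; [exact: le_trans (normr_ge0 _) (fc 0)|exact: fc].
Qed.

Lemma norm_sin (b : R) : `|sin b| <= 1.
Proof. by rewrite ler_norml sin_geN1 sin_le1. Qed.

Lemma norm_cos (b : R) : `|cos b| <= 1.
Proof. by rewrite ler_norml cos_geN1 cos_le1. Qed.

Lemma bmeas_sin1 (D : set T1) : @bmeas _ T1 R D sin.
Proof. exact: bmeas_continuous (@continuous_sin R) norm_sin. Qed.

Lemma bmeas_cos1 (D : set T1) : @bmeas _ T1 R D cos.
Proof. exact: bmeas_continuous (@continuous_cos R) norm_cos. Qed.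

Lemma posc01 (b : R) : posc b = pos01 (cos b).
Proof. by rewrite pos01E. Qed.

Lemma negc01 (b : R) : negc b = neg01 (cos b).
Proof. by rewrite neg01E. Qed.

Lemma bmeas_posc (D : set T1) : @bmeas _ T1 R D posc /\ @bmeas _ T1 R D negc.
Proof.
have [H1 H2] := bmeas_comp01 D (bmeas_cos1 setT).1.
by split; [move: H1|move: H2]; congr (bmeas _ _); apply/funext => b; rewrite ?posc01 ?negc01.
Qed.

Section BallIntegrals.
Variables (rho : R -> R) (rb t h : R).
Hypotheses (brho : @bmeas _ T1 R `[0, 1] rho) (t0 : 0 < t).
Hypotheses (rho01 : forall s, s \in `[0, 1] -> 0 <= rho s) (rhoE : \int[mu]_(s in `[0, 1]) rho s = rb).

Let sin_ge0_box z : (@ball_box R) z -> 0 <= rho z.1 /\ 0 <= sin z.2.1.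
Proof.
move=> [z1 [z2 _]]; split; first exact: rho01.
by move: z2; rewrite /= in_itv/=; exact: sin_ge0_pi.
Qed.

Lemma wedge_mass (kap S : R -> R) (K K2 : R) j :
  @bmeas _ T1 R `[0, pi] kap -> @bmeas _ T1 R `[0, pi] S ->
  \int[mu]_(b in `[0, pi]) (S b * kap b) = K ->
  \int[mu]_(b in `[0, pi]) (S b * (kap b * sin b)) = K2 ->
  \int[mu3]_(z in (@ball_box R)) (kap z.2.1 * (S z.2.1 *
     tri (Num.max 0 (- (t * ray rho (@sph2 R) z))) (h - `|t * ray rho (@sph2 R) z|)
       (Num.max 0 (t * ray rho (@sph2 R) z)) j)) =
  tri (t * (rb * K2)) (h * (K * pi) - t * (rb * (K2 * 2))) (t * (rb * K2)) j.
Proof.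
move=> bk bS EK EK2.
have bc := bmeas_cos1 `[0, pi]; have bs := bmeas_sin1 `[0, pi].
have [bp bn] := bmeas_posc `[0, pi].
have bSk := bmeasM bS bk; have bSks := bmeasM bS (bmeasM bk bs).
have [EP EN] := @half_cos R.
have b1 : @bmeas _ T1 R `[0, pi] (fun=> 1) by exact: bmeas_cst.
have b11 : @bmeas _ T1 R `[0, 1] (fun=> 1) by exact: bmeas_cst.
have bpc := bmeasM bp bc; have bnc := bmeasM bn bc.
have babs : @bmeas _ T1 R `[0, pi] (fun b => `|cos b|) := bmeas_norm bc.
have mI (a b : R) : measurable (`[a, b]%classic : set T1) by exact: measurable_itv.
have [mD fD] := (@measurable_ball_box R, @finite_ball_box R).
have Eabs : \int[mu]_(b in `[0, pi]) `|cos b| = 2.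
  transitivity (\int[mu]_(b in `[0, pi]) (posc b * cos b - negc b * cos b)).
    by apply: eq_Rintegral => b _; exact: cos_abs.
  rewrite (@bRintegralB _ T1 R mu _ (mI _ _) (finite_mu_itv _ _) _ _ bpc bnc) EP EN; ring.
have bbox (A B C : R -> R) : @bmeas _ T1 R `[0, 1] A -> @bmeas _ T1 R `[0, pi] B ->
    @bmeas _ T1 R `[0, pi] C -> bmeas (@ball_box R) (fun z => A z.1 * (B z.2.1 * C z.2.2)).
  move=> bA bB bC; apply: bmeasM; first exact: (bmeas_fst _ bA).
  exact: (bmeas_snd2 _ (bmeasM (bmeas_fst _ bB) (bmeas_snd2 _ bC))).
rewrite /tri; case: (j == 1).
  transitivity (\int[mu3]_(z in (@ball_box R)) (t * (rho z.1 * (S z.2.1 * (kap z.2.1 * sin z.2.1) * (posc z.2.2 * cos z.2.2))))).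
    apply: eq_Rintegral => z /set_mem Bz; have [r0 s0] := sin_ge0_box Bz.
    rewrite /ray /sph2 max0_mull ?(ltW t0)// max0_mull// max0_mull// cos_posp.
    move: (sin _) (posc _) (cos _) => *; ring.
  rewrite (bRintegralZ mD fD _ (bbox _ _ _ brho bSks bpc)) (ball_box_product brho bSks bpc) rhoE EK2 EP; ring.
case: (j == 0).
  transitivity (\int[mu3]_(z in (@ball_box R)) (h * (1 * (S z.2.1 * kap z.2.1 * 1)) -
     t * (rho z.1 * (S z.2.1 * (kap z.2.1 * sin z.2.1) * `|cos z.2.2|)))).
    apply: eq_Rintegral => z /set_mem Bz; have [r0 s0] := sin_ge0_box Bz.
    rewrite /ray /sph2 !normrM (gtr0_norm t0) (ger0_norm r0) (ger0_norm s0).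
    move: (sin _) (cos _) => *; ring.
  rewrite (bRintegralB mD fD (bmeasZ _ (bbox _ _ _ b11 bSk b1)) (bmeasZ _ (bbox _ _ _ brho bSks babs))).
  rewrite (bRintegralZ mD fD _ (bbox _ _ _ b11 bSk b1)) (bRintegralZ mD fD _ (bbox _ _ _ brho bSks babs)).
  rewrite (ball_box_product b11 bSk b1) (ball_box_product brho bSks babs) rhoE EK2 EK Eabs.
  rewrite !Rintegral_itv_cst ?ler01 ?pi_ge0// !subr0; move: (pi : R) => p; ring.
case: (j == -1); last by under eq_Rintegral do rewrite !mulr0; rewrite Rintegral_cst// mul0r.
transitivity (\int[mu3]_(z in (@ball_box R)) (- t * (rho z.1 * (S z.2.1 * (kap z.2.1 * sin z.2.1) * (negc z.2.2 * cos z.2.2))))).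
  apply: eq_Rintegral => z /set_mem Bz; have [r0 s0] := sin_ge0_box Bz.
  rewrite /ray /sph2 -!mulrN max0_mull ?(ltW t0)// max0_mull// max0_mull// cos_negp.
  move: (sin _) (negc _) (cos _) => *; ring.
rewrite (bRintegralZ mD fD _ (bbox _ _ _ brho bSks bnc)) (ball_box_product brho bSks bnc) rhoE EK2 EN; ring.
Qed.

Lemma dipole_mass (S : R -> R) (K : R) j :
  @bmeas _ T1 R `[0, pi] S -> \int[mu]_(b in `[0, pi]) S b = K ->
  \int[mu3]_(z in (@ball_box R)) (@dipole R z.2 * (S z.2.2 *
     tri (Num.max 0 (- (t * ray rho (@sph1 R) z))) (h - `|t * ray rho (@sph1 R) z|)
       (Num.max 0 (t * ray rho (@sph1 R) z)) j)) =
  tri (- (t * (rb * (K / 3)))) 0 (t * (rb * (K / 3))) j.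
Proof.
move=> bS EK.
have bc := bmeas_cos1 `[0, pi]; have bs := bmeas_sin1 `[0, pi].
have [bp bn] := bmeas_posc `[0, pi].
have bd : @bmeas _ T1 R `[0, pi] (fun b => sin b * cos b) := bmeasM bs bc.
have bdc := bmeasM bd bc.
have [EP EN] := @half_dipole_cos R.
have b11 : @bmeas _ T1 R `[0, 1] (fun=> 1) by exact: bmeas_cst.
have bpd := bmeasM bp bdc; have bnd := bmeasM bn bdc.
have mI (a b : R) : measurable (`[a, b]%classic : set T1) by exact: measurable_itv.
have [mD fD] := (@measurable_ball_box R, @finite_ball_box R).
have Ed : \int[mu]_(b in `[0, pi]) (sin b * cos b) = 0.
  have D (b : R) : is_derive b 1 (fun b => 2^-1 * (sin b * sin b) : R) (sin b * cos b).
    apply: (is_derive_eq (is_derive_scale _ (is_derive_mul (is_derive_sin b) (is_derive_sin b)))).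
    by move: (cos b) (sin b) => c s; field.
  rewrite (Rintegral_FTC (pi_gt0 R) D (continuous_mul (@continuous_sin R) (@continuous_cos R))).
  by rewrite sin0 sinpi; ring.
have bbox (A B C : R -> R) : @bmeas _ T1 R `[0, 1] A -> @bmeas _ T1 R `[0, pi] B ->
    @bmeas _ T1 R `[0, pi] C -> bmeas (@ball_box R) (fun z => A z.1 * (B z.2.1 * C z.2.2)).
  move=> bA bB bC; apply: bmeasM; first exact: (bmeas_fst _ bA).
  exact: (bmeas_snd2 _ (bmeasM (bmeas_fst _ bB) (bmeas_snd2 _ bC))).
have IP := ball_box_product brho bpd bS; have IN := ball_box_product brho bnd bS.
rewrite EP EK rhoE in IP; rewrite EN EK rhoE in IN.
have [bP bN] := (bbox _ _ _ brho bpd bS, bbox _ _ _ brho bnd bS).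
rewrite /tri; case: (j == 1).
  transitivity (\int[mu3]_(z in (@ball_box R)) (t * (rho z.1 * (posc z.2.1 * (sin z.2.1 * cos z.2.1 * cos z.2.1) * S z.2.2)))).
    apply: eq_Rintegral => z /set_mem Bz; have [r0 s0] := sin_ge0_box Bz.
    rewrite /ray /sph1 /dipole max0_mull ?(ltW t0)// max0_mull// cos_posp.
    move: (sin _) (posc _) (cos _) => *; ring.
  rewrite (bRintegralZ mD fD _ bP) IP; ring.
case: (j == 0).
  have b0 := bbox _ _ _ b11 bd bS.
  transitivity (\int[mu3]_(z in (@ball_box R)) (h * (1 * (sin z.2.1 * cos z.2.1 * S z.2.2)) -
     t * (rho z.1 * (posc z.2.1 * (sin z.2.1 * cos z.2.1 * cos z.2.1) * S z.2.2)
         - rho z.1 * (negc z.2.1 * (sin z.2.1 * cos z.2.1 * cos z.2.1) * S z.2.2)))).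
    apply: eq_Rintegral => z /set_mem Bz; have [r0 s0] := sin_ge0_box Bz.
    rewrite /ray /sph1 /dipole !normrM (gtr0_norm t0) (ger0_norm r0) cos_abs.
    move: (sin _) (cos _) (posc _) (negc _) => *; ring.
  rewrite (bRintegralB mD fD (bmeasZ _ b0) (bmeasZ _ (bmeasB bP bN))).
  rewrite (bRintegralZ mD fD _ b0) (bRintegralZ mD fD _ (bmeasB bP bN)) (bRintegralB mD fD bP bN).
  by rewrite IP IN (ball_box_product b11 bd bS) Ed; ring.
case: (j == -1); last by under eq_Rintegral do rewrite !mulr0; rewrite Rintegral_cst// mul0r.
transitivity (\int[mu3]_(z in (@ball_box R)) (- t * (rho z.1 * (negc z.2.1 * (sin z.2.1 * cos z.2.1 * cos z.2.1) * S z.2.2)))).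
  apply: eq_Rintegral => z /set_mem Bz; have [r0 s0] := sin_ge0_box Bz.
  rewrite /ray /sph1 /dipole -!mulrN max0_mull ?(ltW t0)// max0_mull// cos_negp.
  move: (sin _) (negc _) (cos _) => *; ring.
rewrite (bRintegralZ mD fD _ bN) IN; ring.
Qed.

End BallIntegrals.
End Masses.

Section EdgeMasses.
#[local] Opaque derive waveW waveZ sin cos pi Rintegral evo sheet.
Context {R : realType}.
Notation mu := (@lebesgue_measure R).
Notation T1 := (measurableTypeR R).
Notation T2 := (measurableTypeR R * measurableTypeR R)%type.
Notation T3 := (T1 * T2)%type.
Notation mu2 := (@lebesgue2 R).
Notation mu3 := (@lebesgue3 R).
Implicit Types (i j : int) (x : R * R).

Definition radial_weight (rho : R -> R) (rb : R) :=
  [/\ @bmeas _ T1 R `[0, 1] rho, forall s, s \in `[0, 1] -> 0 <= rho s <= 1,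
    forall s, s != 0 -> rho s != 0 & \int[mu]_(s in `[0, 1]) rho s = rb].

Lemma radial_weight1 : radial_weight (fun=> 1) 1.
Proof.
split; [exact: bmeas_cst|by move=> *; rewrite ler01 lexx|by move=> *; exact: oner_neq0|].
by rewrite Rintegral_itv_cst// subr0 mulr1.
Qed.

Lemma radial_weight_id : radial_weight (fun s => s) (1 / 2).
Proof.
split.
- split; first exact: measurable_id.
  by exists 1; split => // s; rewrite /= in_itv/= => /andP[s0 s1]; rewrite ger0_norm.
- by move=> s; rewrite in_itv.
- by [].
- have D (s : R) : is_derive s 1 (fun s => 2^-1 * (s * s) : R) s.
    apply: (is_derive_eq (is_derive_scale _ (is_derive_mul (is_derive_id s 1) (is_derive_id s 1)))).
    by field.
  have c : continuous (fun s : R => s) by move=> s; exact: cvg_id.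
  by rewrite (Rintegral_FTC ltr01 D c); field.
Qed.

Lemma bmeas_ray rho rb (f : T2 -> R) : radial_weight rho rb -> bmeas (@angles R) f ->
  bmeas (@ball_box R) (ray rho f).
Proof.
by move=> [br _ _ _] bf; exact: bmeasM (bmeas_fst _ br) (bmeas_snd2 _ bf).
Qed.

Lemma norm_ray rho rb (f : T2 -> R) : radial_weight rho rb ->
  (forall w, `|f w| <= 1) -> forall z, (@ball_box R) z -> `|ray rho f z| <= `|f z.2| /\ `|ray rho f z| <= 1.
Proof.
move=> [_ r01 _ _] f1 z [z1 _]; have /andP[r0 r1] := r01 _ z1.
have H : `|ray rho f z| <= `|f z.2| by rewrite /ray normrM ger0_norm// ler_piMl.
by split => //; exact: le_trans H (f1 _).
Qed.

Lemma norm_sph1 (w : T2) : `|sph1 w : R| <= 1. Proof. exact: norm_cos. Qed.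

Lemma norm_sph2 (w : T2) : `|sph2 w : R| <= `|sin w.1|.
Proof. by rewrite /sph2 normrM ler_piMr// norm_cos. Qed.

Lemma sin0_of_cos (b : R) : `|cos b| = 1 -> sin b = 0.
Proof.
move=> c1; have := cos2Dsin2 b; rewrite -real_normK ?num_real// c1 expr1n.
by move=> /eqP; rewrite -subr_eq0 addrAC subrr add0r sqrf_eq0 => /eqP.
Qed.

Lemma cos0_of_sin (b : R) : `|sin b| = 1 -> cos b = 0.
Proof.
move=> c1; have := cos2Dsin2 b; rewrite -[sin b ^+ 2]real_normK ?num_real// c1 expr1n.
by move=> /eqP; rewrite -subr_eq0 addrK sqrf_eq0 => /eqP.
Qed.

Section Weights.
Variables (rho : R -> R) (rb t dx dy : R).
Hypotheses (wrho : radial_weight rho rb) (t0 : 0 < t) (tx : t <= dx) (ty : t <= dy).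

Let b1 : bmeas (@ball_box R) (ray rho (@sph1 R)).
Proof. exact: (bmeas_ray wrho (bmeas_sph1 _)). Qed.

Let b2 : bmeas (@ball_box R) (ray rho (@sph2 R)).
Proof. exact: (bmeas_ray wrho (bmeas_sph2 _)). Qed.

Let norm_sph2_1 (w : T2) : `|sph2 w : R| <= 1.
Proof. exact: le_trans (norm_sph2 w) (norm_sin _). Qed.

Let rho_pos (z : T3) : (@ball_box R) z -> 0 < z.1 -> 0 < rho z.1.
Proof.
move=> [z1 _] z0; have [_ r01 rn0 _] := wrho; have /andP[r0 _] := r01 _ z1.
by rewrite lt_def r0 andbT; apply: rn0; rewrite gt_eqF.
Qed.

Definition wedge_row (K K2 : R) (j : int) : R :=
  tri (t * (rb * K2)) (dy * (K * pi) - t * (rb * (K2 * 2))) (t * (rb * K2)) j.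

Lemma right_sheet_mass (kap : R -> R) (KP KN K2P K2N : R) x i j :
  (forall b, sin b = 0 -> kap b = 0) -> @bmeas _ T1 R `[0, pi] kap ->
  \int[mu]_(b in `[0, pi]) (posc b * kap b) = KP /\ \int[mu]_(b in `[0, pi]) (negc b * kap b) = KN ->
  \int[mu]_(b in `[0, pi]) (posc b * (kap b * sin b)) = K2P /\
  \int[mu]_(b in `[0, pi]) (negc b * (kap b * sin b)) = K2N ->
  sheet (fun z => kap z.2.1) (ray rho (@sph1 R)) (ray rho (@sph2 R)) t
    (x.1 + dx / 2) (x.2 - dy / 2) (x.2 + dy / 2)
    (\1_(icell dx dy (x.1 + i%:~R * dx, x.2 + j%:~R * dy))) =
  tri 0 (wedge_row KN K2N j) (wedge_row KP K2P j) i.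
Proof.
move=> kap0 bk [EKP EKN] [EK2P EK2N].
have bk' : bmeas (@ball_box R) (fun z => kap z.2.1).
  exact: (bmeas_snd2 _ (bmeas_fst _ bk)).
have mu_ : measurable_fun setT (fun z : T3 => cos z.2.1).
  by apply: measurable_cos_comp; exact: measurableT_comp measurable_fst measurable_snd.
rewrite (@sheet_mass R _ _ _ (fun z => cos z.2.1) t x dx dy i j t0 tx ty bk' b1 b2 mu_); first last.
- move=> z Bz z0 _; have r0 := rho_pos Bz z0.
  by rewrite /ray /sph1 pmulr_rge0// pmulr_rle0.
- move=> z Bz; have [H1 H2] := norm_ray wrho norm_sph1 Bz.
  have [_ H4] := norm_ray wrho norm_sph2_1 Bz; split => // E.
  apply: kap0; apply: sin0_of_cos; apply: le_anti; rewrite norm_cos /=.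
  by rewrite -E.
have [bp bn] := @bmeas_posc R `[0, pi].
have [br r01 _ rE] := wrho.
have r0 s : s \in `[0, 1] -> 0 <= rho s by move=> /r01/andP[].
rewrite {1}/tri [in RHS]/tri.
case: (i == 1).
  under eq_Rintegral do rewrite -posc01.
  exact: (wedge_mass dy br t0 r0 rE j bk bp EKP EK2P).
case: (i == 0).
  under eq_Rintegral do rewrite -negc01.
  exact: (wedge_mass dy br t0 r0 rE j bk bn EKN EK2N).
rewrite if_same; under eq_Rintegral do rewrite mul0r mulr0.
by rewrite Rintegral_cst ?mul0r//; exact: measurable_ball_box.
Qed.

Lemma left_sheet_mass (kap : R -> R) (KP KN K2P K2N : R) x i j :
  (forall b, sin b = 0 -> kap b = 0) -> @bmeas _ T1 R `[0, pi] kap ->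
  \int[mu]_(b in `[0, pi]) (posc b * kap b) = KP /\ \int[mu]_(b in `[0, pi]) (negc b * kap b) = KN ->
  \int[mu]_(b in `[0, pi]) (posc b * (kap b * sin b)) = K2P /\
  \int[mu]_(b in `[0, pi]) (negc b * (kap b * sin b)) = K2N ->
  sheet (fun z => kap z.2.1) (ray rho (@sph1 R)) (ray rho (@sph2 R)) t
    (x.1 - dx / 2) (x.2 - dy / 2) (x.2 + dy / 2)
    (\1_(icell dx dy (x.1 + i%:~R * dx, x.2 + j%:~R * dy))) =
  tri 0 (wedge_row KN K2N j) (wedge_row KP K2P j) (i + 1).
Proof.
move=> kap0 bk E1 E2.
have := right_sheet_mass (x.1 - dx, x.2) (i + 1) j kap0 bk E1 E2; rewrite /=.
rewrite (_ : x.1 - dx + dx / 2 = x.1 - dx / 2); last by field.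
by rewrite (_ : x.1 - dx + (i + 1)%:~R * dx = x.1 + i%:~R * dx)// intrD; ring.
Qed.

Definition dipole_row (i : int) : R :=
  tri (- (t * (rb * (pi / 2 / 3)))) 0 (t * (rb * (pi / 2 / 3))) i.

(* The two coordinates are exchanged: this is the sheet over the horizontal edge
   of height [x.2 + dy / 2]. *)
Lemma top_sheet_mass x i j :
  sheet (fun z => dipole z.2) (ray rho (@sph2 R)) (ray rho (@sph1 R)) t
    (x.2 + dy / 2) (x.1 - dx / 2) (x.1 + dx / 2)
    (\1_(icell dy dx (x.2 + j%:~R * dy, x.1 + i%:~R * dx))) =
  tri 0 (dipole_row i) (dipole_row i) j.
Proof.
have bk' : bmeas (@ball_box R) (fun z => dipole z.2).
  exact: (bmeas_snd2 _ (bmeas_dipole _)).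
have mu_ : measurable_fun setT (fun z : T3 => cos z.2.2).
  by apply: measurable_cos_comp; exact: measurableT_comp measurable_snd measurable_snd.
rewrite (@sheet_mass R _ _ _ (fun z => cos z.2.2) t (x.2, x.1) dy dx j i t0 ty tx bk' b2 b1 mu_); first last.
- move=> z Bz z0 k0; have r0 := rho_pos Bz z0.
  have s0 : 0 < sin z.2.1.
    have [_ [z1 _]] := Bz; rewrite lt_def; apply/andP; split; last first.
      by move: z1; rewrite /= in_itv/=; exact: sin_ge0_pi.
    by apply: contraNneq k0 => E; rewrite /dipole E mul0r.
  by rewrite /ray /sph2 mulrA !(pmulr_rge0 _ (mulr_gt0 r0 s0)) !(pmulr_rle0 _ (mulr_gt0 r0 s0)).
- move=> z Bz; have [H1 H2] := norm_ray wrho norm_sph2_1 Bz.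
  have [_ H4] := norm_ray wrho norm_sph1 Bz; split => // E.
  rewrite /dipole cos0_of_sin ?mulr0//; apply: le_anti; rewrite norm_sin /=.
  by rewrite -E (le_trans H1)// norm_sph2.
have [bp bn] := @bmeas_posc R `[0, pi].
have [br r01 _ rE] := wrho.
have r0 s : s \in `[0, 1] -> 0 <= rho s by move=> /r01/andP[].
have [EP EN] : \int[mu]_(b in `[0, pi]) posc b = pi / 2 /\ \int[mu]_(b in `[0, pi]) negc b = pi / 2.
  have [H1 H2] := @half1 R.
  by split; [rewrite -[RHS]H1|rewrite -[RHS]H2]; apply: eq_Rintegral => b _; rewrite mulr1.
rewrite {1}/tri [in RHS]/tri.
case: (j == 1).
  under eq_Rintegral do rewrite -posc01.
  exact: (dipole_mass dx br t0 r0 rE i bp EP).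
case: (j == 0).
  under eq_Rintegral do rewrite -negc01.
  exact: (dipole_mass dx br t0 r0 rE i bn EN).
rewrite if_same; under eq_Rintegral do rewrite mul0r mulr0.
by rewrite Rintegral_cst ?mul0r//; exact: measurable_ball_box.
Qed.

Lemma bottom_sheet_mass x i j :
  sheet (fun z => dipole z.2) (ray rho (@sph2 R)) (ray rho (@sph1 R)) t
    (x.2 - dy / 2) (x.1 - dx / 2) (x.1 + dx / 2)
    (\1_(icell dy dx (x.2 + j%:~R * dy, x.1 + i%:~R * dx))) =
  tri 0 (dipole_row i) (dipole_row i) (j + 1).
Proof.
have := top_sheet_mass (x.1, x.2 - dy) i (j + 1); rewrite /=.
rewrite (_ : x.2 - dy + dy / 2 = x.2 - dy / 2); last by field.
by rewrite (_ : x.2 - dy + (j + 1)%:~R * dy = x.2 + j%:~R * dy)// intrD; ring.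
Qed.

End Weights.
End EdgeMasses.

(** * Stencils of the wave operators *)

Section LocalDensities.
#[local] Opaque derive waveW waveZ sin cos pi Rintegral evo sheet.
Context {R : realType}.
Notation mu := (@lebesgue_measure R).
Notation T1 := (measurableTypeR R).
Notation T2 := (measurableTypeR R * measurableTypeR R)%type.
Notation mu2 := (@lebesgue2 R).
Implicit Types (dx dy : R) (x : R * R) (h : R * R -> R) (F G : (R * R -> R) -> R).

Definition near_cell dx dy x (z : R * R) : bool :=
  (`|z.1 - x.1| <= 3 / 2 * dx) && (`|z.2 - x.2| <= 3 / 2 * dy).

Definition has_density dx dy x F := exists f, [/\ mu2.-integrable setT (EFin \o f),
  forall z, f z != 0 -> near_cell dx dy x z &
  forall h, @bmeas _ T2 R setT h -> F h = \int[mu2]_z (f z * h z)].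

Lemma has_density_lin dx dy x F G (a b : R) : has_density dx dy x F -> has_density dx dy x G ->
  has_density dx dy x (fun h => a * F h + b * G h).
Proof.
move=> [f [intf f0 fE]] [g [intg g0 gE]].
have inta (c : R) (u : T2 -> R) : mu2.-integrable setT (EFin \o u) ->
   mu2.-integrable setT (EFin \o (fun z => c * u z)).
  move=> iu; have := integrable_mul_bmeas iu (@bmeas_cst _ T2 R setT c).
  by congr (_.-integrable _ _); apply/funext => z /=; rewrite mulrC.
exists (fun z => a * f z + b * g z); split.
- exact: (integrableD measurableT (inta a f intf) (inta b g intg)).
- move=> z; have [->|/f0//] := eqVneq (f z) 0; have [->|/g0//] := eqVneq (g z) 0.
  by rewrite !mulr0 addr0 eqxx.
- move=> h bh; rewrite fE// gE//.
  have If := integrable_mul_bmeas intf bh; have Ig := integrable_mul_bmeas intg bh.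
  rewrite -RintegralZl// -RintegralZl// -RintegralD//; [|exact: inta..].
  by apply: eq_Rintegral => z _; ring.
Qed.

Lemma measurable_swap : @measurable_fun _ _ T2 T2 setT (@swap_pt R).
Proof. by apply: measurable_fun_pair; [exact: measurable_snd|exact: measurable_fst]. Qed.

Lemma lebesgue2_swap (A : set T2) : measurable A -> mu2 (@swap_pt R @^-1` A) = mu2 A.
Proof.
move=> mA; apply/esym.
apply: (@product_measure_unique _ _ T1 T1 R mu mu
  (measure_function_pushforward__canonical__measure_function_Measure mu2 measurable_swap)) => //.
move=> B C mB mC; rewrite /= /pushforward.
rewrite (_ : _ @^-1` _ = C `*` B); last by apply/seteqP; split => z [].
by rewrite /lebesgue2 product_measure1E// muleC.
Qed.

Lemma integral_swap (f : T2 -> R) : mu2.-integrable setT (EFin \o f) ->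
  mu2.-integrable setT (EFin \o (f \o @swap_pt R)) /\
  \int[mu2]_z f (swap_pt z) = \int[mu2]_z f z.
Proof. exact: (integral_measure_preserving measurable_swap lebesgue2_swap). Qed.

Lemma has_density_swap dx dy x F : has_density dx dy x F ->
  has_density dy dx (swap_pt x) (fun h => F (h \o @swap_pt R)).
Proof.
move=> [f [intf f0 fE]]; have [intf' _] := integral_swap intf.
exists (f \o @swap_pt R); split => //.
- by move=> z /f0; rewrite /near_cell /= andbC.
- move=> h [mh [c [c0 hc]]].
  have bh : @bmeas _ T2 R setT (h \o @swap_pt R).
    split; first exact: measurableT_comp mh measurable_swap.
    by exists c; split => // z _; exact: hc.
  rewrite fE//; have [_ E] := integral_swap (integrable_mul_bmeas intf bh).
  rewrite -E; apply: eq_Rintegral => z _ /=.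
  by rewrite /swap_pt /= -surjective_pairing.
Qed.

Lemma has_density_sheet k g1 g2 t dx dy x (a : R) : 0 < t -> t <= dx -> t <= dy ->
  (a = x.1 + dx / 2 \/ a = x.1 - dx / 2) ->
  bmeas (@ball_box R) k -> bmeas (@ball_box R) g1 -> bmeas (@ball_box R) g2 -> nonsingular t g1 ->
  (forall z, (@ball_box R) z -> `|g1 z| <= 1 /\ `|g2 z| <= 1) ->
  has_density dx dy x (sheet k g1 g2 t a (x.2 - dy / 2) (x.2 + dy / 2)).
Proof.
move=> t0 tx ty aE bk b1 b2 ns g01.
have [f [intf f0 fE]] : exists f, [/\ mu2.-integrable setT (EFin \o f),
    forall z, f z != 0 -> a - t <= z.1 <= a + t /\ (x.2 - dy / 2) - t <= z.2 <= (x.2 + dy / 2) + t &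
    forall h, @bmeas _ T2 R setT h -> sheet k g1 g2 t a (x.2 - dy / 2) (x.2 + dy / 2) h = \int[mu2]_z (f z * h z)].
  apply: sheet_density => // z Bz; have [H1 H2] := g01 z Bz.
  by rewrite !normrM gtr0_norm// !ler_piMr// ltW.
exists f; split => // z /f0[/andP[z1 z2] /andP[z3 z4]].
by rewrite /near_cell !ler_norml; apply/andP; split; apply/andP; split; case: aE => E; rewrite E in z1 z2; lra.
Qed.

End LocalDensities.

Section Stencils.
#[local] Opaque derive waveW waveZ sin cos pi Rintegral evo sheet.
Context {R : realType}.
Notation mu := (@lebesgue_measure R).
Notation T1 := (measurableTypeR R).
Notation T2 := (measurableTypeR R * measurableTypeR R)%type.
Notation T3 := (T1 * T2)%type.
Notation mu2 := (@lebesgue2 R).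
Notation mu3 := (@lebesgue3 R).
Implicit Types (dx dy t : R) (x : R * R) (phi psi h : R * R -> R) (i j : int)
  (Th : (R * R -> R) -> R * R -> R) (m : int -> int -> R).

Definition stencil dx dy Th m := forall x, exists F,
  [/\ has_density dx dy x F,
    forall psi, test_function psi -> \int[mu2]_(z in icell dx dy x) Th psi z = F psi &
    forall i j, F (\1_(icell dx dy (x.1 + i%:~R * dx, x.2 + j%:~R * dy))) = m i j].

Lemma bmeas_test phi (D : set T2) : test_function phi -> @bmeas _ T2 R D phi.
Proof.
move=> tphi; have [M [M0 HM]] := test_function_bounded tphi; split; last by exists M.
apply: continuous_measurable_plane => y; apply: differentiable_continuous.
by case: tphi => sphi _; exact: (sphi [::]).
Qed.

Lemma bmeas_test_vert phi (a : R) (D : set T1) : test_function phi -> @bmeas _ T1 R D (fun y => phi (a, y)).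
Proof.
move=> tphi; have [mphi [c [c0 phic]]] := bmeas_test setT tphi.
by split; [exact: (measurableT_comp mphi (pair1_measurable a))|exists c; split => // y _; exact: phic].
Qed.

Lemma cell_integral_dX dx dy x phi : 0 < dx -> test_function phi ->
  \int[mu2]_(z in icell dx dy x) dX phi z =
  \int[mu]_(y in `[x.2 - dy / 2, x.2 + dy / 2]) phi (x.1 + dx / 2, y)
  - \int[mu]_(y in `[x.2 - dy / 2, x.2 + dy / 2]) phi (x.1 - dx / 2, y).
Proof.
move=> dx0 tphi; have tx := test_function_dX tphi.
have mI (a b : R) : measurable (`[a, b]%classic : set T1) by exact: measurable_itv.
rewrite (lebesgue2_fubini21 (mI _ _) (mI _ _) (finite_itv _ _) (finite_itv _ _) (bmeas_test _ tx)).
rewrite -(@bRintegralB _ T1 R mu _ (mI _ _) (finite_mu_itv _ _) _ _ (bmeas_test_vert _ _ tphi) (bmeas_test_vert _ _ tphi)).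
apply: eq_Rintegral => y _.
have lt : x.1 - dx / 2 < x.1 + dx / 2 by lra.
have cf : continuous (fun s : R => dX phi (s, y)).
  apply: (continuous_line tx.1); first by move=> s; exact: cvg_id.
  exact: continuous_const.
exact: (Rintegral_FTC lt (fun s => is_derive_fst y s tphi.1) cf).
Qed.

Lemma cell_integral_dY dx dy x phi : 0 < dy -> test_function phi ->
  \int[mu2]_(z in icell dx dy x) dY phi z =
  \int[mu]_(a in `[x.1 - dx / 2, x.1 + dx / 2]) phi (a, x.2 + dy / 2)
  - \int[mu]_(a in `[x.1 - dx / 2, x.1 + dx / 2]) phi (a, x.2 - dy / 2).
Proof.
move=> dy0 tphi.
have mI (a b : R) : measurable (`[a, b]%classic : set T1) by exact: measurable_itv.
have := cell_integral_dX dx (swap_pt x) dy0 (test_function_swap tphi).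
rewrite dX_swap /= => <-.
have b := bmeas_test (icell dx dy x) (test_function_dY tphi).
have b' : @bmeas _ T2 R (icell dy dx (swap_pt x)) (dY phi \o @swap_pt R).
  exact: (bmeas_test _ (test_function_swap (test_function_dY tphi))).
rewrite (lebesgue2_fubini21 (mI _ _) (mI _ _) (finite_itv _ _) (finite_itv _ _) b).
by rewrite (lebesgue2_fubini12 (mI _ _) (mI _ _) (finite_itv _ _) (finite_itv _ _) b').
Qed.

Lemma stencil_swap dx dy Th m : stencil dx dy Th m ->
  (forall psi, test_function psi -> test_function (Th psi)) ->
  stencil dy dx (fun psi => Th (psi \o @swap_pt R) \o @swap_pt R) (fun i j => m j i).
Proof.
move=> st tTh x; have [F [dF EF mF]] := st (swap_pt x).
exists (fun h => F (h \o @swap_pt R)); split.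
- have := has_density_swap dF; by rewrite /swap_pt /= -surjective_pairing.
- move=> psi tpsi; have ts := test_function_swap tpsi; rewrite -EF//.
  have mI (a b : R) : measurable (`[a, b]%classic : set T1) by exact: measurable_itv.
  have b := bmeas_test (icell dy dx x) (test_function_swap (tTh _ ts)).
  have b' := bmeas_test (icell dx dy (swap_pt x)) (tTh _ ts).
  rewrite (lebesgue2_fubini12 (mI _ _) (mI _ _) (finite_itv _ _) (finite_itv _ _) b').
  by rewrite (lebesgue2_fubini21 (mI _ _) (mI _ _) (finite_itv _ _) (finite_itv _ _) b).
- move=> i j; rewrite -mF; congr F; apply/funext => z; rewrite /= !indicE; congr ((nat_of_bool _)%:R).
  by apply/idP/idP => /set_mem[z1 z2]; apply/mem_set.
Qed.

Lemma icell_overlap (x y : R * R) dx dy : 0 < dx -> 0 < dy ->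
  \int[mu2]_(z in icell dx dy x) \1_(icell dx dy y) z =
  Num.max 0 (dx - `|x.1 - y.1|) * Num.max 0 (dy - `|x.2 - y.2|).
Proof.
move=> dx0 dy0; rewrite -!itv_overlap//.
have mI (a b : R) : measurable (`[a, b]%classic : set T1) by exact: measurable_itv.
have bI (D A : set T1) : measurable A -> @bmeas _ T1 R D (\1_A : T1 -> R) by exact: bmeas_indic.
rewrite -(@Rintegral_prod _ _ T1 T1 R mu mu _ _ (mI _ _) (mI _ _) (finite_itv _ _) (finite_itv _ _)); [|exact: bI..].
apply: eq_Rintegral => z _; rewrite !indicE -natrM mulnb; congr ((nat_of_bool _)%:R).
by rewrite /icell in_setX.
Qed.

Lemma stencil_id dx dy : 0 < dx -> 0 < dy ->
  stencil dx dy (fun psi => psi) (fun i j => tri 0 dx 0 i * tri 0 dy 0 j).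
Proof.
move=> dx0 dy0 x; exists (fun h => \int[mu2]_(z in icell dx dy x) h z).
have mC := measurable_icell dx dy x; have fC := finite_icell dx dy x.
split => //.
- exists (\1_(icell dx dy x)); split.
  + have -> : EFin \o (\1_(icell dx dy x) : T2 -> R) = (EFin \o (fun=> 1)) \_ (icell dx dy x).
      apply/funext => z. rewrite patchE /= indicE; by case: ifP.
    apply/(integrable_mkcond (EFin \o (fun=> 1)) mC).
    exact: (bmeas_integrable mC fC (bmeas_cst _ 1)).
  + move=> z; rewrite indicE /near_cell; have [/set_mem[/=]|] := boolP (z \in _); last by rewrite eqxx.
    rewrite !in_itv/= => /andP[? ?] /andP[? ?] _.
    by rewrite !ler_norml; apply/andP; split; apply/andP; split; lra.
  + move=> h bh; rewrite Rintegral_mkcond; apply: eq_Rintegral => z _.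
    by rewrite patchE indicE; case: ifP => _; rewrite ?mul1r ?mul0r.
- move=> i j; rewrite icell_overlap//=.
  have E (a d : R) (l : int) : 0 < d -> Num.max 0 (d - `|a - (a + l%:~R * d)|) = tri 0 d 0 l.
    move=> d0; rewrite opprD addrA subrr tent_tri ?normr0 ?(ltW d0)//.
    by rewrite oppr0 maxxx addr0.
  by rewrite !E.
Qed.

End Stencils.

Section AcousticStencils.
#[local] Opaque derive waveW waveZ sin cos pi Rintegral evo sheet smear.
Context {R : realType}.
Notation mu := (@lebesgue_measure R).
Notation T1 := (measurableTypeR R).
Notation T2 := (measurableTypeR R * measurableTypeR R)%type.
Notation T3 := (T1 * T2)%type.
Notation mu2 := (@lebesgue2 R).
Notation mu3 := (@lebesgue3 R).
Notation one := (fun _ : R => 1 : R).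
Notation idr := (fun s : R => s).
Implicit Types (a b t : R) (x : R * R) (phi psi h : R * R -> R) (i j : int) (k g : T3 -> R).

Lemma ray_one (f : T2 -> R) : ray one f = fun z => f z.2.
Proof. by apply/funext => z; rewrite /ray mul1r. Qed.

Transparent sheet.
Lemma sheet_vert k g1 g2 t a b1 b2 psi : bmeas (@ball_box R) k -> bmeas (@ball_box R) g1 ->
  bmeas (@ball_box R) g2 -> test_function psi ->
  @bmeas _ T1 R `[b1, b2] (fun y => smear mu3 (@ball_box R) k g1 g2 t psi (a, y)) /\
  \int[mu]_(y in `[b1, b2]) smear mu3 (@ball_box R) k g1 g2 t psi (a, y) =
  sheet k g1 g2 t a b1 b2 psi.
Proof.
move=> bk b1' b2' tpsi; split => //; apply: bmeas_test_vert.
exact: (test_function_smear (@measurable_ball_box R) (@finite_ball_box R) b1' b2' t bk tpsi).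
Qed.
Opaque sheet.

Transparent smear.
Lemma smear_swap k g1 g2 t psi x :
  smear mu3 (@ball_box R) k g1 g2 t psi x = smear mu3 (@ball_box R) k g2 g1 t (psi \o @swap_pt R) (swap_pt x).
Proof. by []. Qed.
Opaque smear.

Lemma sheet_horiz k g1 g2 t b a1 a2 psi : bmeas (@ball_box R) k -> bmeas (@ball_box R) g1 ->
  bmeas (@ball_box R) g2 -> test_function psi ->
  @bmeas _ T1 R `[a1, a2] (fun a => smear mu3 (@ball_box R) k g1 g2 t psi (a, b)) /\
  \int[mu]_(a in `[a1, a2]) smear mu3 (@ball_box R) k g1 g2 t psi (a, b) =
  sheet k g2 g1 t b a1 a2 (psi \o @swap_pt R).
Proof.
move=> bk b1' b2' tpsi.
have [H1 H2] := sheet_vert t b a1 a2 bk b2' b1' (test_function_swap tpsi).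
split; first by move: H1; congr (bmeas _ _); apply/funext => a; rewrite smear_swap.
by rewrite -H2; apply: eq_Rintegral => a _; rewrite smear_swap.
Qed.

Let bk : bmeas (@ball_box R) (fun z => sph_weight z.2).
Proof. exact: (bmeas_snd (bmeas_weight _)). Qed.
Let bd : bmeas (@ball_box R) (fun z => dipole z.2).
Proof. exact: (bmeas_snd (bmeas_dipole _)). Qed.
Let br1 := bmeas_ray (@radial_weight1 R) (bmeas_sph1 _).
Let br2 := bmeas_ray (@radial_weight1 R) (bmeas_sph2 _).
Let bi1 := bmeas_ray (@radial_weight_id R) (bmeas_sph1 _).
Let bi2 := bmeas_ray (@radial_weight_id R) (bmeas_sph2 _).

Transparent waveW.
Lemma waveW_ball t phi x : test_function phi -> waveW t phi x =
  t / (2 * pi) * smear mu3 (@ball_box R) (fun z => sph_weight z.2) (ray one (@sph1 R)) (ray one (@sph2 R)) t phi x.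
Proof.
move=> tphi; rewrite !ray_one -(smear_ball t x (bmeas_weight _) (bmeas_sph1 _) (bmeas_sph2 _) tphi).
by [].
Qed.
Opaque waveW.

Lemma waveZ_ball t phi x : test_function phi -> waveZ t (dX phi) x =
  t / (2 * pi) * (smear mu3 (@ball_box R) (fun z => dipole z.2) (ray one (@sph1 R)) (ray one (@sph2 R)) t phi x
   + smear mu3 (@ball_box R) (fun z => dipole z.2) (ray idr (@sph1 R)) (ray idr (@sph2 R)) t phi x).
Proof.
move=> tphi; rewrite dX_waveZ// !ray_one.
by rewrite (smear_ball t x (bmeas_dipole _) (bmeas_sph1 _) (bmeas_sph2 _) tphi).
Qed.

Let mI (a b : R) : measurable (`[a, b]%classic : set T1). Proof. exact: measurable_itv. Qed.

Lemma waveW_sheet t phi a b1 b2 : test_function phi ->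
  \int[mu]_(y in `[b1, b2]) waveW t phi (a, y) = t / (2 * pi) *
    sheet (fun z => sph_weight z.2) (ray one (@sph1 R)) (ray one (@sph2 R)) t a b1 b2 phi.
Proof.
move=> tphi; have [H1 H2] := sheet_vert t a b1 b2 bk br1 br2 tphi.
rewrite -H2 -(@bRintegralZ _ T1 R mu _ (mI _ _) (finite_mu_itv _ _) _ _ H1).
by apply: eq_Rintegral => y _; rewrite waveW_ball.
Qed.

Lemma waveZ_sheet t phi a b1 b2 : test_function phi ->
  \int[mu]_(y in `[b1, b2]) waveZ t (dX phi) (a, y) = t / (2 * pi) *
    (sheet (fun z => dipole z.2) (ray one (@sph1 R)) (ray one (@sph2 R)) t a b1 b2 phi
   + sheet (fun z => dipole z.2) (ray idr (@sph1 R)) (ray idr (@sph2 R)) t a b1 b2 phi).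
Proof.
move=> tphi; have [H1 H2] := sheet_vert t a b1 b2 bd br1 br2 tphi.
have [H3 H4] := sheet_vert t a b1 b2 bd bi1 bi2 tphi.
rewrite -H2 -H4 -(@bRintegralD _ T1 R mu _ (mI _ _) (finite_mu_itv _ _) _ _ H1 H3).
rewrite -(@bRintegralZ _ T1 R mu _ (mI _ _) (finite_mu_itv _ _) _ _ (bmeasD H1 H3)).
by apply: eq_Rintegral => y _; rewrite waveZ_ball.
Qed.

Lemma waveZ_sheet_horiz t phi b a1 a2 : test_function phi ->
  \int[mu]_(a in `[a1, a2]) waveZ t (dX phi) (a, b) = t / (2 * pi) *
    (sheet (fun z => dipole z.2) (ray one (@sph2 R)) (ray one (@sph1 R)) t b a1 a2 (phi \o @swap_pt R)
   + sheet (fun z => dipole z.2) (ray idr (@sph2 R)) (ray idr (@sph1 R)) t b a1 a2 (phi \o @swap_pt R)).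
Proof.
move=> tphi; have [H1 H2] := sheet_horiz t b a1 a2 bd br1 br2 tphi.
have [H3 H4] := sheet_horiz t b a1 a2 bd bi1 bi2 tphi.
rewrite -H2 -H4 -(@bRintegralD _ T1 R mu _ (mI _ _) (finite_mu_itv _ _) _ _ H1 H3).
rewrite -(@bRintegralZ _ T1 R mu _ (mI _ _) (finite_mu_itv _ _) _ _ (bmeasD H1 H3)).
by apply: eq_Rintegral => y _; rewrite waveZ_ball.
Qed.

Section Cfl.
Variables (t dx dy : R).
Hypotheses (t0 : 0 < t) (tx : t <= dx) (ty : t <= dy).
Let dx0 : 0 < dx := lt_le_trans t0 tx.
Let dy0 : 0 < dy := lt_le_trans t0 ty.

Lemma has_density_vert k rho rb x a : radial_weight rho rb -> bmeas (@ball_box R) k ->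
  a = x.1 + dx / 2 \/ a = x.1 - dx / 2 ->
  has_density dx dy x (sheet k (ray rho (@sph1 R)) (ray rho (@sph2 R)) t a (x.2 - dy / 2) (x.2 + dy / 2)).
Proof.
move=> wr bk' aE; have [br r01 rn0 _] := wr.
have n2 (w : T2) : `|sph2 w : R| <= 1 by exact: le_trans (norm_sph2 w) (norm_sin _).
apply: has_density_sheet => //; [exact: (bmeas_ray wr (bmeas_sph1 _))|exact: (bmeas_ray wr (bmeas_sph2 _))| |].
  by apply: nonsingular_sph1 => //; [rewrite gt_eqF|exact: br.1].
move=> z Bz; have [_ H1] := norm_ray wr (@norm_sph1 R) Bz; have [_ H2] := norm_ray wr n2 Bz.
by split.
Qed.

Lemma has_density_horiz k rho rb x b : radial_weight rho rb -> bmeas (@ball_box R) k ->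
  b = x.2 + dy / 2 \/ b = x.2 - dy / 2 ->
  has_density dx dy x (fun h => sheet k (ray rho (@sph2 R)) (ray rho (@sph1 R)) t b
    (x.1 - dx / 2) (x.1 + dx / 2) (h \o @swap_pt R)).
Proof.
move=> wr bk' bE; have [br r01 rn0 _] := wr.
have n2 (w : T2) : `|sph2 w : R| <= 1 by exact: le_trans (norm_sph2 w) (norm_sin _).
rewrite [x]surjective_pairing -[(x.1, x.2)]/(swap_pt (x.2, x.1)).
apply: (has_density_swap (F := sheet k (ray rho (@sph2 R)) (ray rho (@sph1 R)) t b
    ((x.2, x.1).2 - dx / 2) ((x.2, x.1).2 + dx / 2))).
apply: has_density_sheet => //; [exact: (bmeas_ray wr (bmeas_sph2 _))|exact: (bmeas_ray wr (bmeas_sph1 _))| |].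
  by apply: nonsingular_sph2 => //; [rewrite gt_eqF|exact: br.1].
move=> z Bz; have [_ H1] := norm_ray wr (@norm_sph1 R) Bz; have [_ H2] := norm_ray wr n2 Bz.
by split.
Qed.

Lemma triZ_diff (a N P : R) i : a * tri 0 N P i + (- a) * tri 0 N P (i + 1) = a * tri (- N) (N - P) P i.
Proof. by rewrite mulNr -mulrBr tri_diff. Qed.

Lemma scaled_difference (a u v u' v' : R) :
  a * (u + v) - a * (u' + v') = a * (1 * u + 1 * v) + - a * (1 * u' + 1 * v').
Proof. by ring. Qed.

Lemma pair_triZ_diff (a N P N' P' : R) i :
  a * (1 * tri 0 N P i + 1 * tri 0 N' P' i) + - a * (1 * tri 0 N P (i + 1) + 1 * tri 0 N' P' (i + 1)) =
  a * tri (- (N + N')) (N + N' - (P + P')) (P + P') i.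
Proof.
rewrite !mul1r mulNr -mulrBr opprD addrACA !tri_diff /tri; congr (_ * _).
by (case: (i == 1); [|case: (i == 0); [|case: (i == -1)]]); ring.
Qed.

Lemma stencil_WX : stencil dx dy (fun psi => waveW t (dX psi))
  (fun i j => tri (-1) 0 1 i * tri (t ^+ 2 / 8) (t * dy / 2 - t ^+ 2 / 4) (t ^+ 2 / 8) j).
Proof.
move=> x; pose S a := sheet (fun z => sph_weight z.2) (ray one (@sph1 R)) (ray one (@sph2 R)) t a
  (x.2 - dy / 2) (x.2 + dy / 2).
exists (fun h => t / (2 * pi) * S (x.1 + dx / 2) h + - (t / (2 * pi)) * S (x.1 - dx / 2) h); split.
- apply: has_density_lin; apply: (has_density_vert (@radial_weight1 R) bk); by [left|right].
- move=> psi tpsi; rewrite -(partial_waveW t [:: true] tpsi).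
  have := cell_integral_dX dy x dx0 (test_function_waveW t tpsi); rewrite !waveW_sheet// -/(S _) => E.
  by rewrite mulNr; exact: E.
- move=> i j.
  have bs := bmeas_sin1 (`[0, pi] : set T1).
  have E1 := @right_sheet_mass R one 1 t dx dy (@radial_weight1 R) t0 tx ty sin 1 1 (pi / 4) (pi / 4) x i j
    (fun b e => e) bs (@half_sin R) (@half_sin_sin R).
  have E2 := @left_sheet_mass R one 1 t dx dy (@radial_weight1 R) t0 tx ty sin 1 1 (pi / 4) (pi / 4) x i j
    (fun b e => e) bs (@half_sin R) (@half_sin_sin R).
  rewrite /S E1 E2 triZ_diff /wedge_row /tri; have := lt0r_neq0 (pi_gt0 R); move: (pi : R) => p p0.
  by (case: (i == 1); [|case: (i == 0); [|case: (i == -1)]]);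
    (case: (j == 1); [|case: (j == 0); [|case: (j == -1)]]); field.
Qed.

Lemma stencil_ZXX : stencil dx dy (fun psi => waveZ t (dX (dX psi)))
  (fun i j => tri 1 (- 2) 1 i *
     tri (t ^+ 2 / (4 * pi)) (t / (2 * pi) * (pi * dy - t)) (t ^+ 2 / (4 * pi)) j).
Proof.
move=> x; pose S rho a := sheet (fun z => dipole z.2) (ray rho (@sph1 R)) (ray rho (@sph2 R)) t a
  (x.2 - dy / 2) (x.2 + dy / 2).
pose c : R := t / (2 * pi).
exists (fun h => c * (1 * S one (x.1 + dx / 2) h + 1 * S idr (x.1 + dx / 2) h)
   + - c * (1 * S one (x.1 - dx / 2) h + 1 * S idr (x.1 - dx / 2) h)); split.
- have D rho rb (w : radial_weight rho rb) a aE : has_density dx dy x (S rho a) :=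
    has_density_vert w bd aE.
  have [w1 wi] := (@radial_weight1 R, @radial_weight_id R).
  have up := or_introl (erefl (x.1 + dx / 2)) : x.1 + dx / 2 = x.1 + dx / 2 \/ x.1 + dx / 2 = x.1 - dx / 2.
  have dn := or_intror (erefl (x.1 - dx / 2)) : x.1 - dx / 2 = x.1 + dx / 2 \/ x.1 - dx / 2 = x.1 - dx / 2.
  exact: (has_density_lin c (- c) (has_density_lin 1 1 (D _ _ w1 _ up) (D _ _ wi _ up))
    (has_density_lin 1 1 (D _ _ w1 _ dn) (D _ _ wi _ dn))).
- move=> psi tpsi; rewrite -(partial_waveZ t [:: true] (test_function_dX tpsi)).
  have := cell_integral_dX dy x dx0 (test_function_waveZ t (test_function_dX tpsi)).
  move=> E; apply: (etrans E); apply: etrans (scaled_difference _ _ _ _ _).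
  exact: (congr2 (fun a b : R => a - b) (waveZ_sheet t (x.1 + dx / 2) (x.2 - dy / 2) (x.2 + dy / 2) tpsi)
    (waveZ_sheet t (x.1 - dx / 2) (x.2 - dy / 2) (x.2 + dy / 2) tpsi)).
- move=> i j.
  have bs : @bmeas _ T1 R `[0, pi] (fun b => sin b * cos b) := bmeasM (bmeas_sin1 _) (bmeas_cos1 _).
  have s0 (b : R) : sin b = 0 -> sin b * cos b = 0 by move=> ->; rewrite mul0r.
  have E1 := @right_sheet_mass R one 1 t dx dy (@radial_weight1 R) t0 tx ty _ _ _ _ _ x i j
    s0 bs (@half_dipole R) (@half_dipole_sin R).
  have E2 := @left_sheet_mass R one 1 t dx dy (@radial_weight1 R) t0 tx ty _ _ _ _ _ x i j
    s0 bs (@half_dipole R) (@half_dipole_sin R).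
  have E3 := @right_sheet_mass R idr _ t dx dy (@radial_weight_id R) t0 tx ty _ _ _ _ _ x i j
    s0 bs (@half_dipole R) (@half_dipole_sin R).
  have E4 := @left_sheet_mass R idr _ t dx dy (@radial_weight_id R) t0 tx ty _ _ _ _ _ x i j
    s0 bs (@half_dipole R) (@half_dipole_sin R).
  rewrite /S E1 E2 E3 E4 (pair_triZ_diff c) /c /wedge_row /tri.
  have := lt0r_neq0 (pi_gt0 R); move: (pi : R) => p p0.
  by (case: (i == 1); [|case: (i == 0); [|case: (i == -1)]]);
    (case: (j == 1); [|case: (j == 0); [|case: (j == -1)]]); field.
Qed.

Lemma stencil_ZYX : stencil dx dy (fun psi => waveZ t (dY (dX psi)))
  (fun i j => tri (- (t ^+ 2 / 8)) 0 (t ^+ 2 / 8) i * tri (-1) 0 1 j).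
Proof.
move=> x; pose S rho b h := sheet (fun z => dipole z.2) (ray rho (@sph2 R)) (ray rho (@sph1 R)) t b
  (x.1 - dx / 2) (x.1 + dx / 2) (h \o @swap_pt R).
pose c : R := t / (2 * pi).
exists (fun h => c * (1 * S one (x.2 + dy / 2) h + 1 * S idr (x.2 + dy / 2) h)
   + - c * (1 * S one (x.2 - dy / 2) h + 1 * S idr (x.2 - dy / 2) h)); split.
- have D rho rb (w : radial_weight rho rb) a aE : has_density dx dy x (S rho a) :=
    has_density_horiz w bd aE.
  have [w1 wi] := (@radial_weight1 R, @radial_weight_id R).
  have up := or_introl (erefl (x.2 + dy / 2)) : x.2 + dy / 2 = x.2 + dy / 2 \/ x.2 + dy / 2 = x.2 - dy / 2.
  have dn := or_intror (erefl (x.2 - dy / 2)) : x.2 - dy / 2 = x.2 + dy / 2 \/ x.2 - dy / 2 = x.2 - dy / 2.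
  exact: (has_density_lin c (- c) (has_density_lin 1 1 (D _ _ w1 _ up) (D _ _ wi _ up))
    (has_density_lin 1 1 (D _ _ w1 _ dn) (D _ _ wi _ dn))).
- move=> psi tpsi; rewrite -(partial_waveZ t [:: false] (test_function_dX tpsi)).
  have := cell_integral_dY dx x dy0 (test_function_waveZ t (test_function_dX tpsi)).
  move=> E; apply: (etrans E); apply: etrans (scaled_difference _ _ _ _ _).
  exact: (congr2 (fun a b : R => a - b) (waveZ_sheet_horiz t (x.2 + dy / 2) (x.1 - dx / 2) (x.1 + dx / 2) tpsi)
    (waveZ_sheet_horiz t (x.2 - dy / 2) (x.1 - dx / 2) (x.1 + dx / 2) tpsi)).
- move=> i j.
  have I : \1_(icell dx dy (x.1 + i%:~R * dx, x.2 + j%:~R * dy)) \o @swap_pt R =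
      \1_(icell dy dx (x.2 + j%:~R * dy, x.1 + i%:~R * dx)) :> (T2 -> R).
    apply/funext => z; rewrite /= !indicE; congr ((nat_of_bool _)%:R).
    by apply/idP/idP => /set_mem[z1 z2]; apply/mem_set.
  rewrite /S I.
  have E1 := @top_sheet_mass R one 1 t dx dy (@radial_weight1 R) t0 tx ty x i j.
  have E2 := @bottom_sheet_mass R one 1 t dx dy (@radial_weight1 R) t0 tx ty x i j.
  have E3 := @top_sheet_mass R idr _ t dx dy (@radial_weight_id R) t0 tx ty x i j.
  have E4 := @bottom_sheet_mass R idr _ t dx dy (@radial_weight_id R) t0 tx ty x i j.
  rewrite E1 E2 E3 E4 (pair_triZ_diff c) /c /dipole_row /tri.
  have := lt0r_neq0 (pi_gt0 R); move: (pi : R) => p p0.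
  by (case: (i == 1); [|case: (i == 0); [|case: (i == -1)]]);
    (case: (j == 1); [|case: (j == 0); [|case: (j == -1)]]); field.
Qed.

End Cfl.
End AcousticStencils.

Section VerticalStencils.
#[local] Opaque derive waveW waveZ sin cos pi Rintegral evo sheet smear.
Context {R : realType}.
Notation mu := (@lebesgue_measure R).
Notation T1 := (measurableTypeR R).
Notation T2 := (measurableTypeR R * measurableTypeR R)%type.
Notation mu2 := (@lebesgue2 R).
Implicit Types (dx dy t : R) (x : R * R) (phi psi h : R * R -> R) (i j : int)
  (Th : (R * R -> R) -> R * R -> R) (m : int -> int -> R).

Lemma stencil_ext dx dy Th Th' m m' : stencil dx dy Th m ->
  (forall psi, test_function psi -> Th psi = Th' psi) -> (forall i j, m i j = m' i j) ->
  stencil dx dy Th' m'.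
Proof.
move=> st eT em x; have [F [dF EF mF]] := st x; exists F; split => //.
  by move=> psi tpsi; rewrite -eT// EF.
by move=> i j; rewrite mF em.
Qed.

Section Cfl.
Variables (t dx dy : R).
Hypotheses (t0 : 0 < t) (tx : t <= dx) (ty : t <= dy).

Lemma stencil_WY : stencil dx dy (fun psi => waveW t (dY psi))
  (fun i j => tri (t ^+ 2 / 8) (t * dx / 2 - t ^+ 2 / 4) (t ^+ 2 / 8) i * tri (-1) 0 1 j).
Proof.
apply: (stencil_ext (stencil_swap (stencil_WX t0 ty tx) _)).
- by move=> psi tpsi; apply: test_function_waveW; exact: test_function_dX.
- move=> psi tpsi; apply/funext => z /=; rewrite dX_swap.
  exact: (waveW_swap z (test_function_dY tpsi) (ltW t0)).
- by move=> i j; exact: mulrC.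
Qed.

Lemma stencil_ZYY : stencil dx dy (fun psi => waveZ t (dY (dY psi)))
  (fun i j => tri (t ^+ 2 / (4 * pi)) (t / (2 * pi) * (pi * dx - t)) (t ^+ 2 / (4 * pi)) i
     * tri 1 (- 2) 1 j).
Proof.
apply: (stencil_ext (stencil_swap (stencil_ZXX t0 ty tx) _)).
- by move=> psi tpsi; apply: test_function_waveZ; do 2 apply: test_function_dX.
- move=> psi tpsi; apply/funext => z /=; rewrite dX_swap dX_swap.
  exact: (waveZ_swap z (test_function_dY (test_function_dY tpsi)) (ltW t0)).
- by move=> i j; exact: mulrC.
Qed.

Lemma stencil_ZXY : stencil dx dy (fun psi => waveZ t (dX (dY psi)))
  (fun i j => tri (-1) 0 1 i * tri (- (t ^+ 2 / 8)) 0 (t ^+ 2 / 8) j).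
Proof.
apply: (stencil_ext (stencil_swap (stencil_ZYX t0 ty tx) _)).
- by move=> psi tpsi; apply: test_function_waveZ; apply: test_function_dY; exact: test_function_dX.
- move=> psi tpsi; apply/funext => z /=; rewrite dX_swap dY_swap.
  exact: (waveZ_swap z (test_function_dX (test_function_dY tpsi)) (ltW t0)).
- by move=> i j; exact: mulrC.
Qed.

End Cfl.

Lemma stencil_density dx dy Th m x : stencil dx dy Th m -> exists f, [/\
  mu2.-integrable setT (EFin \o f), forall z, f z != 0 -> near_cell dx dy x z,
  forall psi, test_function psi -> \int[mu2]_(z in icell dx dy x) Th psi z = \int[mu2]_z (f z * psi z) &
  forall i j, \int[mu2]_(z in icell dx dy (x.1 + i%:~R * dx, x.2 + j%:~R * dy)) f z = m i j].
Proof.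
move=> /(_ x)[F [[f [intf f0 fE]] EF mF]]; exists f; split => //.
- by move=> psi tpsi; rewrite EF// fE//; exact: bmeas_test.
- move=> i j; rewrite -mF fE; last by apply: bmeas_indic; exact: measurable_icell.
  rewrite Rintegral_mkcond; apply: eq_Rintegral => z _.
  by rewrite patchE indicE; case: ifP => _; rewrite ?mulr1 ?mulr0.
Qed.

Definition hcell dx dy x : set T2 :=
  `[x.1 - dx / 2, x.1 + dx / 2[ `*` `[x.2 - dy / 2, x.2 + dy / 2[.

Lemma measurable_hcell dx dy x : measurable (hcell dx dy x).
Proof. by apply: measurableX; exact: measurable_itv. Qed.

Lemma integral_hcell dx dy x phi : test_function phi ->
  \int[mu2]_(z in hcell dx dy x) phi z = \int[mu2]_(z in icell dx dy x) phi z.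
Proof.
move=> tphi.
have fo (a b : R) : (mu `[a, b[ < +oo)%E.
  by rewrite lebesgue_measure_itv/=; case: ifP => // _; rewrite -EFinB ltry.
have mo (a b : R) : measurable (`[a, b[%classic : set T1) by exact: measurable_itv.
have mI (a b : R) : measurable (`[a, b]%classic : set T1) by exact: measurable_itv.
have int (a b c : R) : mu.-integrable `[a, b[ (EFin \o (fun y => phi (c, y))).
  have [mp [M [_ pM]]] := bmeas_test_vert c setT tphi.
  exact: (@bounded_integrable _ T1 R mu _ (mo a b) (fo a b) _ M mp (fun y _ => pM y I)).
have int' (a b c : R) : mu.-integrable `[a, b[ (EFin \o (fun y => phi (y, c))).
  have [mp [M [_ pM]]] := bmeas_test_vert c setT (test_function_swap tphi).
  exact: (@bounded_integrable _ T1 R mu _ (mo a b) (fo a b) _ M mp (fun y _ => pM y I)).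
have b D := bmeas_test D tphi.
rewrite /hcell (lebesgue2_fubini12 (mo _ _) (mo _ _) (fo _ _) (fo _ _) (b _)).
under eq_Rintegral do rewrite Rintegral_itv_bndo_bndc//.
rewrite -(lebesgue2_fubini12 (mo _ _) (mI _ _) (fo _ _) (finite_itv _ _) (b _)).
rewrite (lebesgue2_fubini21 (mo _ _) (mI _ _) (fo _ _) (finite_itv _ _) (b _)).
under eq_Rintegral do rewrite Rintegral_itv_bndo_bndc//.
by rewrite -(lebesgue2_fubini21 (mI _ _) (mI _ _) (finite_itv _ _) (finite_itv _ _) (b _)).
Qed.

Lemma lebesgue_translation (c : R) (A : set R) : measurable (A : set T1) ->
  mu ((fun s : R => c + s) @^-1` A) = mu A.
Proof.
move=> mA; have mt : @measurable_fun _ _ T1 T1 setT (fun s : R => c + s).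
  by apply: measurable_funD => //; exact: measurable_id.
apply/esym; apply: (@lebesgue_measure_unique R
  (measure_function_pushforward__canonical__measure_function_Measure mu mt)) => // _ [[a b]] _ <-.
rewrite /= /pushforward.
rewrite (_ : _ @^-1` _ = `]a - c, b - c]%classic); last first.
  by apply/seteqP; split => z /=; rewrite !in_itv/= => /andP[? ?]; apply/andP; split; lra.
rewrite !lebesgue_measure_itv/= !lte_fin ltrD2r.
by case: ifP => // _; rewrite -!EFinB; congr EFin; ring.
Qed.

Lemma measurable_translation x : @measurable_fun _ _ T2 T2 setT (fun s => (x.1 + s.1, x.2 + s.2)).
Proof.
apply: measurable_fun_pair; apply: measurable_funD => //.
Qed.

Lemma lebesgue2_translation x (A : set T2) : measurable A ->
  mu2 ((fun s => (x.1 + s.1, x.2 + s.2)) @^-1` A) = mu2 A.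
Proof.
move=> mA; apply/esym.
apply: (@product_measure_unique _ _ T1 T1 R mu mu
  (measure_function_pushforward__canonical__measure_function_Measure mu2 (measurable_translation x))) => //.
move=> B C mB mC; rewrite /= /pushforward.
rewrite (_ : _ @^-1` _ = ((fun s : R => x.1 + s) @^-1` B) `*` ((fun s : R => x.2 + s) @^-1` C)).
  have mt (c : R) : @measurable_fun _ _ T1 T1 setT (fun s : R => c + s).
    by apply: measurable_funD => //; exact: measurable_id.
  rewrite -(lebesgue_translation x.1 mB) -(lebesgue_translation x.2 mC).
  exact: (product_measure1E mu mu (measurable_preimage (mt _) mB) (measurable_preimage (mt _) mC)).
by apply/seteqP; split => z [].
Qed.

Lemma cell_averageE dx dy x (f : R * R -> R) : mu2.-integrable setT (EFin \o (f \_ (icell dx dy x))) ->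
  cell_average dx dy f x = 1 / (dx * dy) * \int[mu2]_(z in icell dx dy x) f z.
Proof.
move=> intf; rewrite /cell_average; congr (_ * _).
have [_ E] := integral_measure_preserving (measurable_translation x) (lebesgue2_translation x) intf.
rewrite [RHS]Rintegral_mkcond -E [LHS]Rintegral_mkcond; apply: eq_Rintegral => s _.
rewrite !patchE (_ : (_ \in icell _ _ _) = (s \in `[- (dx / 2), dx / 2] `*` `[- (dy / 2), dy / 2]))//.
apply/idP/idP => /set_mem[/=]; rewrite !in_itv/= => /andP[? ?] /andP[? ?];
  apply/mem_set; split; rewrite /= in_itv/=; apply/andP; split; lra.
Qed.

End VerticalStencils.

(** * Reconstructed grid functions *)

Section Grid.
#[local] Opaque derive waveW waveZ sin cos pi Rintegral evo sheet smear.
Context {R : realType}.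
Notation mu := (@lebesgue_measure R).
Notation T1 := (measurableTypeR R).
Notation T2 := (measurableTypeR R * measurableTypeR R)%type.
Notation mu2 := (@lebesgue2 R).
Implicit Types (z : R * R) (i j : int) (p : int * int).

Variables (x0 : R * R) (dx dy : R).
Hypotheses (dx0 : 0 < dx) (dy0 : 0 < dy).

Definition cell_index z : int * int :=
  (Num.floor ((z.1 - x0.1) / dx + 1 / 2), Num.floor ((z.2 - x0.2) / dy + 1 / 2)).

Notation center p := (cell_center x0 dx dy p.1 p.2).

Lemma floor_cell (a b d : R) i : 0 < d -> (Num.floor ((a - b) / d + 1 / 2) == i) =
  (a \in `[b + i%:~R * d - d / 2, b + i%:~R * d + d / 2[).
Proof.
move=> d0; rewrite floor_eq intrD in_itv/=; move: (i%:~R : R) => k.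
rewrite -lerBlDr -ltrBrDr ler_pdivlMr// ltr_pdivrMr//.
by congr (_ && _); apply/idP/idP; nra.
Qed.

Lemma cell_index_hcell z p : (cell_index z == p) = (z \in hcell dx dy (center p)).
Proof.
case: p => i j; rewrite /cell_index xpair_eqE !floor_cell// /hcell in_setX.
by rewrite !mem_setE.
Qed.

Lemma near_cell_index p z : near_cell dx dy (center p) z ->
  (`|p.1 - (cell_index z).1|%N <= 2)%N /\ (`|p.2 - (cell_index z).2|%N <= 2)%N.
Proof.
have := eqxx (cell_index z); rewrite cell_index_hcell => /set_mem[/=].
rewrite !in_itv/= => /andP[a1 a2] /andP[a3 a4] /andP[].
rewrite !ler_norml /cell_center/= => /andP[b1 b2] /andP[b3 b4].
have aux (d a b : R) (k l : int) : 0 < d -> b + l%:~R * d - d / 2 <= a -> a < b + l%:~R * d + d / 2 ->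
    - (3 / 2 * d) <= a - (b + k%:~R * d) -> a - (b + k%:~R * d) <= 3 / 2 * d ->
    (`|k - l|%N <= 2)%N.
  move=> d0 h1 h2 h3 h4.
  have H1 : ((k - l)%:~R : R) <= 2%:~R by rewrite intrB; nra.
  have H2 : ((-2)%:~R : R) <= (k - l)%:~R by rewrite intrB mulrNz; nra.
  by move: H1 H2; rewrite !ler_int; exact: absz_le2.
by split; [apply: (aux dx z.1 x0.1)|apply: (aux dy z.2 x0.2)].
Qed.

Definition level z : nat := (`|(cell_index z).1| + `|(cell_index z).2| + 2)%N.

Lemma level_bounded (r : R) : exists M : nat, forall z, `|z.1| <= r -> `|z.2| <= r -> (level z <= M)%N.
Proof.
have aux (b d : R) : 0 < d -> exists M : nat, forall a : R, `|a| <= r ->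
    (`|Num.floor ((a - b) / d + 1 / 2)|%N <= M)%N.
  move=> d0; exists (Num.truncn ((r + `|b|) / d + 2)).+1 => a ar.
  set y := (a - b) / d + 1 / 2; have /andP[f1 f2] := floor_itv y.
  have yB : `|y| <= (r + `|b|) / d + 1 / 2.
    rewrite (le_trans (ler_normD _ _))// lerD//; last by rewrite ger0_norm.
    have dV : 0 <= d^-1 by rewrite invr_ge0 ltW.
    rewrite normrM (ger0_norm dV) ler_wpM2r//.
    by rewrite (le_trans (ler_normB _ _))// lerD.
  rewrite -(ler_nat R) natr_absz.
  have := truncnS_gt ((r + `|b|) / d + 2); set M := (_.+1%:R : R).
  move: f1 f2 yB; rewrite intrD ler_norml intr_norm.
  move: ((Num.floor y)%:~R : R) ((r + `|b|) / d) => k q f1 f2 /andP[y1 y2] qM.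
  by rewrite ler_norml; apply/andP; split; lra.
have [M1 H1] := aux x0.1 dx dx0; have [M2 H2] := aux x0.2 dy dy0.
exists (M1 + M2 + 2)%N => z z1 z2; rewrite /level leq_add2r leq_add//; [exact: H1|exact: H2].
Qed.

End Grid.

Section GridAverages.
#[local] Opaque derive waveW waveZ sin cos pi Rintegral evo sheet smear.
Context {R : realType}.
Notation mu := (@lebesgue_measure R).
Notation T1 := (measurableTypeR R).
Notation T2 := (measurableTypeR R * measurableTypeR R)%type.
Notation mu2 := (@lebesgue2 R).
Implicit Types (z : R * R) (i j : int) (p : int * int) (L : (R * R -> R) -> R).

(* [f] agrees with an integrable function on every box, which makes the class
   of such [f] stable under sums. *)
Definition has_grid_average x0 dx dy L (avg : int -> int -> R) := exists f : T2 -> R, [/\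
  measurable_fun setT f,
  forall r : R, exists2 g : T2 -> R, mu2.-integrable setT (EFin \o g) &
    forall z, `|z.1| <= r -> `|z.2| <= r -> f z = g z,
  forall psi, test_function psi -> L psi = distr_of_fun f psi &
  forall i j, cell_average dx dy f (cell_center x0 dx dy i j) = avg i j].

Definition conv3 (a b c : R) (f : int -> R) i : R := c * f (i - 1) + (b * f i + a * f (i + 1)).

Lemma level_index (i j k l : int) : (`|k - i|%N <= 2)%N -> (`|l - j|%N <= 2)%N ->
  (`|k|%N <= `|i| + `|j| + 2)%N && (`|l|%N <= `|i| + `|j| + 2)%N.
Proof. by move=> *; apply/andP; split; lia. Qed.

Lemma tri_sub1 (a b c : R) i : tri a b c (i - (i - 1)) = c.
Proof. by rewrite opprB addrCA subrr addr0. Qed.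

Lemma tri_sub0 (a b c : R) i : tri a b c (i - i) = b.
Proof. by rewrite subrr. Qed.

Lemma tri_subN1 (a b c : R) i : tri a b c (i - (i + 1)) = a.
Proof. by rewrite opprD addNKr. Qed.

Lemma tri_sub_far (a b c : R) i k : k != i - 1 -> k != i -> k != i + 1 -> tri a b c (i - k) = 0.
Proof.
by rewrite /tri => k1 k0 k2; rewrite !ifF//; apply/negbTE; move: k0 k1 k2; lia.
Qed.

Lemma sum_tri (a b c : R) N i (g : int -> R) : (`|i|.+1 <= N)%N ->
  \sum_(k <- irange N) g k * tri a b c (i - k) = conv3 a b c g i.
Proof.
move=> iN; rewrite (sum_irange3 iN).
  by rewrite tri_sub1 tri_sub0 tri_subN1 /conv3 mulrC [g i * _]mulrC [g (i + 1) * _]mulrC.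
by move=> k k1 k0 k2; rewrite tri_sub_far// mulr0.
Qed.

Lemma integrable_scale (c : R) (f : T2 -> R) : mu2.-integrable setT (EFin \o f) ->
  mu2.-integrable setT (EFin \o (fun z => c * f z)).
Proof.
move=> intf; have := integrable_mul_bmeas intf (@bmeas_cst _ T2 R setT c).
by congr (_.-integrable _ _); apply/funext => z /=; rewrite mulrC.
Qed.

Lemma integrable_restrict (f : T2 -> R) (D : set T2) : measurable D ->
  mu2.-integrable setT (EFin \o f) -> mu2.-integrable D (EFin \o f).
Proof. by move=> mD; apply: integrableS. Qed.

Lemma integrable_patch (f : T2 -> R) (D : set T2) : measurable D ->
  mu2.-integrable D (EFin \o f) -> mu2.-integrable setT (EFin \o (f \_ D)).
Proof.
move=> mD intf; rewrite (_ : EFin \o _ = (EFin \o f) \_ D).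
  by apply/(integrable_mkcond (EFin \o f) mD).
by apply/funext => z; rewrite /= !patchE; case: ifP.
Qed.

Lemma compact_measurable_plane (K : set (R * R)) : compact K -> measurable (K : set T2).
Proof.
move=> cK; rewrite -[K]setCK; apply: measurableC; apply: open_measurable_plane.
by apply: closed_openC; apply: compact_closed => //; exact: norm_hausdorff.
Qed.

Lemma compact_in_box (K : set (R * R)) : compact K ->
  exists r : R, forall z, K z -> `|z.1| <= r /\ `|z.2| <= r.
Proof.
move=> /compact_bounded[r [_ Hr]]; exists (r + 1) => z Kz.
have := Hr (r + 1) _ z Kz; rewrite ltrDl ltr01 => /(_ isT).
by rewrite /= norm_le_box => /andP.
Qed.

Lemma test_function_box psi : test_function psi ->
  exists r : R, forall z, psi z != 0 -> `|z.1| <= r /\ `|z.2| <= r.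
Proof.
move=> /test_functionP[_ [r Hr]]; exists r => z nz.
have : ~~ (r < `|z|) by apply/negP => /Hr/eqP; rewrite (negbTE nz).
by rewrite -leNgt norm_le_box => /andP.
Qed.

Lemma itv_norm (a b r : R) : b - r <= a <= b + r -> `|a| <= `|b| + r.
Proof.
move=> ab; rewrite -[a](subrK b) addrC (le_trans (ler_normD _ _))// lerD2l.
by rewrite ler_distl.
Qed.

Lemma level_max1 (M : nat) (i j : int) : (`|i|.+1 <= maxn M (`|i| + `|j| + 1))%N.
Proof. by lia. Qed.

Lemma level_max2 (M : nat) (i j : int) : (`|j|.+1 <= maxn M (`|i| + `|j| + 1))%N.
Proof. by lia. Qed.

Lemma icell_in_box dx dy x : exists r : R, forall z, icell dx dy x z -> `|z.1| <= r /\ `|z.2| <= r.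
Proof.
exists (`|x.1| + dx / 2 + (`|x.2| + dy / 2)) => z [/=]; rewrite !in_itv/= => h1 h2.
have h1' := itv_norm h1; have h2' := itv_norm h2.
have n1 : 0 <= `|x.1| + dx / 2 by exact: le_trans (normr_ge0 _) h1'.
have n2 : 0 <= `|x.2| + dy / 2 by exact: le_trans (normr_ge0 _) h2'.
by split; [rewrite (le_trans h1')// lerDl|rewrite (le_trans h2')// lerDr].
Qed.

Lemma recon_stencil x0 dx dy Th (a1 a2 a3 b1 b2 b3 : R) (w : int -> int -> R) :
  0 < dx -> 0 < dy ->
  stencil dx dy Th (fun i j => tri a1 a2 a3 i * tri b1 b2 b3 j) ->
  (forall psi, test_function psi -> test_function (Th psi)) ->
  has_grid_average x0 dx dy (fun psi => distr_of_fun (recon x0 dx dy w) (Th psi))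
    (fun i j => 1 / (dx * dy) * conv3 a1 a2 a3 (fun k => conv3 b1 b2 b3 (w k) j) i).
Proof.
move=> dx0 dy0 st tTh.
have [f Hf] := choice (fun p => stencil_density (cell_center x0 dx dy p.1 p.2) st).
pose S N z := \sum_(p <- ibox N) w p.1 p.2 * f p z.
pose lev := level x0 dx dy.
have S_stable z N : (lev z <= N)%N -> S N z = S (lev z) z.
  move=> zN; apply: big_subseq0; [exact: uniq_ibox|exact: uniq_ibox| |].
    move=> p; rewrite !mem_ibox => /andP[p1 p2].
    by rewrite (leq_trans p1)// (leq_trans p2).
  move=> p; rewrite mem_ibox => np.
  have [->|nz] := eqVneq (f p z) 0; first by rewrite mulr0.
  have [_ near _ _] := Hf p; have [n1 n2] := near_cell_index dx0 dy0 (near _ nz).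
  by exfalso; move/negP: np; apply; rewrite /lev /level; exact: level_index.
pose F z := S (lev z) z.
have inth p : mu2.-integrable setT (EFin \o (fun z => w p.1 p.2 * f p z)).
  by have [intf _ _ _] := Hf p; exact: integrable_scale.
have intS N : mu2.-integrable setT (EFin \o S N).
  exact: (Rintegral_bigsum (ibox N) measurableT inth).1.
have mS N : measurable_fun setT (S N : T2 -> R).
  by apply/measurable_EFinP; exact: (measurable_int mu2 (intS N)).
have mF : measurable_fun setT (F : T2 -> R).
  apply: (@measurable_fun_cvg _ T2 R setT S) => // z _.
  by apply: cvg_near_cst; exists (lev z) => // N /= zN; exact: S_stable.
have Fbox (r : R) : exists M, forall z, `|z.1| <= r -> `|z.2| <= r -> S M z = F z /\ (lev z <= M)%N.
  have [M HM] := level_bounded x0 dx0 dy0 r; exists M => z z1 z2.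
  by split; [apply: S_stable|]; exact: HM.
exists F; split.
- exact: mF.
- by move=> r; have [M HM] := Fbox r; exists (S M) => // z z1 z2; rewrite (HM z z1 z2).1.
- move=> psi tpsi; have tT := tTh _ tpsi; rewrite /distr_of_fun.
  have [r1 Hr1] := test_function_box tT; have [M1 HM1] := Fbox r1.
  have [r2 Hr2] := test_function_box tpsi; have [M2 HM2] := Fbox r2.
  pose M := maxn M1 M2.
  transitivity (\sum_(p <- ibox M) w p.1 p.2 * \int[mu2]_(z in hcell dx dy (cell_center x0 dx dy p.1 p.2)) Th psi z).
    pose g p z := w p.1 p.2 * (Th psi \_ (hcell dx dy (cell_center x0 dx dy p.1 p.2))) z.
    have mh p := measurable_hcell dx dy (cell_center x0 dx dy p.1 p.2).
    have intg p : mu2.-integrable setT (EFin \o ((Th psi) \_ (hcell dx dy (cell_center x0 dx dy p.1 p.2)))).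
      apply: integrable_patch => //.
      apply: (bmeas_integrable (mh p) _ (bmeas_test _ tT)).
      apply: le_lt_trans (finite_icell dx dy (cell_center x0 dx dy p.1 p.2)).
      apply: le_measure; rewrite ?inE//; first exact: measurable_icell.
      by move=> z [z1 z2]; split; [move: z1|move: z2]; rewrite /= !in_itv/= => /andP[-> /ltW].
    transitivity (\int[mu2]_z \sum_(p <- ibox M) g p z).
      apply: eq_Rintegral => z _.
      have [T0|nz] := eqVneq (Th psi z) 0.
        by rewrite T0 mulr0 big1// => p _; rewrite /g patchE T0 if_same mulr0.
      have [z1 z2] := Hr1 z nz; have [_ H1] := HM1 z z1 z2.
      rewrite (@big_subseq0 _ _ _ [:: cell_index x0 dx dy z]) //.
      + rewrite big_cons big_nil addr0 /g patchE -(cell_index_hcell x0 dx0 dy0) eqxx.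
        by [].
      + exact: uniq_ibox.
      + move=> p; rewrite inE => /eqP->; rewrite mem_ibox.
        have H : (lev z <= M)%N by rewrite (leq_trans H1)// leq_maxl.
        by rewrite !(leq_trans _ H)// /lev /level -?addnA ?leq_addr// addnCA leq_addr.
      + move=> p; rewrite inE /g patchE -(cell_index_hcell x0 dx0 dy0) eq_sym => /negbTE->.
        by rewrite mulr0.
    rewrite (Rintegral_bigsum (ibox M) measurableT (fun p => integrable_scale (w p.1 p.2) (intg p))).2.
    by apply: eq_bigr => p _; rewrite RintegralZl// [in RHS]Rintegral_mkcond.
  transitivity (\sum_(p <- ibox M) \int[mu2]_z (w p.1 p.2 * f p z * psi z)).
    apply: eq_bigr => p _; have [intf _ E _] := Hf p.
    rewrite integral_hcell// E//.
    rewrite -RintegralZl//; last exact: (integrable_mul_bmeas intf (bmeas_test setT tpsi)).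
    by apply: eq_Rintegral => z _; rewrite mulrA.
  rewrite -(Rintegral_bigsum (ibox M) measurableT _).2; last first.
    move=> p; exact: (integrable_mul_bmeas (inth p) (bmeas_test setT tpsi)).
  apply: eq_Rintegral => z _; rewrite -mulr_suml -/(S M z).
  have [->|nz] := eqVneq (psi z) 0; first by rewrite !mulr0.
  have [z1 z2] := Hr2 z nz; have [_ H2] := HM2 z z1 z2.
  by rewrite S_stable// (leq_trans H2)// leq_maxr.
- move=> i j; pose c := cell_center x0 dx dy i j.
  have mC := measurable_icell dx dy c.
  have [r Hr] := icell_in_box dx dy c.
  have [M' HM'] := Fbox r; pose M := maxn M' (`|i| + `|j| + 1)%N.
  have FS z : icell dx dy c z -> F z = S M z.
    move=> Cz; have [z1 z2] := Hr z Cz; have [_ H] := HM' z z1 z2.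
    by rewrite S_stable// (leq_trans H)// leq_maxl.
  rewrite cell_averageE; last first.
    rewrite (_ : F \_ _ = S M \_ (icell dx dy c)).
      by apply: integrable_patch => //; exact: integrable_restrict.
    by apply/funext => z; rewrite !patchE; case: ifP => // /set_mem/FS.
  congr (_ * _).
  transitivity (\int[mu2]_(z in icell dx dy c) S M z).
    by apply: eq_Rintegral => z /set_mem; exact: FS.
  rewrite (Rintegral_bigsum (ibox M) mC (fun p => integrable_restrict mC (inth p))).2.
  transitivity (\sum_(p <- ibox M) w p.1 p.2 * (tri a1 a2 a3 (i - p.1) * tri b1 b2 b3 (j - p.2))).
    apply: eq_bigr => p _; have [intf _ _ mf] := Hf p.
    rewrite RintegralZl//; last exact: integrable_restrict.
    rewrite -mf; congr (_ * _); congr (Rintegral _ (icell dx dy _) _).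
    by rewrite /c /cell_center /= !intrB; congr pair; ring.
  rewrite big_allpairs /=.
  transitivity (\sum_(k <- irange M) conv3 b1 b2 b3 (w k) j * tri a1 a2 a3 (i - k)).
    apply: eq_bigr => k _; rewrite -(@sum_tri b1 b2 b3 M j); last exact: level_max2.
    by rewrite mulr_suml; apply: eq_bigr => l _; ring.
  by apply: sum_tri; exact: level_max1.
Qed.

Lemma has_grid_average_distr x0 dx dy L avg i j : has_grid_average x0 dx dy L avg ->
  distr_cell_average dx dy L (cell_center x0 dx dy i j) (avg i j).
Proof.
move=> [f [mf locf Lf avgf]]; exists f; split => //; split => // K cK.
have [r Kr] := compact_in_box cK; have [g intg fg] := locf r.
have mK := compact_measurable_plane cK.
have /integrableP[_ fin] := integrable_restrict mK intg.
apply: le_lt_trans fin; rewrite le_eqVlt; apply/orP; left; apply/eqP.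
apply: eq_integral => z /set_mem Kz; have [z1 z2] := Kr z Kz.
by rewrite /= (fg z z1 z2).
Qed.

Lemma has_grid_averageD x0 dx dy L1 L2 avg1 avg2 :
  has_grid_average x0 dx dy L1 avg1 -> has_grid_average x0 dx dy L2 avg2 ->
  has_grid_average x0 dx dy (fun psi => L1 psi + L2 psi) (fun i j => avg1 i j + avg2 i j).
Proof.
move=> [f1 [mf1 loc1 Lf1 avgf1]] [f2 [mf2 loc2 Lf2 avgf2]].
exists (fun z => f1 z + f2 z); split.
- exact: measurable_funD.
- move=> r; have [g1 int1 fg1] := loc1 r; have [g2 int2 fg2] := loc2 r.
  exists (fun z => g1 z + g2 z); first exact: (integrableD measurableT int1 int2).
  by move=> z z1 z2; rewrite fg1// fg2.
- move=> psi tpsi; rewrite Lf1// Lf2// /distr_of_fun.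
  have [r Hr] := test_function_box tpsi.
  have loc (f : T2 -> R) (g : T2 -> R) : (forall z, `|z.1| <= r -> `|z.2| <= r -> f z = g z) ->
      forall z, f z * psi z = g z * psi z.
    move=> fg z; have [->|nz] := eqVneq (psi z) 0; first by rewrite !mulr0.
    by have [z1 z2] := Hr z nz; rewrite fg.
  have [g1 int1 fg1] := loc1 r; have [g2 int2 fg2] := loc2 r.
  have I1 := integrable_mul_bmeas int1 (bmeas_test setT tpsi).
  have I2 := integrable_mul_bmeas int2 (bmeas_test setT tpsi).
  transitivity (\int[mu2]_z (g1 z * psi z) + \int[mu2]_z (g2 z * psi z)).
    by congr (_ + _); apply: eq_Rintegral => z _; exact: loc.
  rewrite -RintegralD//; apply: eq_Rintegral => z _.
  by rewrite mulrDl (loc _ _ fg1) (loc _ _ fg2).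
- move=> i j; rewrite -avgf1 -avgf2; set c := cell_center _ _ _ _ _.
  have mC := measurable_icell dx dy c; have [r Hr] := icell_in_box dx dy c.
  have loc (f : T2 -> R) (g : T2 -> R) : mu2.-integrable setT (EFin \o g) ->
      (forall z, `|z.1| <= r -> `|z.2| <= r -> f z = g z) ->
      mu2.-integrable (icell dx dy c) (EFin \o f).
    move=> intg fg; apply: eq_integrable (integrable_restrict mC intg) => //.
    by move=> z /set_mem Cz; have [z1 z2] := Hr z Cz; rewrite /= fg.
  have [g1 int1 fg1] := loc1 r; have [g2 int2 fg2] := loc2 r.
  have I1 := loc _ _ int1 fg1; have I2 := loc _ _ int2 fg2.
  have I12 : mu2.-integrable (icell dx dy c) (EFin \o (fun z => f1 z + f2 z)) := integrableD mC I1 I2.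
  rewrite !cell_averageE; [|exact: integrable_patch..].
  by rewrite RintegralD// mulrDr.
Qed.

Lemma has_grid_average_ext x0 dx dy L L' avg avg' : has_grid_average x0 dx dy L avg ->
  (forall psi, test_function psi -> L' psi = L psi) -> (forall i j, avg i j = avg' i j) ->
  has_grid_average x0 dx dy L' avg'.
Proof.
move=> [f [mf locf Lf avgf]] eL eavg; exists f; split => //.
  by move=> psi tpsi; rewrite eL// Lf.
by move=> i j; rewrite avgf eavg.
Qed.

End GridAverages.

(** * The multidimensional Godunov scheme *)

Section Propagation.
#[local] Opaque derive waveW waveZ sin cos pi Rintegral evo sheet smear.
Context {R : realType}.
Implicit Types (psi f g h : R * R -> R) (Lam : (R * R -> R) -> R).

Notation zero := (fun _ : R * R => 0 : R).

Lemma distribution0 Lam : is_distribution Lam -> Lam zero = 0.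
Proof.
move=> [lin _]; have := lin (-1) _ _ (@test_function0 R) (@test_function0 R).
rewrite (_ : (fun _ => _) = zero); last by apply/funext => z; rewrite mulr0 addr0.
by rewrite mulN1r addNr.
Qed.

Lemma distributionD Lam f g : is_distribution Lam -> test_function f -> test_function g ->
  Lam (fun x => 1 * f x + g x) = Lam f + Lam g.
Proof. by move=> [lin _] tf tg; rewrite lin// mul1r. Qed.

Transparent evo.
Lemma distribution_evo Lam t f g h : is_distribution Lam ->
  test_function f -> test_function g -> test_function h ->
  Lam (evo t f g h) = Lam f + (Lam (waveZ t g) + Lam (waveW t h)).
Proof.
move=> dL tf tg th; have tZ := test_function_waveZ t tg; have tW := test_function_waveW t th.
have tZW : test_function (fun x => 1 * waveZ t g x + waveW t h x) by exact: test_function_lin.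
rewrite -(distributionD dL tZ tW); exact: (distributionD dL tf tZW).
Qed.
Opaque evo.

Lemma waveW0f t : waveW t zero = zero.
Proof. by apply/funext => x; exact: waveW_zero. Qed.

Lemma waveZ0f t : waveZ t zero = zero.
Proof.
apply/funext => x; have E := waveZ_lin t (-1) x (@test_function0 R) (@test_function0 R).
have F : (fun _ : R * R => -1 * 0 + 0 : R) = zero by apply/funext => z; rewrite mulr0 addr0.
by rewrite F in E; rewrite E mulN1r addNr.
Qed.

Lemma dv_l psi : dv psi zero = dX psi.
Proof. by apply/funext => x; rewrite /dv dY0 mul1r addr0. Qed.

Lemma dv_r psi : dv zero psi = dY psi.
Proof. by apply/funext => x; rewrite /dv dX0 mulr0 add0r. Qed.

Lemma lap0 : lap zero = zero.
Proof. by apply/funext => x; rewrite /lap dX0 dY0 dX0 dY0 addr0. Qed.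

Lemma distribution_waveZ_lap Lam t psi : is_distribution Lam -> test_function psi ->
  Lam (waveZ t (lap psi)) = Lam (waveZ t (dX (dX psi))) + Lam (waveZ t (dY (dY psi))).
Proof.
move=> dL tpsi.
have tx := test_function_dX (test_function_dX tpsi).
have ty := test_function_dY (test_function_dY tpsi).
rewrite -(distributionD dL (test_function_waveZ t tx) (test_function_waveZ t ty)).
congr Lam; apply/funext => x; rewrite -(waveZ_lin t 1 x tx ty) lapE; by [].
Qed.

Lemma drop_zeros_U (a b c d e : R) :
  a + 0 + 0 = b + (c + 0) + (0 + (d + 0)) + (0 + (0 + e)) -> a = b + c + d + e.
Proof. by rewrite !addr0 !add0r. Qed.

Lemma drop_zeros_V (a b c d e : R) :
  0 + a + 0 = 0 + (c + 0) + (b + (d + 0)) + (0 + (0 + e)) -> a = b + c + d + e.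
Proof. by rewrite !addr0 !add0r => ->; rewrite [c + _]addrCA addrA. Qed.

Lemma drop_zeros_P (a b c d e f : R) :
  0 + 0 + a = 0 + (0 + e) + (0 + (0 + f)) + (b + (c + d + 0)) -> a = b + c + d + e + f.
Proof. by rewrite !addr0 !add0r => ->; ring. Qed.

Variables (A : R) (U V P : R -> (R * R -> R) -> R) (T : R).
Hypotheses (A0 : 0 < A) (T0 : 0 < T) (sol : weak_acoustic A U V P).
Let r := A * T.

Lemma propagation_U psi : test_function psi ->
  U T psi = U 0 psi + U 0 (waveZ r (dX (dX psi))) + V 0 (waveZ r (dY (dX psi))) + P 0 (waveW r (dX psi)).
Proof.
move=> tpsi; have t0 := @test_function0 R; have tx := test_function_dX tpsi.
have [_ dVT dPT] := let: And3 H _ _ := sol in H T (ltW T0).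
have [dU dV dP] := let: And3 H _ _ := sol in H 0 (lexx 0).
have := acoustic_duality A0 sol tpsi t0 t0 T0.
rewrite /fieldU /fieldV /fieldP dv_l (distribution0 dVT) (distribution0 dPT) -/r.
rewrite dX0 dY0 lap0.
rewrite !distribution_evo//; [|exact: test_function_dY|exact: test_function_dX].
rewrite waveW0f waveZ0f !(distribution0 dU) !(distribution0 dV) !(distribution0 dP).
exact: drop_zeros_U.
Qed.

Lemma propagation_V psi : test_function psi ->
  V T psi = V 0 psi + U 0 (waveZ r (dX (dY psi))) + V 0 (waveZ r (dY (dY psi))) + P 0 (waveW r (dY psi)).
Proof.
move=> tpsi; have t0 := @test_function0 R; have ty := test_function_dY tpsi.
have [dUT _ dPT] := let: And3 H _ _ := sol in H T (ltW T0).
have [dU dV dP] := let: And3 H _ _ := sol in H 0 (lexx 0).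
have := acoustic_duality A0 sol t0 tpsi t0 T0.
rewrite /fieldU /fieldV /fieldP dv_r (distribution0 dUT) (distribution0 dPT) -/r.
rewrite dX0 dY0 lap0.
rewrite !distribution_evo//; [|exact: test_function_dY|exact: test_function_dX].
rewrite waveW0f waveZ0f !(distribution0 dU) !(distribution0 dV) !(distribution0 dP).
exact: drop_zeros_V.
Qed.

Lemma propagation_P psi : test_function psi ->
  P T psi = P 0 psi + P 0 (waveZ r (dX (dX psi))) + P 0 (waveZ r (dY (dY psi)))
    + U 0 (waveW r (dX psi)) + V 0 (waveW r (dY psi)).
Proof.
move=> tpsi; have t0 := @test_function0 R.
have [tx ty] := (test_function_dX tpsi, test_function_dY tpsi).
have [dUT dVT _] := let: And3 H _ _ := sol in H T (ltW T0).
have [dU dV dP] := let: And3 H _ _ := sol in H 0 (lexx 0).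
have := acoustic_duality A0 sol t0 t0 tpsi T0.
have dv0 : dv zero zero = zero by rewrite dv_l dX0.
rewrite /fieldU /fieldV /fieldP dv0 dX0 dY0 (distribution0 dUT) (distribution0 dVT) -/r.
rewrite !distribution_evo//; [|exact: test_function_lap].
rewrite waveW0f waveZ0f !(distribution0 dU) !(distribution0 dV) !(distribution0 dP).
rewrite (distribution_waveZ_lap r dP tpsi); exact: drop_zeros_P.
Qed.

End Propagation.

Section Scheme.
#[local] Opaque derive waveW waveZ sin cos pi Rintegral evo sheet smear.
Context {R : realType}.
Implicit Types (w : int -> int -> R).

Variables (c eps dx dy dt : R).
Hypotheses (c0 : 0 < c) (eps0 : 0 < eps) (dx0 : 0 < dx) (dy0 : 0 < dy) (dt0 : 0 < dt).
Let r := c / eps * dt.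
Hypotheses (rx : r <= dx) (ry : r <= dy).
Variable x0 : R * R.

Let r0 : 0 < r. Proof. by rewrite mulr_gt0// divr_gt0. Qed.

Let avg (T : (R * R -> R) -> R) (Th : (R * R -> R) -> R * R -> R) w a1 a2 a3 b1 b2 b3 :=
  has_grid_average x0 dx dy (fun psi => T (Th psi))
    (fun i j => 1 / (dx * dy) * conv3 a1 a2 a3 (fun k => conv3 b1 b2 b3 (w k) j) i).

Lemma initial_average (T : (R * R -> R) -> R) Th w a1 a2 a3 b1 b2 b3 :
  (forall phi, test_function phi -> T phi = distr_of_fun (recon x0 dx dy w) phi) ->
  stencil dx dy Th (fun i j => tri a1 a2 a3 i * tri b1 b2 b3 j) ->
  (forall psi, test_function psi -> test_function (Th psi)) ->
  avg T Th w a1 a2 a3 b1 b2 b3.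
Proof.
move=> T0 st tTh; apply: (has_grid_average_ext (recon_stencil x0 w dx0 dy0 st tTh)) => //.
by move=> psi tpsi; rewrite T0//; exact: tTh.
Qed.

Let tid psi : @test_function R psi -> test_function psi. Proof. by []. Qed.
Let tWX psi (H : @test_function R psi) := test_function_waveW r (test_function_dX H).
Let tWY psi (H : @test_function R psi) := test_function_waveW r (test_function_dY H).
Let tZXX psi (H : @test_function R psi) := test_function_waveZ r (test_function_dX (test_function_dX H)).
Let tZYX psi (H : @test_function R psi) := test_function_waveZ r (test_function_dY (test_function_dX H)).
Let tZXY psi (H : @test_function R psi) := test_function_waveZ r (test_function_dX (test_function_dY H)).
Let tZYY psi (H : @test_function R psi) := test_function_waveZ r (test_function_dY (test_function_dY H)).

Variables (u v p : int -> int -> R) (U V P : R -> (R * R -> R) -> R).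
Hypotheses (sol : acoustic_solution c eps U V P)
  (hU0 : has_initial_data U (recon x0 dx dy u))
  (hV0 : has_initial_data V (recon x0 dx dy v))
  (hP0 : has_initial_data P (recon x0 dx dy p)).

Let weak := acoustic_solution_weak sol.
Let A0 : 0 < c / eps. Proof. exact: divr_gt0. Qed.

Lemma grid_average_U : has_grid_average x0 dx dy (U dt) (fun i j =>
  u i j
  - c * dt / (2 * eps * dx) * (Dx p i j - Dxx u i j)
  - 1 / 2 * ((c * dt) ^+ 2 / (eps ^+ 2 * dx * dy))
    * (- (1 / (2 * pi)) * Dxx (Dyy u) i j - 1 / 4 * Dx (Dy v) i j + 1 / 4 * Dx (Dyy p) i j)).
Proof.
have H1 := initial_average hU0 (stencil_id dx0 dy0) tid.
have H2 := initial_average hU0 (stencil_ZXX r0 rx ry) tZXX.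
have H3 := initial_average hV0 (stencil_ZYX r0 rx ry) tZYX.
have H4 := initial_average hP0 (stencil_WX r0 rx ry) tWX.
apply: (has_grid_average_ext (has_grid_averageD (has_grid_averageD (has_grid_averageD H1 H2) H3) H4)).
  by move=> psi tpsi; exact: (propagation_U A0 dt0 weak tpsi).
move=> i j; rewrite /conv3 /Dx /Dy /Dxx /Dyy /r.
have := lt0r_neq0 (pi_gt0 R); move: (pi : R) => q q0.
have n1 := lt0r_neq0 eps0; have n2 := lt0r_neq0 dx0; have n3 := lt0r_neq0 dy0.
by field; rewrite q0 n1 n2 n3.
Qed.

Lemma grid_average_V : has_grid_average x0 dx dy (V dt) (fun i j =>
  v i j
  - c * dt / (2 * eps * dy) * (Dy p i j - Dyy v i j)
  - 1 / 2 * ((c * dt) ^+ 2 / (eps ^+ 2 * dx * dy))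
    * (- (1 / (2 * pi)) * Dxx (Dyy v) i j - 1 / 4 * Dx (Dy u) i j + 1 / 4 * Dxx (Dy p) i j)).
Proof.
have H1 := initial_average hV0 (stencil_id dx0 dy0) tid.
have H2 := initial_average hU0 (stencil_ZXY r0 rx ry) tZXY.
have H3 := initial_average hV0 (stencil_ZYY r0 rx ry) tZYY.
have H4 := initial_average hP0 (stencil_WY r0 rx ry) tWY.
apply: (has_grid_average_ext (has_grid_averageD (has_grid_averageD (has_grid_averageD H1 H2) H3) H4)).
  by move=> psi tpsi; exact: (propagation_V A0 dt0 weak tpsi).
move=> i j; rewrite /conv3 /Dx /Dy /Dxx /Dyy /r.
have := lt0r_neq0 (pi_gt0 R); move: (pi : R) => q q0.
have n1 := lt0r_neq0 eps0; have n2 := lt0r_neq0 dx0; have n3 := lt0r_neq0 dy0.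
by field; rewrite q0 n1 n2 n3.
Qed.

Lemma grid_average_P : has_grid_average x0 dx dy (P dt) (fun i j =>
  p i j
  - c * dt / (2 * eps * dx) * (Dx u i j - Dxx p i j)
  - c * dt / (2 * eps * dy) * (Dy v i j - Dyy p i j)
  - 1 / 2 * ((c * dt) ^+ 2 / (eps ^+ 2 * dx * dy))
    * (1 / 4 * Dx (Dyy u) i j + 1 / 4 * Dxx (Dy v) i j - 2 * (1 / (2 * pi)) * Dxx (Dyy p) i j)).
Proof.
have H1 := initial_average hP0 (stencil_id dx0 dy0) tid.
have H2 := initial_average hP0 (stencil_ZXX r0 rx ry) tZXX.
have H3 := initial_average hP0 (stencil_ZYY r0 rx ry) tZYY.
have H4 := initial_average hU0 (stencil_WX r0 rx ry) tWX.
have H5 := initial_average hV0 (stencil_WY r0 rx ry) tWY.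
apply: (has_grid_average_ext (has_grid_averageD (has_grid_averageD (has_grid_averageD
  (has_grid_averageD H1 H2) H3) H4) H5)).
  by move=> psi tpsi; exact: (propagation_P A0 dt0 weak tpsi).
move=> i j; rewrite /conv3 /Dx /Dy /Dxx /Dyy /r.
have := lt0r_neq0 (pi_gt0 R); move: (pi : R) => q q0.
have n1 := lt0r_neq0 eps0; have n2 := lt0r_neq0 dx0; have n3 := lt0r_neq0 dy0.
by field; rewrite q0 n1 n2 n3.
Qed.

End Scheme.

Theorem mainTheorem5 (R : realType) (c eps dx dy dt : R)
  (hc : 0 < c) (heps : 0 < eps) (hdx : 0 < dx) (hdy : 0 < dy) (hdt : 0 < dt)
  (hcfl : c * dt / eps <= Num.min dx dy)
  (x0 : R * R) (u v p : int -> int -> R)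
  (hu : bounded_grid u) (hv : bounded_grid v) (hp : bounded_grid p)
  (U V P : R -> (R * R -> R) -> R)
  (hsol : acoustic_solution c eps U V P)
  (hU0 : has_initial_data U (recon x0 dx dy u))
  (hV0 : has_initial_data V (recon x0 dx dy v))
  (hP0 : has_initial_data P (recon x0 dx dy p))
  (i j : int) :
  [/\ distr_cell_average dx dy (U dt) (cell_center x0 dx dy i j)
        (u i j
         - c * dt / (2 * eps * dx) * (Dx p i j - Dxx u i j)
         - 1 / 2 * ((c * dt) ^+ 2 / (eps ^+ 2 * dx * dy))
           * (- (1 / (2 * pi)) * Dxx (Dyy u) i j
              - 1 / 4 * Dx (Dy v) i j
              + 1 / 4 * Dx (Dyy p) i j)),
      distr_cell_average dx dy (V dt) (cell_center x0 dx dy i j)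
        (v i j
         - c * dt / (2 * eps * dy) * (Dy p i j - Dyy v i j)
         - 1 / 2 * ((c * dt) ^+ 2 / (eps ^+ 2 * dx * dy))
           * (- (1 / (2 * pi)) * Dxx (Dyy v) i j
              - 1 / 4 * Dx (Dy u) i j
              + 1 / 4 * Dxx (Dy p) i j)) &
      distr_cell_average dx dy (P dt) (cell_center x0 dx dy i j)
        (p i j
         - c * dt / (2 * eps * dx) * (Dx u i j - Dxx p i j)
         - c * dt / (2 * eps * dy) * (Dy v i j - Dyy p i j)
         - 1 / 2 * ((c * dt) ^+ 2 / (eps ^+ 2 * dx * dy))
           * (1 / 4 * Dx (Dyy u) i j
              + 1 / 4 * Dxx (Dy v) i j
              - 2 * (1 / (2 * pi)) * Dxx (Dyy p) i j))].
Proof.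
move: hcfl; rewrite le_min mulrAC => /andP[rx ry].
split.
- exact: (has_grid_average_distr i j (grid_average_U hc heps hdx hdy hdt rx ry hsol hU0 hV0 hP0)).
- exact: (has_grid_average_distr i j (grid_average_V hc heps hdx hdy hdt rx ry hsol hU0 hV0 hP0)).
- exact: (has_grid_average_distr i j (grid_average_P hc heps hdx hdy hdt rx ry hsol hU0 hV0 hP0)).
Qed.
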